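(* Assume in addition $\kappa\in C^3_{\mathrm{per}}([0,T];L^\infty(D))$. Let $\widehat u^\omega_{h,K}\in\widehat V_{h,K}$ and $\omega_{h,K}\in\mathbb C$ be an eigenmode and eigenvalue of the fully discrete coupled harmonics eigenvalue problem with $\operatorname{Re}\omega_{h,K}\in(-\Omega/2,\Omega/2]$ and $\|\widehat u^\omega_{h,K}\|_{K,D}=1$, and let $$U^\omega_{h,K}(t)=\sum_{n=-K}^K\big(\widehat u^\omega_{h,K}\big)_n e^{-i(\omega_{h,K}+n\Omega)t}.$$ Let $u^{h,K,\omega}_{\mathrm{init}}:[0,\infty)\to X_h$ be the solution of the spatially semi-discrete initial value problem $$(v_h,\partial_t^2u_h(t))_{L^2(D)}+(\nabla v_h,\kappa(t)\nabla u_h(t))_{L^2(D)}+\kappa_0(v_h,\partial_tu_h(t))_{L^2(\Gamma)}=0\quad\text{for all }v_h\in X_h,\ t\ge0,$$ with $u^{h,K,\omega}_{\mathrm{init}}(0)=U^\omega_{h,K}(0)$ and $\partial_tu^{h,K,\omega}_{\mathrm{init}}(0)=\partial_tU^\omega_{h,K}(0)$. Put $d(t)=u^{h,K,\omega}_{\mathrm{init}}(t)-U^\omega_{h,K}(t)$. Then, for $t\ge 0$, $$\|\partial_td(t)\|_{L^2(D)}+\|\nabla d(t)\|_{L^2(D)}\le C\,\frac{C_{\mathrm{inv}}(h)^4}{K^2},$$ and $$\Big\|\operatorname{Re}\big(u^{h,K,\omega}_{\mathrm{init}}(0)e^{-i\omega_{h,K}T}\big)-\operatorname{Re}u^{h,K,\omega}_{\mathrm{init}}(T)\Big\|_{L^2(D)}\le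 C\,\frac{C_{\mathrm{inv}}(h)^4}{K^2}.$$ The constant $C$ is independent of $h$ and $K$, but depends on $t$, $T$, $\Omega$, $\kappa$ and $D$.
   Context: $D\subset\mathbb R^d$ is a bounded Lipschitz domain with boundary $\Gamma$, $\kappa_0>0$ is a fixed constant, $T>0$, $\Omega=2\pi/T$. The real-valued coefficient $\kappa\in C^1_{\mathrm{per}}(0,T;L^\infty(D))$ is $T$-periodic and $C^1$ in time with values in $L^\infty(D)$, with $0<c_\kappa=\operatorname*{ess\,inf}_{D\times[0,T]}\kappa\le\operatorname*{ess\,sup}_{D\times[0,T]}\kappa=C_\kappa<\infty$. Its Fourier coefficients are defined by $\kappa(x,t)=\sum_{n\in\mathbb Z}\widehat\kappa_n(x)e^{-in\Omega t}$. $C^3_{\mathrm{per}}$ denotes $T$-periodic $C^3$ functions of time. $(X_h)_{h>0}$ is a family of finite-dimensional subspaces of (complex-valued) $H^1(D)$, with mesh width $h\to0$, and $C_{\mathrm{inv}}(h)$ is a constant with $\|\nabla u_h\|_{L^2(D)}\le C_{\mathrm{inv}}(h)\|u_h\|_{L^2(D)}$ for all $u_h\in X_h$; it tends to infinity as $h\to0$. For a positive integer $K$ put $\widehat V_{h,K}=X_h^{2K+1}$ with elements $\widehat u=(\widehat u_n)_{|n|\le K}$. Let $(\widehat\varphi,\widehat\psi)_{K,D}=\sum_{|n|\le K}(\widehat\varphi_n,\widehat\psi_n)_{L^2(D)}$, $(\widehat\varphi,\widehat\psi)_{K,\Gamma}=\sum_{|n|\le K}(\widehat\varphi_n,\widehat\psi_n)_{L^2(\Gamma)}$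 (conjugate-linear in the test function, written first), $\|\widehat\varphi\|_{K,D}^2=(\widehat\varphi,\widehat\varphi)_{K,D}$, $(\mathcal D\widehat u)_n=-in\Omega\widehat u_n$, and $(\mathcal T_\kappa\nabla\widehat u)_n=\sum_{|m|\le K}\widehat\kappa_{n-m}\nabla\widehat u_m$ with the gradient acting entrywise. Fully discrete coupled harmonics eigenvalue problem: find $\omega_{h,K}\in\mathbb C$ and a nontrivial $(\widehat u,\widehat z)\in\widehat V_{h,K}^2$ such that for all $(\widehat v,\widehat\eta)\in\widehat V_{h,K}^2$ $$(\widehat v,\mathcal D\widehat u-\widehat z)_{K,D}=i\omega_{h,K}(\widehat v,\widehat u)_{K,D},$$ $$(\widehat\eta,\mathcal D\widehat z)_{K,D}+(\nabla\widehat\eta,\mathcal T_\kappa\nabla\widehat u)_{K,D}+\kappa_0(\widehat\eta,\widehat z)_{K,\Gamma}=i\omega_{h,K}(\widehat\eta,\widehat z)_{K,D}.$$ The component $\widehat u=\widehat u^\omega_{h,K}$ is called the eigenmode.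
   Formalization: The estimates are stated for those h with C_inv(h) ≥ c, for any fixed c > 0, with C depending also on c and κ₀; without a positive lower bound on C_inv(h) they fail, e.g. for X_h = span(1+εx) on (0,1), K = 1, κ = 2+cos(2Ωt), where d is of order ε², not ε⁴. *)

(* Defs.v *)
From HB Require Import structures.
From mathcomp Require Import all_boot all_order all_algebra.
From mathcomp Require Import all_classical all_reals all_analysis ess_sup_inf.
From mathcomp Require Export complex.

Set Implicit Arguments.
Unset Strict Implicit.
Unset Printing Implicit Defensive.
Import Order.TTheory GRing.Theory Num.Theory.
Import numFieldNormedType.Exports.

Local Open Scope classical_set_scope.
Local Open Scope complex_scope.
Local Open Scope ring_scope.

(* not the [Re] and [Im] of [Num.Theory], which are [R[i]]-valued *)
Notation Re := complex.Re.
Notation Im := complex.Im.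

Section Euclidean.
Context {R : realType} {d : nat}.
Implicit Types x y : 'rV[R]_d.

Definition dotp x y : R := \sum_i x 0 i * y 0 i.

(* The library norm on ['rV[R]_d] is the sup norm. *)
Definition enorm x : R := Num.sqrt (dotp x x).

Definition boundary (A : set 'rV[R]_d) := closure A `\` A°.

(* Near each boundary point, in suitable orthonormal coordinates with last axis
   [nu], the domain is the strict epigraph of a Lipschitz function [g] of the
   projection of the point on the hyperplane orthogonal to [nu]. *)
Definition lipschitz_boundary (D : set 'rV[R]_d) :=
  forall x, boundary D x ->
    exists (r L : R) (nu : 'rV[R]_d) (g : 'rV[R]_d -> R),
      [/\ 0 < r, enorm nu = 1,
          forall y z, `|g y - g z| <= L * enorm (y - z) &
          forall y, enorm (y - x) < r ->
            (D y <-> g (y - dotp y nu *: nu) < dotp y nu)].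

Definition bounded_lipschitz_domain (D : set 'rV[R]_d) :=
  [/\ open D, connected D, D !=set0, bounded_set D & lipschitz_boundary D].

End Euclidean.

(* The type [T] with all its subsets measurable: [mu_ext] on it is the outer
   measure generated by a gauge defined on all subsets of [T]. *)
Definition all_sets (T : Type) : Type := T.

Section AllSets.
Context (T : pointedType).
HB.instance Definition _ := Pointed.on (all_sets T).
Let all_measurable : set (set (all_sets T)) := setT.
Let all0 : all_measurable set0. Proof. by []. Qed.
Let allC A : all_measurable A -> all_measurable (~` A). Proof. by []. Qed.
Let allU (F : (set (all_sets T))^nat) :
  (forall i, all_measurable (F i)) -> all_measurable (\bigcup_i F i).
Proof. by []. Qed.
HB.instance Definition _ :=
  @isMeasurable.Build default_measure_display (all_sets T) all_measurable
    all0 allC allU.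
End AllSets.

Section Measures.
Context {R : realType} {d : nat}.
Local Notation V := 'rV[R]_d.
Local Open Scope ereal_scope.

Definition box (a b : V) : set V :=
  [set x | forall i, (a 0%R i <= x 0%R i < b 0%R i)%R].

Definition box_gauge (A : set (all_sets V)) : \bar R :=
  if A == set0 then 0 else
  ereal_inf [set (\prod_i (p.2 0%R i - p.1 0%R i))%R%:E | p in
    [set p : V * V | (forall i, p.1 0%R i <= p.2 0%R i)%R /\
                     A `<=` box p.1 p.2]].

Lemma box_gauge0 : box_gauge set0 = 0.
Proof. by rewrite /box_gauge eqxx. Qed.

Lemma box_gauge_ge0 A : 0 <= box_gauge A.
Proof.
rewrite /box_gauge; case: ifP => // _.
apply: le_ereal_inf_tmp => _ [p [hp _] <-].
by rewrite lee_fin; apply: prodr_ge0 => i _; rewrite subr_ge0.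
Qed.

Definition lebesgue_outer (A : set V) : \bar R := mu_ext box_gauge A.

HB.instance Definition _ := isOuterMeasure.Build R V lebesgue_outer
  (mu_ext0 box_gauge0 box_gauge_ge0) (mu_ext_ge0 box_gauge_ge0)
  (le_mu_ext box_gauge) (mu_ext_sigma_subadditive box_gauge_ge0).

End Measures.

Section Hausdorff.
Context {R : realType} {d : nat}.
Local Notation V := 'rV[R]_d.
Local Open Scope ereal_scope.

Definition ediam (A : set V) : \bar R :=
  ereal_sup [set (enorm (p.1 - p.2))%:E | p in A `*` A].

Definition unit_ball_volume (s : nat) : R :=
  fine (lebesgue_outer [set x : 'rV[R]_s | (enorm x < 1)%R]).

Definition diam_gauge (s : nat) (delta : R) (A : set (all_sets V)) : \bar R :=
  if A == set0 then 0 else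
  if ediam A <= delta%:E then
    (unit_ball_volume s * (fine (ediam A) / 2) ^+ s)%R%:E
  else +oo.

Lemma diam_gauge0 s delta : diam_gauge s delta set0 = 0.
Proof. by rewrite /diam_gauge eqxx. Qed.

Lemma diam_gauge_ge0 s delta A : 0 <= diam_gauge s delta A.
Proof.
rewrite /diam_gauge; case: ifPn => // /set0P[x Ax].
case: ifPn => // _; rewrite lee_fin; apply: mulr_ge0.
  by rewrite fine_ge0//; exact: outer_measure_ge0.
apply: exprn_ge0; rewrite divr_ge0// fine_ge0//.
apply: (@le_trans _ _ (enorm (x - x))%:E); first by rewrite lee_fin sqrtr_ge0.
by apply: ereal_sup_ubound; exists (x, x).
Qed.

(** Hausdorff outer measure of dimension [s], normalised so as to be the usual
    surface measure *)
Definition hausdorff_outer (s : nat) (A : set V) : \bar R :=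
  ereal_sup [set mu_ext (diam_gauge s delta) A | delta in [set r | (0 < r)%R]].

Section hausdorff_outer_measure.
Variable s : nat.
Local Notation H := (hausdorff_outer s).

Let H_ge0 A : 0 <= H A.
Proof.
apply: (@le_trans _ _ (mu_ext (diam_gauge s 1) A)).
  exact/mu_ext_ge0/diam_gauge_ge0.
by apply: ereal_sup_ubound; exists 1%R => //=; exact: ltr01.
Qed.

Let H0 : H set0 = 0.
Proof.
apply/eqP; rewrite eq_le H_ge0 andbT; apply: ge_ereal_sup => _ [r _ <-].
by rewrite mu_ext0//; [exact: diam_gauge0|exact: diam_gauge_ge0].
Qed.

Let H_le : {homo H : A B / A `<=` B >-> A <= B}.
Proof.
move=> A B AB; apply: ge_ereal_sup => _ [r r0 <-].
apply: (le_trans (le_mu_ext (diam_gauge s r) AB)).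
by apply: ereal_sup_ubound; exists r.
Qed.

Let H_sub : sigma_subadditive H.
Proof.
move=> F; apply: ge_ereal_sup => _ [r r0 <-].
apply: (le_trans (mu_ext_sigma_subadditive (diam_gauge_ge0 s r) F)).
apply: lee_nneseries => [n _ _|n _]; first exact/mu_ext_ge0/diam_gauge_ge0.
by apply: ereal_sup_ubound; exists r.
Qed.

HB.instance Definition _ := isOuterMeasure.Build R V H H0 H_ge0 H_le H_sub.

End hausdorff_outer_measure.
End Hausdorff.

Section Restriction.
Context {R : realType} {T : Type}.
Local Open Scope ereal_scope.

Definition outer_restr (mu : set T -> \bar R) (A X : set T) := mu (X `&` A).

Variables (mu : {outer_measure set T -> \bar R}) (A : set T).

Let r0 : outer_restr mu A set0 = 0.
Proof. by rewrite /outer_restr set0I outer_measure0. Qed.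

Let r_ge0 X : 0 <= outer_restr mu A X.
Proof. exact: outer_measure_ge0. Qed.

Let r_le : {homo outer_restr mu A : X Y / X `<=` Y >-> X <= Y}.
Proof. by move=> X Y XY; apply: le_outer_measure; exact: setSI. Qed.

Let r_sub : sigma_subadditive (outer_restr mu A).
Proof.
by move=> F; rewrite /outer_restr setI_bigcupl; exact: outer_measure_sigma_subadditive.
Qed.

HB.instance Definition _ :=
  isOuterMeasure.Build R T (outer_restr mu A) r0 r_ge0 r_le r_sub.

End Restriction.


Section DomainMeasures.
Context {R : realType} {d : nat}.

Definition vol_outer (D : set 'rV[R]_d) : {outer_measure set 'rV[R]_d -> \bar R} :=
  outer_restr lebesgue_outer D.

Definition surf_outer (D : set 'rV[R]_d) :
    {outer_measure set 'rV[R]_d -> \bar R} :=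
  outer_restr (hausdorff_outer d.-1) (boundary D).

(* Both are the measures on R^d supported on D, resp. on its boundary: integrals
   over D and over the boundary are integrals against them over the whole
   space. *)
Definition vol (D : set 'rV[R]_d) :
    {measure set (caratheodory_type (vol_outer D)) -> \bar R} := vol_outer D.

Definition surf (D : set 'rV[R]_d) :
    {measure set (caratheodory_type (surf_outer D)) -> \bar R} := surf_outer D.

End DomainMeasures.

Definition cexp {R : realType} (z : R[i]) : R[i] :=
  (expR (Re z))%:C * (cos (Im z) +i* sin (Im z)).

Section ComplexL2.
Context {R : realType} {disp : measure_display} {T : measurableType disp}.
Variable mu : {measure set T -> \bar R}.
Implicit Types f g : T -> R[i].

Definition cintegral f : R[i] :=
  (\int[mu]_x Re (f x)) +i* (\int[mu]_x Im (f x)).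

Definition L2 f :=
  (fun x => Re (f x)) \in Lfun mu 2%:E /\ (fun x => Im (f x)) \in Lfun mu 2%:E.

(* conjugate-linear in the first argument *)
Definition inner f g : R[i] := cintegral (fun x => (f x)^* * g x).

Definition norm2 f : R := Num.sqrt (Re (inner f f)).

End ComplexL2.

Section H1.
Context {R : realType} {d : nat}.
Local Notation V := 'rV[R]_d.
Local Notation C := R[i].

Definition partial (i : 'I_d) (f : V -> R) : V -> R := 'D_(delta_mx 0 i) f.

Fixpoint Ck (k : nat) (f : V -> R) : Prop :=
  if k is k'.+1 then
    continuous f /\ forall i, (forall x, derivable f x (delta_mx 0 i)) /\
                              Ck k' (partial i f)
  else continuous f.

Definition smooth (f : V -> R) := forall k, Ck k f.

Definition csmooth (f : V -> C) :=
  smooth (fun x => Re (f x)) /\ smooth (fun x => Im (f x)).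

Definition cpartial (i : 'I_d) (f : V -> C) : V -> C := fun x =>
  partial i (fun y => Re (f y)) x +i* partial i (fun y => Im (f y)) x.

Definition test_function (D : set V) (phi : V -> R) :=
  [/\ smooth phi, compact (closure [set x | phi x != 0]) &
      closure [set x | phi x != 0] `<=` D].

(* A function together with its weak gradient and its boundary trace.  As these
   are determined by the function up to null sets, the triples satisfying [H1]
   below are representatives of the elements of H^1(D); carrying them along
   makes gradient and trace linear on the nose. *)
Definition H1fun : Type := ((V -> C) * ('I_d -> V -> C) * (V -> C))%type.
HB.instance Definition _ := GRing.Lmodule.on H1fun.

Definition fn (u : H1fun) : V -> C := u.1.1.
Definition grad (u : H1fun) : 'I_d -> V -> C := u.1.2.
Definition trace (u : H1fun) : V -> C := u.2.

Definition weak_gradient (D : set V) (u : V -> C) (g : 'I_d -> V -> C) :=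
  forall i phi, test_function D phi ->
    cintegral (vol D) (fun x => u x * (partial i phi x)%:C) =
    - cintegral (vol D) (fun x => g i x * (phi x)%:C).

(* [tr] is the value at [u] of the continuous extension to H^1(D) of the
   restriction of smooth functions to the boundary. *)
Definition boundary_trace (D : set V) (u : V -> C) (g : 'I_d -> V -> C)
    (tr : V -> C) :=
  exists phi : nat -> V -> C,
    [/\ forall n, csmooth (phi n),
        norm2 (vol D) (phi n \- u) @[n --> \oo] --> (0 : R),
        forall i, norm2 (vol D) (cpartial i (phi n) \- g i) @[n --> \oo] -->
                  (0 : R) &
        norm2 (surf D) (phi n \- tr) @[n --> \oo] --> (0 : R)].

Definition H1 (D : set V) (u : H1fun) :=
  [/\ L2 (vol D) (fn u), forall i, L2 (vol D) (grad u i),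
      L2 (surf D) (trace u), weak_gradient D (fn u) (grad u) &
      boundary_trace D (fn u) (grad u) (trace u)].

Definition normD (D : set V) (u : H1fun) : R := norm2 (vol D) (fn u).

Definition inner_grad (D : set V) (g g' : 'I_d -> V -> C) : C :=
  \sum_i inner (vol D) (g i) (g' i).

Definition norm_grad (D : set V) (u : H1fun) : R :=
  Num.sqrt (Re (inner_grad D (grad u) (grad u))).

(* The complex span of a basis; linear independence is that of classes of
   functions almost everywhere equal. *)
Definition fin_dim_subspace (D : set V) (X : set H1fun) :=
  exists (N : nat) (b : 'I_N -> H1fun),
    [/\ forall j, H1 D (b j),
        forall c : 'I_N -> C,
          {ae vol D, forall x, fn (\sum_j c j *: b j) x = 0} ->
          forall j, c j = 0 &
        X = [set u | exists c : 'I_N -> C, u = \sum_j c j *: b j]].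

(* [w] is the derivative in L^2(D) at time [t] of [u], defined on [0, oo[; the
   derivative at 0 is one-sided. *)
Definition time_derivative (D : set V) (u : R -> H1fun) (t : R) (w : H1fun) :=
  normD D ((s^-1)%:C *: (u (t + s) - u t) - w)
    @[s --> within [set s | 0 <= t + s] 0^'] --> (0 : R).

End H1.
Arguments H1fun : clear implicits.

Section Coefficient.
Context {R : realType} {d : nat}.
Local Notation V := 'rV[R]_d.
Variable D : set V.

Definition Linf_norm (f : V -> R) : \bar R := Lnorm (vol D) +oo%E (EFin \o f).

(* The curves [k : R -> L^oo(D)] of class C^n *)
Fixpoint Ck_Linf (n : nat) (k : R -> V -> R) : Prop :=
  [/\ forall t, k t \in Lfun (vol D) +oo%E,
      forall t, Linf_norm (k s \- k t) @[s --> t] --> 0%E &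
      if n is n'.+1 then
        exists k' : R -> V -> R,
          (forall t, Linf_norm (fun x => s^-1 * (k (t + s) x - k t x) - k' t x)
                       @[s --> 0^'] --> 0%E) /\
          Ck_Linf n' k'
      else True].

Definition Ck_per_Linf (n : nat) (T : R) (k : R -> V -> R) :=
  Ck_Linf n k /\ forall t, {ae vol D, forall x, k (t + T) x = k t x}.

Lemma measurable_cylinder (T : R) :
  measurable ([set: caratheodory_type (vol_outer D)] `*`
              (`[0, T] : set (measurableTypeR R))).
Proof. by apply: measurableX => //; exact: measurable_itv. Qed.

(* Lebesgue measure on D x [0,T] *)
Definition cylinder_measure (T : R) :=
  mrestr (vol D \x (@lebesgue_measure R))%E (measurable_cylinder T).

Definition kappa_inf (T : R) (k : R -> V -> R) : \bar R :=
  ess_inf (cylinder_measure T) (fun p => (k p.2 p.1)%:E).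

Definition kappa_sup (T : R) (k : R -> V -> R) : \bar R :=
  ess_sup (cylinder_measure T) (fun p => (k p.2 p.1)%:E).

(* standing assumptions; joint measurability fixes a representative of [k] for
   which the integrals over the period below make sense pointwise *)
Definition admissible_coefficient (T : R) (k : R -> V -> R) :=
  [/\ measurable_fun setT
        (fun p : caratheodory_type (vol_outer D) * measurableTypeR R =>
           k p.2 p.1),
      Ck_per_Linf 1 T k, (0 < kappa_inf T k)%E & (kappa_sup T k < +oo)%E].

Definition frequency (T : R) : R := 2 * pi / T.

Definition iunit : R[i] := 0 +i* 1.

(* Sign convention: k(t) = sum_n (fourier n) e^(-i n Omega t) *)
Definition fourier (T : R) (k : R -> V -> R) (n : int) (x : V) : R[i] :=
  (T^-1)%:C *
  ((\int[@lebesgue_measure R]_(t in `[0, T])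
      (k t x * cos (n%:~R * frequency T * t))) +i*
   (\int[@lebesgue_measure R]_(t in `[0, T])
      (k t x * sin (n%:~R * frequency T * t)))).

End Coefficient.

Section Harmonics.
Context {R : realType} {d : nat}.
Local Notation V := 'rV[R]_d.
Local Notation C := R[i].
Variables (D : set V) (kappa0 T : R) (kappa : R -> V -> R) (K : nat).
Local Notation Omega := (frequency T).

(* families indexed by |n| <= K: the index [j] stands for [n = j - K] *)
Definition harmonics (E : Type) : Type := 'I_(K.*2.+1) -> E.

Definition harm (j : 'I_(K.*2.+1)) : int := (j%:Z - K%:Z)%R.

Definition innerK_D (v u : harmonics (H1fun R d)) : C :=
  \sum_n inner (vol D) (fn (v n)) (fn (u n)).

Definition innerK_bd (v u : harmonics (H1fun R d)) : C :=
  \sum_n inner (surf D) (trace (v n)) (trace (u n)).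

Definition innerK_grad (g g' : harmonics ('I_d -> V -> C)) : C :=
  \sum_n inner_grad D (g n) (g' n).

Definition normK (u : harmonics (H1fun R d)) : R := Num.sqrt (Re (innerK_D u u)).

Definition Dop (u : harmonics (H1fun R d)) : harmonics (H1fun R d) :=
  fun n => (- iunit * ((harm n)%:~R * Omega)%:C) *: u n.

Definition Tkappa_grad (u : harmonics (H1fun R d)) : harmonics ('I_d -> V -> C) :=
  fun n i x => \sum_m fourier T kappa (harm n - harm m) x * grad (u m) i x.

Definition gradK (u : harmonics (H1fun R d)) : harmonics ('I_d -> V -> C) :=
  fun n => grad (u n).

(* [u] and [omega] are an eigenmode and eigenvalue of the fully discrete
   problem for the space [X] *)
Definition eigenmode (X : set (H1fun R d)) (omega : C) (u : harmonics (H1fun R d)) :=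
  (forall n, X (u n)) /\
  exists z : harmonics (H1fun R d),
    [/\ forall n, X (z n), normK u != 0 \/ normK z != 0,
        forall v : harmonics (H1fun R d), (forall n, X (v n)) ->
          innerK_D v (fun n => Dop u n - z n) = iunit * omega * innerK_D v u &
        forall eta : harmonics (H1fun R d), (forall n, X (eta n)) ->
          innerK_D eta (Dop z) + innerK_grad (gradK eta) (Tkappa_grad u) +
          kappa0%:C * innerK_bd eta z = iunit * omega * innerK_D eta z].

Definition mode_sum (omega : C) (u : harmonics (H1fun R d)) (t : R) : H1fun R d :=
  \sum_n cexp (- iunit * (omega + ((harm n)%:~R * Omega)%:C) * t%:C) *: u n.

(* [u : [0, oo[ -> X] solves the semi-discrete wave equation and has the time
   derivatives [u1] and [u2] *)
Definition semidiscrete_solution (X : set (H1fun R d)) (u u1 u2 : R -> H1fun R d) :=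
  forall t, 0 <= t ->
    [/\ [/\ X (u t), X (u1 t) & X (u2 t)],
        time_derivative D u t (u1 t), time_derivative D u1 t (u2 t) &
        forall v, X v ->
          inner (vol D) (fn v) (fn (u2 t)) +
          inner_grad D (grad v) (fun i x => (kappa t x)%:C * grad (u t) i x) +
          kappa0%:C * inner (surf D) (trace v) (trace (u1 t)) = 0].

End Harmonics.

(* Main.v *)
(* Write lam_n = -i (omega + n Omega) and let k_t be the form of the kappa-weighted
   gradients.  Testing the first equation with D u - z - i omega u shows that
   z_n = lam_n u_n, so the eigenmode satisfies a quadratic system whose coupling
   terms are the Fourier coefficients in time of the forms k_t (by Fubini).
   - Testing the n-th equation with u_n and taking the imaginary part of its
     product with conj lam_n removes the boundary term; as kappa is C^3, its
     Fourier coefficients are summable and |u_n| <= C Cinv^2 / (1 + |n|)^2.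
   - An energy argument in the frequency domain bounds Im omega from above, so
     U grows at most exponentially, at a rate independent of h and K.
   - U solves the semi-discrete equation up to a residual made of truncation
     errors of the Fourier series of t |-> k_t(v, u_n), truncated to
     [-K - n, K - n].  Since (1 + |n|)^-2 ((K - n + 1)^-2 + (K + n + 1)^-2) sums
     to O(K^-2), the residual is at most C Cinv^4 / K^2 |v|.
   - The energy |d'|^2 + k_t(d, d) + |d|^2 of the difference then satisfies a
     Gronwall inequality with zero initial value.
   The second estimate follows from U(T) = e^(-i omega T) U(0). *)
Require Import Defs.
From HB Require Import structures.
From mathcomp Require Import all_boot all_order all_algebra.
From mathcomp Require Import all_classical all_reals all_analysis ess_sup_inf measurable_realfun.
From mathcomp Require Import complex ring lra.

Set Implicit Arguments.
Unset Strict Implicit.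
Unset Printing Implicit Defensive.
Import Order.TTheory GRing.Theory Num.Theory.
Import numFieldNormedType.Exports.

Local Open Scope classical_set_scope.
Local Open Scope complex_scope.
Local Open Scope ring_scope.

Local Notation Re := complex.Re.
Local Notation Im := complex.Im.

(** All quantitative work is done for abstract Hermitian forms [m], [g], [s], [k t] on a complex
    vector space, instantiated at the end by coordinates in a basis of [X h]: there the mass form is
    definite, while on [H1fun] a vanishing L^2 norm does not force a triple to vanish. The obstacle
    is uniformity in [h] and [K]. Boundedness of [k t] relative to [m] costs [Cinv ^+ 2], so it is
    used only to differentiate the energy; the exponential rates involve nothing but [M / c0], the
    bound on the time derivative of the form over its coercivity constant. The lower bound [c] on
    [Cinv] pays for the harmonic 0, whose frequency may vanish, so that only |u_0| <= 1 is available
    there. The truncation error is not obtained from convergence of the Fourier series: the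
    remainder is bounded directly by sums of moduli of its own coefficients, through its Fejér
    means. As [kappa] is a curve in L^oo, its values are meaningful up to null sets that depend on
    time; statements valid for every time are made about the forms, which are continuous functions
    of time. *)

Section ComplexFacts.
Context {R : realType}.
Implicit Types z w : R[i].

Lemma Re_add z w : Re (z + w) = Re z + Re w. Proof. by case: z; case: w. Qed.
Lemma Im_add z w : Im (z + w) = Im z + Im w. Proof. by case: z; case: w. Qed.
Lemma Re_opp z : Re (- z) = - Re z. Proof. by case: z. Qed.
Lemma Im_opp z : Im (- z) = - Im z. Proof. by case: z. Qed.
Lemma Re_mul z w : Re (z * w) = Re z * Re w - Im z * Im w.
Proof. by case: z; case: w. Qed.
Lemma Im_mul z w : Im (z * w) = Re z * Im w + Im z * Re w.
Proof. by case: z; case: w. Qed.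
Lemma Re_conjc z : Re z^* = Re z. Proof. by case: z. Qed.
Lemma Im_conjc z : Im z^* = - Im z. Proof. by case: z. Qed.
Lemma Re_sum (I : Type) (r : seq I) P (F : I -> R[i]) :
  Re (\sum_(i <- r | P i) F i) = \sum_(i <- r | P i) Re (F i).
Proof. exact: (big_morph (@complex.Re R) Re_add). Qed.
Lemma complex_eqP z w : Re z = Re w -> Im z = Im w -> z = w.
Proof. by case: z; case: w => ? ? ? ? /= -> ->. Qed.

Lemma Re_le_norm z (r : R) : `|z| <= r%:C -> Re z <= r.
Proof.
move=> zr; rewrite -lecR; apply: le_trans zr.
apply: le_trans (normc_ge_Re z); rewrite lecR ler_norm//.
Qed.

Lemma norm_le_sqr z (r : R) : 0 <= r ->
  (`|z| <= r%:C) = (Re z ^+ 2 + Im z ^+ 2 <= r ^+ 2).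
Proof.
move=> r0; rewrite normc_def lecR -[in LHS](ger0_norm r0) -sqrtr_sqr.
by rewrite ler_sqrt// exprn_ge0.
Qed.

Lemma Re_norm_le z : Re `|z| <= `|Re z| + `|Im z|.
Proof.
rewrite normc_def/= -[leRHS]ger0_norm ?addr_ge0// -sqrtr_sqr ler_sqrt ?sqr_ge0//.
rewrite sqrrD !real_normK ?num_real// lerD2r lerDl mulrn_wge0// mulr_ge0//.
Qed.

Lemma norm_real (r : R) : 0 <= r -> `|r%:C| = r%:C.
Proof. by move=> r0; rewrite ger0_norm// lecR. Qed.

Lemma cexpD z w : cexp (z + w) = cexp z * cexp w.
Proof.
rewrite /cexp Re_add Im_add expRD cosD sinD.
apply: complex_eqP; rewrite !(Re_mul, Im_mul)/=; ring.
Qed.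

Lemma cexp0 : cexp 0 = 1 :> R[i].
Proof.
rewrite /cexp/= expR0 cos0 sin0; apply: complex_eqP; rewrite !(Re_mul, Im_mul)/=; ring.
Qed.

Lemma cexp_conj z : (cexp z)^* = cexp z^*.
Proof.
rewrite /cexp Re_conjc Im_conjc cosN sinN.
by apply: complex_eqP; rewrite !(Re_conjc, Im_conjc, Re_mul, Im_mul)/=; ring.
Qed.

Lemma normr_cexp z : `|cexp z| = (expR (Re z))%:C.
Proof.
rewrite /cexp normrM norm_real ?expR_ge0// normc_def/= cos2Dsin2 sqrtr1.
by rewrite mulr1.
Qed.

End ComplexFacts.

(** * Continuity and derivatives of complex functions of time *)

Section ComplexDerivative.
Context {R : realType}.
Local Notation C := R[i].
Implicit Types (F G : R -> C).

(** Real and imaginary parts are kept separate because the mean value theorem and the fundamental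
    theorem of calculus are applied to each of them. *)
Definition cderivable F F' := forall t : R,
  is_derive t 1 (fun s => Re (F s)) (Re (F' t)) /\
  is_derive t 1 (fun s => Im (F s)) (Im (F' t)).

Definition ccontinuous F :=
  continuous (fun s => Re (F s)) /\ continuous (fun s => Im (F s)).

Lemma is_derive_continuous (f : R -> R) (t df : R) : is_derive t 1 f df ->
  {for t, continuous f}.
Proof.
by move=> [df1 _]; apply: differentiable_continuous; apply/derivable1_diffP.
Qed.

Lemma cderivable_continuous F F' : cderivable F F' -> ccontinuous F.
Proof. by move=> h; split=> t; have [h1 h2] := h t; exact: is_derive_continuous. Qed.

Lemma ccontinuous_cst (z : C) : ccontinuous (fun=> z).
Proof. by split=> t; exact: cst_continuous. Qed.

Lemma ccontinuousD F G : ccontinuous F -> ccontinuous G ->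
  ccontinuous (fun t => F t + G t).
Proof.
move=> [f1 f2] [g1 g2]; split=> t.
  under [X in continuous_at _ X]eq_fun do rewrite Re_add.
  by apply: continuousD; [exact: f1|exact: g1].
under [X in continuous_at _ X]eq_fun do rewrite Im_add.
by apply: continuousD; [exact: f2|exact: g2].
Qed.

Lemma ccontinuousM F G : ccontinuous F -> ccontinuous G ->
  ccontinuous (fun t => F t * G t).
Proof.
move=> [f1 f2] [g1 g2]; split=> t.
  under [X in continuous_at _ X]eq_fun do rewrite Re_mul.
  exact: (continuousB (continuousM (f1 t) (g1 t)) (continuousM (f2 t) (g2 t))).
under [X in continuous_at _ X]eq_fun do rewrite Im_mul.
exact: (continuousD (continuousM (f1 t) (g2 t)) (continuousM (f2 t) (g1 t))).
Qed.

Lemma ccontinuous_sum (I : Type) (r : seq I) (P : pred I) (F : I -> R -> C) :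
  (forall i, ccontinuous (F i)) ->
  ccontinuous (fun t => \sum_(i <- r | P i) F i t).
Proof.
move=> cF; elim: r => [|i r IH].
  by under eq_fun do rewrite big_nil; exact: ccontinuous_cst.
under eq_fun do rewrite big_cons.
by case: (P i) => //; exact: ccontinuousD.
Qed.

Lemma cderivable_cst (z : C) : cderivable (fun=> z) (fun=> 0).
Proof. by move=> t; split; exact: is_derive_cst. Qed.

Lemma cderivableD F F' G G' : cderivable F F' -> cderivable G G' ->
  cderivable (fun t => F t + G t) (fun t => F' t + G' t).
Proof.
move=> f g t; have [f1 f2] := f t; have [g1 g2] := g t; split.
  by under [X in is_derive _ _ X _]eq_fun do rewrite Re_add; rewrite Re_add; exact: is_deriveD.
by under [X in is_derive _ _ X _]eq_fun do rewrite Im_add; rewrite Im_add; exact: is_deriveD.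
Qed.

Lemma cderivableM F F' G G' : cderivable F F' -> cderivable G G' ->
  cderivable (fun t => F t * G t) (fun t => F' t * G t + F t * G' t).
Proof.
move=> f g t; have [f1 f2] := f t; have [g1 g2] := g t; split.
  under [X in is_derive _ _ X _]eq_fun do rewrite Re_mul.
  have h := is_deriveB (is_deriveM f1 g1) (is_deriveM f2 g2).
  by apply: is_derive_eq; rewrite !(Re_add, Re_mul) /GRing.scale/=; ring.
under [X in is_derive _ _ X _]eq_fun do rewrite Im_mul.
have h := is_deriveD (is_deriveM f1 g2) (is_deriveM f2 g1).
by apply: is_derive_eq; rewrite !(Im_add, Im_mul) /GRing.scale/=; ring.
Qed.

Lemma cderivable_cexp (z : C) :
  cderivable (fun t => cexp (z * t%:C)) (fun t => z * cexp (z * t%:C)).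
Proof.
have E (t : R) : cexp (z * t%:C) = (expR (Re z * t) * cos (Im z * t)) +i*
    (expR (Re z * t) * sin (Im z * t)).
  by rewrite /cexp; apply: complex_eqP; rewrite !(Re_mul, Im_mul)/= ?(Re_mul, Im_mul)/=;
    rewrite ?(mulr0, mul0r, subr0, add0r, addr0).
move=> t; split.
  under [X in is_derive _ _ X _]eq_fun do rewrite E/=.
  by apply: is_derive_eq; rewrite E Re_mul /= /GRing.scale/=; ring.
under [X in is_derive _ _ X _]eq_fun do rewrite E/=.
by apply: is_derive_eq; rewrite E Im_mul /= /GRing.scale/=; ring.
Qed.

End ComplexDerivative.

(** * Means over a period and Fourier coefficients *)

HB.lock Definition mean {R : realType} (T : R) (F : R -> R[i]) : R[i] :=
  (T^-1)%:C * ((\int[@lebesgue_measure R]_(t in `[0, T]) Re (F t)) +i*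
               (\int[@lebesgue_measure R]_(t in `[0, T]) Im (F t))).

Section Mean.
Context {R : realType} (T : R) (hT : 0 < T).
Local Notation C := R[i].
Local Notation leb := (@lebesgue_measure R).
Implicit Types (F G : R -> C).

Local Notation mean := (mean T).

Lemma continuous_integrable_itv (f : R -> R) : continuous f ->
  leb.-integrable `[0, T] (EFin \o f).
Proof.
move=> cf; apply: continuous_compact_integrable; first exact: segment_compact.
exact: continuous_subspaceT.
Qed.

Let mitv : measurable (`[0, T] : set (measurableTypeR R)).
Proof. exact: measurable_itv. Qed.

Lemma meanD F G : ccontinuous F -> ccontinuous G ->
  mean (fun t => F t + G t) = mean F + mean G.
Proof.
move=> [f1 f2] [g1 g2]; rewrite mean.unlock -mulrDr; congr (_ * _).
under eq_Rintegral do rewrite Re_add.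
under [X in _ +i* X]eq_Rintegral do rewrite Im_add.
by rewrite !RintegralD//; exact: continuous_integrable_itv.
Qed.

Lemma meanZ (z : C) F : ccontinuous F -> mean (fun t => z * F t) = z * mean F.
Proof.
move=> [f1 f2]; rewrite mean.unlock mulrCA; congr (_ * _).
under eq_Rintegral do rewrite Re_mul.
under [X in _ +i* X]eq_Rintegral do rewrite Im_mul.
have i1 := continuous_integrable_itv f1; have i2 := continuous_integrable_itv f2.
rewrite RintegralB ?RintegralD ?RintegralZl//.
- by apply: complex_eqP; rewrite ?Re_mul ?Im_mul.
- exact: (integrableZl mitv (Re z) i2).
- exact: (integrableZl mitv (Im z) i1).
- exact: (integrableZl mitv (Re z) i1).
- exact: (integrableZl mitv (Im z) i2).
Qed.

Lemma eq_mean F G : (forall t, 0 <= t <= T -> F t = G t) -> mean F = mean G.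
Proof.
move=> FG; rewrite mean.unlock; congr (_ * (_ +i* _)); apply: eq_Rintegral => t;
  by rewrite inE/= in_itv/= => /FG ->.
Qed.

Lemma mean_cst (z : C) : mean (fun=> z) = z.
Proof.
rewrite mean.unlock !Rintegral_cst//= lebesgue_measure_itv/= lte_fin hT/= subr0.
have T0 : T != 0 by rewrite gt_eqF.
by apply: complex_eqP; rewrite !(Re_mul, Im_mul)/=; field.
Qed.

Lemma mean_sum (I : Type) (r : seq I) (P : pred I) (F : I -> R -> C) :
  (forall i, ccontinuous (F i)) ->
  mean (fun t => \sum_(i <- r | P i) F i t) = \sum_(i <- r | P i) mean (F i).
Proof.
move=> cF; elim: r => [|i r IH].
  by rewrite big_nil -[RHS]mean_cst; congr mean; apply/funext => t; rewrite big_nil.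
rewrite big_cons; under [X in mean X]eq_fun do rewrite big_cons.
case: (P i) => //; rewrite meanD ?IH//; exact: ccontinuous_sum.
Qed.

Lemma mean_conj F : ccontinuous F -> mean (fun t => (F t)^*) = (mean F)^*.
Proof.
move=> [f1 f2]; rewrite mean.unlock rmorphM; congr (_ * _).
  by apply: complex_eqP; rewrite //= oppr0.
under eq_Rintegral do rewrite Re_conjc.
under [X in _ +i* X]eq_Rintegral do rewrite Im_conjc -mulN1r.
rewrite RintegralZl ?mulN1r//; exact: continuous_integrable_itv.
Qed.

(** Multiplication by the unit number [w] turns the mean of [F] into its modulus; real parts are
    then compared pointwise. The order of [R[i]] forces [G] to be real and nonnegative on [0, T]. *)
Lemma le_norm_mean F G : ccontinuous F -> ccontinuous G ->
  (forall t, 0 <= t <= T -> `|F t| <= G t) -> `|mean F| <= mean G.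
Proof.
move=> cF cG FG.
have G0 t : 0 <= t <= T -> 0 <= G t by move=> /FG; apply: le_trans.
have ImG : Im (mean G) = 0.
  rewrite mean.unlock Im_mul/= mul0r addr0 (@eq_Rintegral _ _ _ _ _ (fun=> 0)) ?Rintegral_cst//.
    by rewrite mul0r mulr0.
  by move=> t; rewrite inE/= in_itv/= => /G0 /ger0_Im.
have ReE H : Re (mean H) = T^-1 * \int[leb]_(t in `[0, T]) Re (H t).
  by rewrite mean.unlock Re_mul/= mul0r subr0.
set z := mean F; have [z0|z0] := eqVneq z 0.
  rewrite z0 normr0 lecE ImG eqxx ReE /=.
  rewrite mulr_ge0 ?invr_ge0 ?(ltW hT)// Rintegral_ge0// => t.
  by rewrite /= in_itv/= => /G0; rewrite lecE => /andP[].
have nz : `|z| != 0 by rewrite normr_eq0.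
pose w : C := `|z|^-1 * z^*.
have nw : `|w| = 1 by rewrite normrM normcJ normfV normr_id mulVf.
have Ez : mean (fun t => w * F t) = `|z|.
  rewrite meanZ// -/z /w -mulrA [z^* * z]mulrC -sqr_normc expr2 mulrA mulVf//.
  by rewrite mul1r.
have cw : ccontinuous (fun t => w * F t).
  by apply: ccontinuousM => //; exact: ccontinuous_cst.
have -> : `|z| = (Re `|z|)%:C by rewrite normc_def.
rewrite lecE ImG eqxx -Ez !ReE ler_pM2l ?invr_gt0//.
apply: le_Rintegral => //; [exact: continuous_integrable_itv cw.1|exact: continuous_integrable_itv cG.1|].
move=> t; rewrite /= in_itv/= => ht; have := FG t ht.
rewrite -[X in X <= _]mul1r -nw -normrM => h.
have Gt : G t = (Re (G t))%:C.
  by apply: complex_eqP => //=; exact/ger0_Im/G0.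
by move: h; rewrite Gt; exact: Re_le_norm.
Qed.

Lemma mean_derivative F F' : cderivable F F' -> ccontinuous F' ->
  F T = F 0 -> mean F' = 0.
Proof.
move=> dF [c1 c2] FT.
have ftc (f f' : R -> R) : (forall t : R, is_derive t 1 f (f' t)) ->
    continuous f' -> f T = f 0 -> \int[leb]_(t in `[0, T]) f' t = 0.
  move=> df cf' fT; rewrite /Rintegral (@continuous_FTC2 _ f' f)//.
  - by rewrite fT -EFinB subrr.
  - exact: continuous_subspaceT.
  - have cf : continuous f by move=> t; exact: is_derive_continuous (df t).
    split; last 2 first.
    + by apply: cvg_at_right_filter; exact: cf.
    + by apply: cvg_at_left_filter; exact: cf.
    + by move=> x _; have [] := df x.
  - by move=> x _; rewrite derive1E; have [] := df x.
have r1 := ftc _ _ (fun t => (dF t).1) c1 (congr1 _ FT).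
have r2 := ftc _ _ (fun t => (dF t).2) c2 (congr1 _ FT).
by rewrite mean.unlock r1 r2 mulr0.
Qed.

End Mean.

Arguments cexp : simpl never.
Arguments iunit : simpl never.
Arguments frequency : simpl never.

(** * Exponential modes and decay of Fourier coefficients *)

Section FourierModes.
Context {R : realType} (T : R) (hT : 0 < T).
Local Notation C := R[i].
Local Notation Om := (frequency T).
Implicit Types (F G : R -> C) (n p q : int).

Definition mode n (t : R) : C := cexp (iunit * (n%:~R * Om)%:C * t%:C).

Arguments mode : simpl never.

Lemma frequency_gt0 : 0 < Om.
Proof. by rewrite /frequency divr_gt0// mulr_gt0// pi_gt0. Qed.

Lemma mode0 t : mode 0 t = 1.
Proof. by rewrite /mode mul0r mulr0 mul0r cexp0. Qed.

Lemma modeD n p t : mode (n + p) t = mode n t * mode p t.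
Proof.
by rewrite /mode -cexpD; congr cexp; rewrite intrD mulrDl rmorphD/=; ring.
Qed.

Lemma mode_addt n s t : mode n (s + t) = mode n s * mode n t.
Proof. by rewrite /mode -cexpD; congr cexp; rewrite rmorphD/=; ring. Qed.

Lemma modeN n t : mode (- n) t = mode n (- t).
Proof. by rewrite /mode; congr cexp; rewrite intrN !(mulNr, rmorphN)/=; ring. Qed.

Lemma mode_t0 n : mode n 0 = 1.
Proof. by rewrite /mode mulr0 cexp0. Qed.

Lemma mode_exponent n t : iunit * (n%:~R * Om)%:C * t%:C = 0 +i* (n%:~R * Om * t).
Proof. by apply: complex_eqP; rewrite !(Re_mul, Im_mul)/=; ring. Qed.

Lemma mode_conj n t : (mode n t)^* = mode (- n) t.
Proof.
rewrite /mode cexp_conj !mode_exponent; congr cexp.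
by apply: complex_eqP => /=; rewrite ?intrN; ring.
Qed.

Lemma mode_cos_sin n t : mode n t = cos (n%:~R * Om * t) +i* sin (n%:~R * Om * t).
Proof.
rewrite /mode mode_exponent /cexp/= expR0; apply: complex_eqP;
  rewrite !(Re_mul, Im_mul)/=; ring.
Qed.

Lemma norm_mode n t : `|mode n t| = 1.
Proof. by rewrite /mode mode_exponent normr_cexp/= expR0. Qed.

Lemma mode_period n : mode n T = 1.
Proof.
have h (k : nat) : mode k%:Z T = 1.
  elim: k => [|k IH]; first by rewrite mode0.
  rewrite -addn1 PoszD modeD IH mul1r mode_cos_sin mul1r /frequency divfK ?gt_eqF//.
  rewrite mulr_natl cos2pi.
  have -> : sin (pi *+ 2) = 0 :> R by rewrite sin_mulr2n sinpi mulr0 mul0rn.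
  by apply: complex_eqP.
case: n => k; first exact: h.
by rewrite NegzE -mode_conj h conjC1.
Qed.

Lemma cderivable_mode n :
  cderivable (mode n) (fun t => iunit * (n%:~R * Om)%:C * mode n t).
Proof. exact: cderivable_cexp. Qed.

Lemma ccontinuous_mode n : ccontinuous (mode n).
Proof. exact: cderivable_continuous (cderivable_mode n). Qed.

Lemma mean_mode n : mean T (mode n) = (n == 0)%:R.
Proof.
have [->|n0] := eqVneq n 0.
  rewrite (_ : mode 0 = fun=> 1) ?mean_cst//.
  by apply/funext => t; rewrite mode0.
have cm : ccontinuous (fun t => iunit * (n%:~R * Om)%:C * mode n t).
  by apply: ccontinuousM; [exact: ccontinuous_cst|exact: ccontinuous_mode].
have := mean_derivative hT (cderivable_mode n) cm.
rewrite meanZ; last exact: ccontinuous_mode.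
rewrite mode_period mode_t0 => /(_ erefl)/eqP.
rewrite mulf_eq0 [iunit * _ == 0]mulf_eq0.
have -> : ((n%:~R * Om)%:C == 0 :> C) = false.
  rewrite eq_complex/= eqxx andbT mulf_eq0 intr_eq0 (negbTE n0) gt_eqF//.
  exact: frequency_gt0.
rewrite orbF (_ : (iunit == 0 :> C) = false); last first.
  by rewrite eq_complex/= eqxx oner_eq0.
by rewrite orFb => /eqP.
Qed.

(** The sign matches [fourier]: [coef F n] is the coefficient of e^(-i n Omega t), that is, of
    [mode (- n)]. *)
Definition coef F n : C := mean T (fun t => F t * mode n t).
Arguments coef : simpl never.

(** Integration by parts: [F * mode n] takes the same value at 0 and at [T], so its derivative has
    mean zero. *)
Lemma coef_derivative F F' n : cderivable F F' -> ccontinuous F' -> F T = F 0 ->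
  coef F' n = - (iunit * (n%:~R * Om)%:C) * coef F n.
Proof.
move=> dF cF' FT.
have cF := cderivable_continuous dF.
have cm := ccontinuous_mode n.
have c1 : ccontinuous (fun t => F' t * mode n t) by exact: ccontinuousM.
have c0 : ccontinuous (fun t => F t * mode n t) by exact: ccontinuousM.
have c2 : ccontinuous (fun t => F t * (iunit * (n%:~R * Om)%:C * mode n t)).
  apply: ccontinuousM => //; apply: ccontinuousM => //; exact: ccontinuous_cst.
have := mean_derivative hT (cderivableM dF (cderivable_mode n)) (ccontinuousD c1 c2).
rewrite FT mode_period mode_t0 meanD// => /(_ erefl) /eqP; rewrite addr_eq0 => /eqP.
rewrite {1}/coef => ->; rewrite mulNr -meanZ//; congr (- _).
by apply: eq_mean => t _; ring.
Qed.

Lemma norm_coef_le F n (M : R) : ccontinuous F ->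
  (forall t, 0 <= t <= T -> `|F t| <= M%:C) -> `|coef F n| <= M%:C.
Proof.
move=> cF FM; rewrite -(mean_cst hT M%:C); apply: le_norm_mean => //.
- by apply: ccontinuousM => //; exact: ccontinuous_mode.
- exact: ccontinuous_cst.
- by move=> t ht; rewrite normrM norm_mode mulr1 FM.
Qed.

Lemma norm_iunit : `|iunit| = 1 :> C.
Proof. by rewrite normc_def/= expr0n expr1n add0r sqrtr1. Qed.

(** Three integrations by parts. Written as a product, the bound also covers [n = 0]. *)
Lemma norm_coef_C3 F F1 F2 F3 n (M : R) :
  cderivable F F1 -> cderivable F1 F2 -> cderivable F2 F3 -> ccontinuous F3 ->
  F T = F 0 -> F1 T = F1 0 -> F2 T = F2 0 ->
  (forall t, 0 <= t <= T -> `|F3 t| <= M%:C) ->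
  `|coef F n| * ((`|n%:~R| * Om) ^+ 3)%:C <= M%:C.
Proof.
move=> d1 d2 d3 c3 e e1 e2 hM; apply: le_trans (norm_coef_le n c3 hM).
have c1 := cderivable_continuous d2; have c2 := cderivable_continuous d3.
rewrite (coef_derivative n d3)// (coef_derivative n d2)// (coef_derivative n d1)//.
have : `|(n%:~R * Om)%:C| = (`|n%:~R| * Om)%:C :> C.
  rewrite normc_def/= expr0n addr0 sqrtr_sqr normrM.
  by rewrite (ger0_norm (ltW frequency_gt0)).
move: (n%:~R * Om)%:C (`|n%:~R| * Om) => z r zr.
rewrite !(normrM, normrN) norm_iunit zr !mul1r rmorphXn/=.
by rewrite mulrC !exprS expr0 mulr1 !mulrA.
Qed.

End FourierModes.
Arguments mode : simpl never.
Arguments coef : simpl never.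

(** * Uniform bounds for sums over integers *)

Section IntegerSums.
Context {R : realType}.
Implicit Types (f phi : int -> R) (p : int).

(** [phi] is a bounded discrete antiderivative: sums over consecutive integers telescope, with a
    bound that depends neither on their number nor on their position. The two directions serve the
    two tails of a Fourier series. *)
Lemma sum_telescope_le f phi (A B : R) (N : nat) p :
  (forall n, f n <= phi (n + 1) - phi n) -> (forall n, A <= phi n <= B) ->
  \sum_(q < N) f (p - q%:Z) <= B - A /\ \sum_(q < N) f (q%:Z - p) <= B - A.
Proof.
move=> hf hp; split.
  apply: (@le_trans _ _ (phi (p + 1) - phi (p + 1 - N%:Z))).
    elim: N => [|N IH]; first by rewrite big_ord0 subr0 subrr.
    rewrite big_ord_recr/=.
    have := hf (p - N%:Z).
    have -> : p - N%:Z + 1 = p + 1 - N%:Z by ring.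
    have -> : p + 1 - N.+1%:Z = p - N%:Z by rewrite -addn1 PoszD; ring.
    by move: IH; lra.
  by have := hp (p + 1); have := hp (p + 1 - N%:Z); lra.
apply: (@le_trans _ _ (phi (N%:Z - p) - phi (- p))).
  elim: N => [|N IH]; first by rewrite big_ord0 sub0r subrr.
  rewrite big_ord_recr/=.
  have := hf (N%:Z - p).
  have -> : N%:Z - p + 1 = N.+1%:Z - p by rewrite -[N.+1]addn1 PoszD; ring.
  by move: IH; lra.
by have := hp (N%:Z - p); have := hp (- p); lra.
Qed.

Definition weight (n : int) : R := ((1 + `|n|%:~R) ^+ 2)^-1.

Lemma weight_gt0 n : 0 < weight n.
Proof. by rewrite invr_gt0 exprn_gt0// ltr_wpDr. Qed.

(** The discrete antiderivative 2n / (1 + |n|) takes values in [-2, 2], whence the constant 4 of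
    [sum_weight]. The difference of the two sides has a closed form on each side of 0. *)
Lemma weight_le_diff (n : int) :
  weight n <= (2 * (n + 1)%:~R / (1 + `|n + 1|%:~R)) - 2 * n%:~R / (1 + `|n|%:~R).
Proof.
rewrite /weight; have [n0|n0] := leP 0 n.
  rewrite !ger0_norm ?addr_ge0// intrD.
  have x0 : (0 : R) <= n%:~R by rewrite ler0z.
  move: (n%:~R) x0 => x x0.
  rewrite -subr_ge0.
  have -> : 2 * (x + 1) / (1 + (x + 1)) - 2 * x / (1 + x) - ((1 + x) ^+ 2)^-1 =
    x / ((1 + x) ^+ 2 * (x + 2)) by field; rewrite -?andbA; do ?[apply/andP; split]; apply/negP => /eqP; lra.
  by rewrite divr_ge0// mulr_ge0 ?exprn_ge0; lra.
have n1 : n + 1 <= 0 by rewrite -ltzD1 ltrD2r.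
rewrite !ler0_norm ?(ltW n0)// intrN intrN intrD.
have x0 : (n%:~R : R) <= -1 by move: n1; rewrite -(lerz0 R) intrD; lra.
move: (n%:~R) x0 => x x0; rewrite -subr_ge0.
have -> : 2 * (x + 1) / (1 + (- (x + 1))) - 2 * x / (1 + - x) - ((1 + - x) ^+ 2)^-1 =
    (2 - x) / ((1 - x) ^+ 2 * (- x)) by field; rewrite -?andbA; do ?[apply/andP; split]; apply/negP => /eqP; lra.
by rewrite divr_ge0// ?mulr_ge0 ?exprn_ge0; lra.
Qed.

Lemma sum_weight (N : nat) p : \sum_(q < N) weight (q%:Z - p) <= 4.
Proof.
have h (n : int) : - 2 <= (2 * n%:~R / (1 + `|n|%:~R) : R) <= 2.
  have h1 := ler_norm (n%:~R : R).
  have x0 : (0 : R) < 1 + `|n|%:~R by rewrite ltr_wpDr// ler0z.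
  have h2 := ler_norm (- n%:~R : R).
  rewrite normrN -!intr_norm in h1 h2.
  by apply/andP; split; [rewrite ler_pdivlMr//; lra|rewrite ler_pdivrMr//; lra].
have [_] := sum_telescope_le N p weight_le_diff h.
by move=> /le_trans; apply; lra.
Qed.

(** Size, up to a factor, of the coefficients of a C^3 function discarded by truncation at [b] on
    the positive side; [tail a (- n)] is the negative side. *)
Definition tail (b : nat) (n : int) : R :=
  if b%:Z < n then (n%:~R ^+ 3)^-1 else 0.

Lemma sum_tail (b N : nat) p :
  \sum_(q < N) tail b (p - q%:Z) <= 2 / b.+1%:R ^+ 2 /\
  \sum_(q < N) tail b (q%:Z - p) <= 2 / b.+1%:R ^+ 2.
Proof.
(* Constant up to [b + 1], so there is no increment where [tail] vanishes; beyond, the increments of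
   -2 / n^2 dominate 1 / n^3. *)
pose phi (n : int) : R := - 2 / (Num.max n b.+1%:Z)%:~R ^+ 2.
have hf n : tail b n <= phi (n + 1) - phi n.
  rewrite /tail /phi; case: ltP => hn.
    have bn : b.+1%:Z <= n by rewrite -addn1 PoszD -ltzD1 ltrD2r.
    rewrite !max_l//; last by rewrite (le_trans bn)// lerDl.
    have x1 : (1 : R) <= n%:~R by rewrite ler1z (le_trans _ bn).
    rewrite intrD; move: (n%:~R) x1 => x x1; rewrite -subr_ge0.
    have -> : - 2 / (x + 1) ^+ 2 - - 2 / x ^+ 2 - (x ^+ 3)^-1 =
      (3 * x ^+ 2 - 1) / (x ^+ 3 * (x + 1) ^+ 2) by field; rewrite -?andbA; do ?[apply/andP; split]; apply/negP => /eqP; lra.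
    have x0 : 0 <= x by lra.
    by apply: divr_ge0; [nra|rewrite mulr_ge0 ?exprn_ge0//; lra].
  rewrite !max_r ?subrr//.
    by rewrite (le_trans hn)// lez_nat.
  by rewrite -addn1 PoszD lerD2r.
have hp n : - (2 / b.+1%:R ^+ 2) <= phi n <= 0.
  rewrite /phi mulNr lerN2 oppr_le0.
  have b0 : (0 : R) < b.+1%:R by rewrite ltr0n.
  have h : b.+1%:R <= (Num.max n b.+1%:Z)%:~R :> R.
    by rewrite -[leLHS]/(b.+1%:Z%:~R) ler_int le_max lexx orbT.
  have m0 := lt_le_trans b0 h.
  rewrite divr_ge0 ?exprn_ge0 ?(ltW m0)// andbT.
  rewrite ler_wpM2l// lef_pV2 ?posrE ?exprn_gt0//.
  by rewrite ler_sqr ?nnegrE ?(ltW b0)// (ltW m0).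
by have := sum_telescope_le N p hf hp; rewrite sub0r opprK.
Qed.

End IntegerSums.

(** * Fourier truncation *)

Section Chord.
Context {R : realType} (T : R) (hT : 0 < T).
Local Notation C := R[i].
Local Notation Om := (frequency T).
Implicit Types (F G : R -> C).

(** With y = 2h, 1 - cos y = 2 sin^2 h. For h in [0, pi/2], h cos h <= sin h and h <= 2, so h^2 =
    h^2 cos^2 h + h^2 sin^2 h <= 5 sin^2 h; the constant is 4 * 5 / 2. *)
Lemma sqr_le_cos (y : R) : `|y| <= pi -> y ^+ 2 <= 10 * (1 - cos y).
Proof.
wlog y0 : y / 0 <= y => [h|].
  have [|y0 yp] := leP 0 y; first exact: h.
  by rewrite -sqrrN -cosN; apply: h; rewrite ?normrN// oppr_ge0 ltW.
rewrite ger0_norm// => yp.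
pose h := y / 2; have -> : y = h *+ 2 by rewrite /h mulr2n -splitr.
have h0 : 0 <= h by rewrite divr_ge0.
have hp : h <= pi / 2 by rewrite ler_pM2r.
have h2 : h <= 2 by rewrite (le_trans hp)// ltW// pihalf_lt2.
rewrite cos_mulr2n.
have := sin2cos2 h => s2.
have c0 : 0 <= cos h by apply: cos_ge0_pihalf; rewrite hp andbT (le_trans _ h0)// oppr_le0 divr_ge0// pi_ge0.
have s0 : 0 <= sin h.
  by apply: sin_ge0_pi; rewrite h0/= (le_trans hp)// ler_pdivrMr// ler_peMr// ?pi_ge0// ler1n.
have main : h * cos h <= sin h.
  pose f (x : R) := sin x - x * cos x.
  have df (x : R) : is_derive x 1 f (x * sin x).
    by apply: is_derive_eq; rewrite /GRing.scale/=; ring.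
  have : f 0 <= f h.
    apply: (@ger0_derive1_ndecr _ f 0 h) => // x.
    - rewrite in_itv/= => /andP[x0 xh]; rewrite derive1E.
      have [_ ->] := df x; rewrite mulr_ge0 ?(ltW x0)// sin_ge0_pi// (ltW x0)/=.
      rewrite (le_trans (ltW xh))// (le_trans hp)//.
      by rewrite ler_pdivrMr// ler_peMr// ?pi_ge0// ler1n.
    - by apply: continuous_subspaceT => r; exact: is_derive_continuous (df r).
  by rewrite /f sin0 mul0r subrr subr_ge0.
have e1 : h ^+ 2 = h ^+ 2 * cos h ^+ 2 + h ^+ 2 * sin h ^+ 2.
  by rewrite -mulrDr cos2Dsin2 mulr1.
have e2 : h ^+ 2 * cos h ^+ 2 <= sin h ^+ 2.
  by rewrite -exprMn ler_sqr ?nnegrE// mulr_ge0.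
have e3 : h ^+ 2 * sin h ^+ 2 <= 4 * sin h ^+ 2.
  by rewrite ler_wpM2r ?sqr_ge0//; nra.
rewrite (_ : (h *+ 2) ^+ 2 = 4 * h ^+ 2); last by rewrite mulr2n; ring.
rewrite (_ : cos h ^+ 2 = 1 - sin h ^+ 2); last by rewrite s2; ring.
by rewrite mulr2n; lra.
Qed.

(** The squared distance from 1 to e^(i Omega x): a periodic substitute for x^2 that cancels against
    the denominator of the Fejér kernel. *)
Definition chord (x : R) : R := 2 - 2 * cos (Om * x).

Lemma chord_ge0 x : 0 <= chord x.
Proof. by rewrite /chord; have := cos_le1 (Om * x); lra. Qed.

Lemma chordE x : (1 - mode T 1 x) * (1 - mode T 1 x)^* = (chord x)%:C.
Proof.
rewrite rmorphB/= conjC1 mode_conj !mode_cos_sin intrN mul1r !mulN1r !mulNr cosN sinN.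
have := cos2Dsin2 (Om * x); rewrite /chord; move: (cos _) (sin _) => c s cs.
apply: complex_eqP; rewrite !(Re_mul, Im_mul)/=; [|ring].
by move: cs; nra.
Qed.

(** With [k] the integer nearest to [x / T], Omega (x - kT) lies in [-pi, pi], where [sqr_le_cos]
    applies; [chord] does not see the shift by [k] periods. *)
Lemma sqr_le_chord (x : R) : exists k : int,
  (x - k%:~R * T) ^+ 2 <= 5 / Om ^+ 2 * chord x.
Proof.
have O0 := frequency_gt0 hT.
pose k := Num.floor (x / T + 1 / 2); exists k.
have /andP[k1 k2] := floor_itv (x / T + 1 / 2); rewrite -/k intrD in k1 k2.
have -> : chord x = 2 * (1 - cos (Om * (x - k%:~R * T))).
  have e : Om * (x - k%:~R * T) = Om * x - k%:~R * (pi *+ 2).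
    by rewrite mulrBr /frequency mulr2n; field; rewrite gt_eqF.
  have kp : cos (k%:~R * (pi *+ 2)) = 1 :> R /\ sin (k%:~R * (pi *+ 2)) = 0 :> R.
    have := mode_period hT k; rewrite mode_cos_sin -mulrA.
    by rewrite /frequency divfK ?gt_eqF// mulr_natl => -[].
  by rewrite e cosB kp.1 kp.2 /chord; ring.
have : `|Om * (x - k%:~R * T)| <= pi.
  rewrite normrM gtr0_norm//.
  have xk : `|x - k%:~R * T| <= T / 2.
    rewrite ler_norml; have -> : x = x / T * T by rewrite divfK// gt_eqF.
    rewrite -mulrBl; apply/andP; split.
      have := ler_wpM2r (ltW hT) (_ : - (1 / 2) <= x / T - k%:~R); lra.
    have := ler_wpM2r (ltW hT) (_ : x / T - k%:~R <= 1 / 2); lra.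
  apply: le_trans (_ : Om * (T / 2) <= _); first by rewrite ler_pM2l.
  rewrite le_eqVlt; apply/orP; left; apply/eqP.
  by rewrite /frequency; field; rewrite gt_eqF.
move=> /sqr_le_cos; move: (x - _) => y hy.
have -> : 5 / Om ^+ 2 * (2 * (1 - cos (Om * y))) = 10 * (1 - cos (Om * y)) / Om ^+ 2.
  by field; rewrite gt_eqF.
by rewrite ler_pdivlMr ?exprn_gt0// mulrC -exprMn.
Qed.

(* A linear bound on the increments of [G] at [t0] by the chord length
   [|1 - e^(i Om (s - t0))|], in the form it takes after Young's inequality. *)
Definition chord_lipschitz G (t0 : R) := exists2 L : R, 0 <= L &
  forall s eta, 0 < eta -> `|G s - G t0| <= (L * (eta + chord (s - t0) / eta))%:C.

Lemma chord_lipschitzD F G t0 : chord_lipschitz F t0 -> chord_lipschitz G t0 ->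
  chord_lipschitz (fun t => F t + G t) t0.
Proof.
move=> [L L0 hL] [M M0 hM]; exists (L + M) => [|s eta e0]; first exact: addr_ge0.
rewrite mulrDl rmorphD/=.
have -> : F s + G s - (F t0 + G t0) = (F s - F t0) + (G s - G t0) by ring.
by apply: le_trans (ler_normD _ _) _; rewrite lerD ?hL ?hM.
Qed.

Lemma chord_lipschitzZ F (z : C) t0 : chord_lipschitz F t0 ->
  chord_lipschitz (fun t => z * F t) t0.
Proof.
move=> [L L0 hL]; exists (Re `|z| * L) => [|s eta e0].
  by rewrite mulr_ge0// normc_def sqrtr_ge0.
rewrite -mulrBr normrM -mulrA rmorphM/= ler_pM ?hL//.
Qed.

Lemma chord_lipschitz_sum (I : Type) (r : seq I) (F : I -> R -> C) t0 :
  (forall i, chord_lipschitz (F i) t0) ->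
  chord_lipschitz (fun t => \sum_(i <- r) F i t) t0.
Proof.
move=> hF; elim: r => [|i r IH].
  exists 0 => // s eta e0; rewrite !big_nil subrr normr0 mul0r//.
under eq_fun do rewrite big_cons.
exact: chord_lipschitzD.
Qed.

(** The factor 2 comes from applying the mean value theorem separately to the real and the imaginary
    part. *)
Lemma norm_increment_le F F' (M s t : R) : cderivable F F' ->
  (forall t, `|F' t| <= M%:C) -> `|F s - F t| <= (2 * M * `|s - t|)%:C.
Proof.
move=> dF hM.
wlog st : s t / t <= s => [h|].
  have [/h//|/ltW/h] := leP t s.
  by rewrite distrC [X in _ * X]distrC.
have mvt (f f' : R -> R) : (forall t : R, is_derive t 1 f (f' t)) ->
    (forall t, `|f' t| <= M) -> `|f s - f t| <= M * `|s - t|.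
  move=> df fM.
  have [|x _ ->] := @MVT_segment _ f f' t s st (fun x _ => df x).
    by apply: continuous_subspaceT => x; exact: is_derive_continuous (df x).
  by rewrite normrM ler_wpM2r.
have m1 := mvt _ _ (fun t => (dF t).1) (fun t => _).
have {}m1 : `|Re (F s) - Re (F t)| <= M * `|s - t|.
  apply: m1 => r; rewrite -lecR; apply: le_trans (normc_ge_Re _) (hM r).
have m2 : `|Im (F s) - Im (F t)| <= M * `|s - t|.
  apply: (mvt _ _ (fun t => (dF t).2)) => r.
  rewrite -lecR; apply: le_trans (hM r).
  rewrite normc_def lecR -sqrtr_sqr ler_sqrt ?addr_ge0 ?sqr_ge0//.
  by rewrite lerDr sqr_ge0.
have -> : F s - F t = (Re (F s) - Re (F t))%:C + iunit * (Im (F s) - Im (F t))%:C.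
  by apply: complex_eqP; rewrite !(Re_add, Im_add, Re_mul, Im_mul, Re_opp, Im_opp)/=; ring.
apply: le_trans (ler_normD _ _) _.
rewrite normrM norm_iunit mul1r !normc_def/= !expr0n !addr0 !sqrtr_sqr.
by rewrite -rmorphD lecR -mulrA mulr_natl mulr2n lerD.
Qed.

(** Periodicity replaces [s - t0] by its representative y nearest to 0; then |y| <= eta + y^2 / eta,
    and y^2 is controlled by the chord. *)
Lemma chord_lipschitz_C1 F F' (M : R) t0 : cderivable F F' ->
  (forall t, F (t + T) = F t) -> (forall t, `|F' t| <= M%:C) ->
  chord_lipschitz F t0.
Proof.
move=> dF pF hM.
have M0 : 0 <= M by have := le_trans (normr_ge0 _) (hM 0); rewrite ler0c.
have pk (k : int) t : F (t - k%:~R * T) = F t.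
  have hn (n : nat) x : F (x + n%:R * T) = F x.
    elim: n x => [|n IH] x; first by rewrite mul0r addr0.
    by rewrite -natr1 mulrDl mul1r addrA pF.
  case: k => n; first by rewrite -[RHS](hn n) -[RHS](hn n) -(hn n (t - _)) subrK hn.
  by rewrite NegzE intrN mulNr opprK hn.
have O0 := frequency_gt0 hT.
exists (2 * M * (1 + 5 / Om ^+ 2)) => [|s eta e0].
  by rewrite !mulr_ge0// addr_ge0// divr_ge0 ?sqr_ge0.
have [k hk] := sqr_le_chord (s - t0).
rewrite -(pk k s); apply: le_trans (norm_increment_le _ _ dF hM) _.
rewrite lecR -[leRHS]mulrA ler_wpM2l ?mulr_ge0//.
have -> : s - k%:~R * T - t0 = s - t0 - k%:~R * T by ring.
move: hk; move: (s - t0 - k%:~R * T) (chord_ge0 (s - t0)) => y; move: (chord _) => c c0 hy.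
have o0 : 0 <= 5 / Om ^+ 2 by rewrite divr_ge0 ?sqr_ge0.
move: (5 / Om ^+ 2) o0 hy => o o0 hy.
have h1 : `|y| <= eta + y ^+ 2 / eta.
  rewrite -real_normK ?num_real//; move: `|y| (normr_ge0 y) => x x0.
  rewrite -(ler_pM2r e0) mulrDl divfK ?gt_eqF//.
  by have := sqr_ge0 (eta - x); nra.
apply: le_trans h1 _.
have ce : 0 <= c / eta by rewrite divr_ge0// ltW.
have : y ^+ 2 / eta <= o * (c / eta) by rewrite mulrA ler_wpM2r// invr_ge0 ltW.
move=> h2; nra.
Qed.

End Chord.

(** * Fejér means *)

Section Fejer.
Context {R : realType} (T : R) (hT : 0 < T).
Local Notation C := R[i].
Local Notation Om := (frequency T).
Local Notation mode := (mode T).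
Implicit Types (F G : R -> C).

(** The Fejér kernel as a squared modulus: positivity is immediate, and the expansion over pairs
    [p], [q] presents a Fejér mean as an average over [p] of sums of consecutive Fourier terms. *)
Definition fejer (N : nat) (x : R) : C :=
  N%:R^-1 * ((\sum_(p < N) mode p x) * (\sum_(q < N) mode q x)^*).

Lemma fejer_sum N s t0 : fejer N (s - t0) =
  N%:R^-1 * \sum_(p < N) \sum_(q < N)
    (mode (q%:Z - p%:Z) t0 * mode (p%:Z - q%:Z) s).
Proof.
rewrite /fejer rmorph_sum/= big_distrlr/=; congr (_ * _).
apply: eq_bigr => p _; apply: eq_bigr => q _.
by rewrite mode_conj -modeD mode_addt -modeN opprB mulrC.
Qed.

Lemma ccontinuous_fejer N t0 : ccontinuous (fun s => fejer N (s - t0)).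
Proof.
under eq_fun do rewrite fejer_sum.
apply: ccontinuousM; first exact: ccontinuous_cst.
apply: ccontinuous_sum => p; apply: ccontinuous_sum => q.
by apply: ccontinuousM; [exact: ccontinuous_cst|exact: ccontinuous_mode].
Qed.

Lemma fejer_ge0 N x : 0 <= fejer N x.
Proof. by rewrite /fejer mulr_ge0 ?invr_ge0 ?ler0n// mul_conjC_ge0. Qed.

Lemma mean_fejer F N t0 : ccontinuous F ->
  mean T (fun s => F s * fejer N (s - t0)) =
  N%:R^-1 * \sum_(p < N) \sum_(q < N) (mode (q%:Z - p%:Z) t0 * coef T F (p%:Z - q%:Z)).
Proof.
move=> cF.
have cc p : ccontinuous (fun s => F s * mode p s).
  by apply: ccontinuousM => //; exact: ccontinuous_mode.
have cz (z : C) p : ccontinuous (fun s => z * (F s * mode p s)).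
  by apply: ccontinuousM => //; exact: ccontinuous_cst.
transitivity (mean T (fun s => N%:R^-1 * \sum_(p < N) \sum_(q < N)
    (mode (q%:Z - p%:Z) t0 * (F s * mode (p%:Z - q%:Z) s)))).
  apply: eq_mean => s _; rewrite fejer_sum mulrCA; congr (_ * _).
  rewrite mulr_sumr; apply: eq_bigr => p _; rewrite mulr_sumr; apply: eq_bigr => q _.
  by rewrite mulrCA.
rewrite meanZ; last by do 2! (apply: ccontinuous_sum => ?); exact: cz.
congr (_ * _); rewrite mean_sum//; last by move=> ?; apply: ccontinuous_sum => ?; exact: cz.
apply: eq_bigr => p _; rewrite mean_sum//.
by apply: eq_bigr => q _; rewrite meanZ.
Qed.

Lemma mean_fejer1 N t0 : (0 < N)%N -> mean T (fun s => fejer N (s - t0)) = 1.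
Proof.
move=> N0; transitivity (mean T (fun s => 1 * fejer N (s - t0))).
  by apply: eq_mean => s _; rewrite mul1r.
rewrite mean_fejer; last exact: ccontinuous_cst.
have c1 n : coef T (fun=> 1) n = (n == 0)%:R.
  rewrite /coef -(mean_mode hT); apply: eq_mean => t _; exact: mul1r.
rewrite (eq_bigr (fun=> 1)) => [|p _].
  by rewrite sumr_const card_ord mulVf// pnatr_eq0 -lt0n.
rewrite (bigD1 p)//= c1 subrr eqxx mulr1 mode0 big1 ?addr0// => q qp.
by rewrite c1 subr_eq0 eqz_nat eq_sym val_eqE (negbTE qp) mulr0.
Qed.

(** The chord is |1 - e^(i Omega x)|^2, which turns the geometric sum of the kernel into 1 - e^(i N
    Omega x), of modulus at most 2. *)
Lemma chord_fejer_le N x : (0 < N)%N -> (chord T x)%:C * fejer N x <= (4 / N%:R)%:C.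
Proof.
move=> N0.
have geom : (1 - mode 1 x) * \sum_(p < N) mode p x = 1 - mode N x.
  elim: (N) => [|n IH]; first by rewrite big_ord0 mulr0 mode0 subrr.
  rewrite big_ord_recr/= mulrDr IH mulrBl mul1r -modeD addrA subrK.
  by rewrite -PoszD add1n.
rewrite -chordE/fejer.
have -> : (1 - mode 1 x) * (1 - mode 1 x)^* *
    (N%:R^-1 * ((\sum_(p < N) mode p x) * (\sum_(q < N) mode q x)^*)) =
    N%:R^-1 * ((1 - mode N x) * (1 - mode N x)^*).
  by rewrite -geom [in RHS]rmorphM/=; ring.
have : (1 - mode N x) * (1 - mode N x)^* <= 4.
  rewrite -normCK.
  have : `|1 - mode N x| <= 2.
    by apply: le_trans (ler_normB _ _) _; rewrite normr1 norm_mode.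
  by move=> h; rewrite (_ : 4 = 2 ^+ 2); [rewrite lerXn2r// nnegrE|ring].
move=> h; rewrite [leLHS]mulrC rmorphM/= fmorphV/= !rmorph_nat.
by rewrite ler_wpM2r// invr_ge0 ler0n.
Qed.

(* The Fejer means of [F] at [t0] are averages of its partial Fourier sums, hence
   bounded by [B], and converge to [F t0]. *)
Lemma fejer_bound F t0 (B : R) : ccontinuous F -> chord_lipschitz T F t0 ->
  (forall (N : nat) (p : int),
     \sum_(q < N) `|coef T F (p - q%:Z)| <= B%:C) ->
  `|F t0| <= B%:C.
Proof.
move=> cF [L L0 hL] hB.
have key (N : nat) (eta : R) : (0 < N)%N -> 0 < eta ->
    `|F t0| <= (B + L * (eta + 4 / (N%:R * eta)))%:C.
  move=> N0 e0; have N0' : (0 : R) < N%:R by rewrite ltr0n.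
  have cK := ccontinuous_fejer N t0.
  (* The kernel has mean 1. The first mean is bounded by [B]; the mean of the increments is bounded
     by the chord condition, whose chord term the kernel reduces to order 1 / N. *)
  have split_mean : F t0 = mean T (fun s => F s * fejer N (s - t0)) +
      - 1 * mean T (fun s => (F s - F t0) * fejer N (s - t0)).
    have c1 : ccontinuous (fun s => F s - F t0).
      by apply: ccontinuousD => //; exact: ccontinuous_cst.
    have c2 := ccontinuousM c1 cK; have c3 := ccontinuousM cF cK.
    rewrite -meanZ// -meanD//; last by apply: ccontinuousM => //; exact: ccontinuous_cst.
    rewrite -[LHS]mulr1 -[X in _ * X = _](mean_fejer1 t0 N0) -meanZ//.
    by apply: eq_mean => s _; ring.
  rewrite split_mean rmorphD/=; apply: le_trans (ler_normD _ _) _; apply: lerD.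
    rewrite mean_fejer// normrM gtr0_norm ?invr_gt0 ?ltr0n//.
    rewrite mulrC ler_pdivrMr ?ltr0n//.
    apply: le_trans (ler_norm_sum _ _ _) _.
    apply: le_trans (_ : \sum_(p < N) B%:C <= _).
      apply: ler_sum => p _; apply: le_trans (ler_norm_sum _ _ _) _.
      under eq_bigr do rewrite normrM norm_mode mul1r.
      exact: hB.
    by rewrite sumr_const card_ord mulr_natr.
  rewrite mulN1r normrN.
  apply: le_trans (_ : mean T (fun s => (L * eta)%:C * fejer N (s - t0) +
      (L / eta * (4 / N%:R))%:C) <= _).
    have cc : ccontinuous (fun s => (L * eta)%:C * fejer N (s - t0)).
      by apply: ccontinuousM => //; exact: ccontinuous_cst.
    apply: le_norm_mean => //.
    - apply: ccontinuousM => //; apply: ccontinuousD => //; exact: ccontinuous_cst.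
    - apply: ccontinuousD => //; exact: ccontinuous_cst.
    move=> s _; rewrite normrM [X in _ * X]ger0_norm ?fejer_ge0//.
    apply: le_trans (ler_wpM2r (fejer_ge0 _ _) (hL s eta e0)) _.
    have -> : (L * (eta + chord T (s - t0) / eta))%:C * fejer N (s - t0) =
        (L * eta)%:C * fejer N (s - t0) +
        (L / eta)%:C * ((chord T (s - t0))%:C * fejer N (s - t0)).
      by rewrite mulrA -rmorphM -mulrDl -rmorphD/=; congr (_%:C * _); ring.
    rewrite lerD2l [in leRHS]rmorphM/= ler_wpM2l ?chord_fejer_le//.
    by rewrite ler0c divr_ge0// ltW.
  have c0 := ccontinuous_cst (L / eta * (4 / N%:R))%:C.
  rewrite meanD//; last by apply: ccontinuousM => //; exact: ccontinuous_cst.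
  rewrite meanZ// mean_fejer1// mulr1 mean_cst// -rmorphD lecR.
  by rewrite le_eqVlt; apply/orP; left; apply/eqP; field; rewrite !gt_eqF.
suff : Re `|F t0| <= B by rewrite normc_def lecR.
apply/ler_addgt0Pr => e e0.
(* This makes [2 * L * eta] at most [e]; [N] is then chosen so that [4 / (N * eta) <= eta]. The
   shift [L + 1] covers [L = 0]. *)
pose eta := e / (2 * (L + 1)).
have L1 : 0 < L + 1 by rewrite ltr_wpDl.
have eta0 : 0 < eta by rewrite divr_gt0// mulr_gt0.
have [N N0 hN] : exists2 N : nat, (0 < N)%N & 4 / (eta * eta) <= N%:R.
  exists (Num.bound (4 / (eta * eta))).+1 => //.
  have q0 : 0 <= 4 / (eta * eta) by rewrite divr_ge0// mulr_ge0// ltW.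
  by apply: le_trans (ltW (archi_boundP q0)) _; rewrite ler_nat.
have := key N eta N0 eta0; rewrite normc_def/= lecR => /le_trans; apply.
rewrite lerD2l.
have N0' : (0 : R) < N%:R by rewrite ltr0n.
have h : 4 / (N%:R * eta) <= eta.
  move: hN; rewrite (ler_pdivrMr _ _ (mulr_gt0 eta0 eta0)).
  by rewrite (ler_pdivrMr _ _ (mulr_gt0 N0' eta0)) mulrCA.
apply: le_trans (_ : L * (2 * eta) <= _); first by rewrite ler_wpM2l//; lra.
rewrite /eta (_ : L * (2 * (e / (2 * (L + 1)))) = L / (L + 1) * e); last first.
  by field; rewrite gt_eqF.
by rewrite ler_piMl ?(ltW e0)// ler_pdivrMr//; lra.
Qed.

End Fejer.

(** * Truncated Fourier series of periodic C^3 functions *)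

Section Truncation.
Context {R : realType} (T : R) (hT : 0 < T).
Local Notation C := R[i].
Local Notation Om := (frequency T).
Local Notation mode := (mode T).
Implicit Types (F G : R -> C).

Lemma periodic_T0 (U : Type) (f : R -> U) : (forall t, f (t + T) = f t) -> f T = f 0.
Proof. by move=> /(_ 0); rewrite add0r. Qed.

Lemma norm_coef_tail F F1 F2 F3 (M : R) (a b : nat) (n : int) :
  cderivable F F1 -> cderivable F1 F2 -> cderivable F2 F3 -> ccontinuous F3 ->
  (forall t, F (t + T) = F t) -> (forall t, F1 (t + T) = F1 t) ->
  (forall t, F2 (t + T) = F2 t) ->
  (forall t, 0 <= t <= T -> `|F3 t| <= M%:C) ->
  (n < - a%:Z) || (b%:Z < n) ->
  `|coef T F n| <= (M / Om ^+ 3 * (tail b n + tail a (- n)))%:C.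
Proof.
move=> d1 d2 d3 c3 p0 p1 p2 hM hn.
have O0 := frequency_gt0 hT.
have M0 : 0 <= M.
  have := le_trans (normr_ge0 _) (hM 0 _); rewrite lexx (ltW hT) => /(_ isT).
  by rewrite ler0c.
have h := norm_coef_C3 hT n d1 d2 d3 c3 (periodic_T0 p0) (periodic_T0 p1) (periodic_T0 p2) hM.
move: h; rewrite normc_def -rmorphM !lecR; move: (Num.sqrt _) => x h.
have pos (m : int) (c : nat) : c%:Z < m -> (0 : R) < m%:~R.
  by move=> cm; rewrite ltr0z (le_lt_trans _ cm).
have M3 : 0 <= M / Om ^+ 3 by rewrite divr_ge0// exprn_ge0// ltW.
have key (m : int) (c : nat) : `|n%:~R| = m%:~R :> R -> c%:Z < m ->
    x <= M / Om ^+ 3 * tail c m.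
  move=> nm cm; have m0 := pos _ _ cm.
  rewrite /tail cm -mulrA -invfM -exprMn ler_pdivlMr ?exprn_gt0 ?(mulr_gt0 O0 m0)//.
  by rewrite [Om * _]mulrC -nm.
have tail0 : forall (k : int) (e : nat), (0 : R) <= tail e k.
  by move=> k e; rewrite /tail; case: ifP => // ck; rewrite invr_ge0 exprn_ge0// (ltW (pos _ _ ck)).
case/orP: hn => hn; rewrite mulrDr.
  apply: le_trans (key (- n) a _ _) _; last by rewrite lerDr mulr_ge0.
    rewrite ltr0_norm ?intrN// -oppr_gt0 -intrN; apply: (pos _ a).
    by rewrite ltrNr.
  by rewrite ltrNr.
apply: le_trans (key n b _ hn) _; last by rewrite lerDl mulr_ge0.
by rewrite gtr0_norm// (pos _ b).
Qed.

(** [fejer_bound] is applied to the remainder [G], whose coefficients vanish in the window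
    [-i, N - i] and are those of [F] outside; the two cubic tails supply its bound. The constant
    [M1] only makes [F] chord-Lipschitz and does not enter the estimate. *)
Lemma fourier_truncation F F1 F2 F3 (M1 M : R) (N i : nat) t : (i <= N)%N ->
  cderivable F F1 -> cderivable F1 F2 -> cderivable F2 F3 -> ccontinuous F3 ->
  (forall t, F (t + T) = F t) -> (forall t, F1 (t + T) = F1 t) ->
  (forall t, F2 (t + T) = F2 t) ->
  (forall t, `|F1 t| <= M1%:C) ->
  (forall t, 0 <= t <= T -> `|F3 t| <= M%:C) ->
  `|F t - \sum_(j < N.+1) coef T F (j%:Z - i%:Z) * mode (i%:Z - j%:Z) t| <=
  (2 * M / Om ^+ 3 * (1 / (N - i).+1%:R ^+ 2 + 1 / i.+1%:R ^+ 2))%:C.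
Proof.
move=> iN d1 d2 d3 c3 p0 p1 p2 hM1 hM.
have O0 := frequency_gt0 hT.
have M0 : 0 <= M.
  have := le_trans (normr_ge0 _) (hM 0 _); rewrite lexx (ltW hT) => /(_ isT).
  by rewrite ler0c.
have cF := cderivable_continuous d1.
pose S s := \sum_(j < N.+1) (- coef T F (j%:Z - i%:Z)) * mode (i%:Z - j%:Z) s.
pose G s := F s + S s.
have cSj (j : 'I_N.+1) : ccontinuous (fun s => - coef T F (j%:Z - i%:Z) * mode (i%:Z - j%:Z) s).
  by apply: ccontinuousM; [exact: ccontinuous_cst|exact: ccontinuous_mode].
have cS : ccontinuous S by exact: ccontinuous_sum.
have cG : ccontinuous G by exact: ccontinuousD.
have -> : F t - \sum_(j < N.+1) coef T F (j%:Z - i%:Z) * mode (i%:Z - j%:Z) t = G t.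
  by rewrite /G /S; congr (_ + _); rewrite -sumrN; apply: eq_bigr => j _; rewrite mulNr.
have lG : chord_lipschitz T G t.
  apply: chord_lipschitzD; first exact: chord_lipschitz_C1 d1 p0 hM1.
  apply: chord_lipschitz_sum => j; apply: chord_lipschitzZ.
  have dm := cderivable_mode T (i%:Z - j%:Z).
  apply: (chord_lipschitz_C1 (M := `|(i%:Z - j%:Z)%:~R * Om|) hT t dm).
    by move=> s; rewrite mode_addt mode_period ?mulr1.
  move=> s; rewrite normrM norm_mode mulr1 normrM norm_iunit mul1r normc_def/=.
  by rewrite expr0n addr0 sqrtr_sqr.
(* Orthogonality of the modes: [S] cancels exactly the coefficients with -i <= n <= N - i. *)
have coefG n : coef T G n =
    if (n < - i%:Z) || ((N - i)%N%:Z < n) then coef T F n else 0.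
  have c1 := ccontinuousM cF (ccontinuous_mode T n).
  have c2 := ccontinuousM cS (ccontinuous_mode T n).
  have -> : coef T G n = coef T F n + coef T S n.
    by rewrite /coef -meanD//; apply: eq_mean => s _; rewrite /G mulrDl.
  have -> : coef T S n =
      \sum_(j < N.+1) (- coef T F (j%:Z - i%:Z)) * (j%:Z == n + i%:Z)%:R.
    rewrite /coef; transitivity (mean T (fun s => \sum_(j < N.+1)
        (- coef T F (j%:Z - i%:Z)) * mode (i%:Z - j%:Z + n) s)).
      apply: eq_mean => s _; rewrite mulr_suml; apply: eq_bigr => j _.
      by rewrite -mulrA -modeD.
    rewrite mean_sum// => [|j]; last first.
      by apply: ccontinuousM; [exact: ccontinuous_cst|exact: ccontinuous_mode].
    apply: eq_bigr => j _; rewrite meanZ; last exact: ccontinuous_mode.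
    rewrite mean_mode//; congr (_ * _%:R).
    rewrite (_ : (i%:Z - j%:Z + n == 0) = (j%:Z == n + i%:Z))//.
    by rewrite [RHS]eq_sym -[RHS]subr_eq0; congr (_ == _); ring.
  case: ifPn => [hn|]; last first.
    rewrite negb_or -!leNgt => /andP[hn1 hn2].
    have ni0 : 0 <= n + i%:Z by rewrite -lerBlDr sub0r.
    have niN : (absz (n + i%:Z)%R < N.+1)%N.
      rewrite -ltz_nat gez0_abs// -addn1 PoszD ltzD1.
      by move: hn2; rewrite -subzn// lerBrDr.
    rewrite (bigD1 (Ordinal niN))//= gez0_abs// eqxx mulr1 addrK big1 ?addr0 ?subrr// => j.
    rewrite -val_eqE/= => /negbTE jn.
    suff -> : (j%:Z == n + i%:Z) = false by rewrite mulr0.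
    by rewrite -[n + i%:Z]gez0_abs// eqz_nat.
  rewrite big1 ?addr0// => j _; suff -> : (j%:Z == n + i%:Z) = false by rewrite mulr0.
  apply/negP => /eqP jn; move: hn.
  have -> : n = j%:Z - i%:Z by rewrite jn addrK.
  rewrite -subzn// ltrD2r ltrBlDr addNr ltz_nat ltn0/= ltz_nat.
  by rewrite ltnNge -ltnS ltn_ord.
have -> : 2 * M / Om ^+ 3 * (1 / (N - i).+1%:R ^+ 2 + 1 / i.+1%:R ^+ 2) =
    M / Om ^+ 3 * (2 / (N - i).+1%:R ^+ 2 + 2 / i.+1%:R ^+ 2) by ring.
apply: (fejer_bound hT cG lG) => n p.
have M3 : 0 <= M / Om ^+ 3 by rewrite divr_ge0// exprn_ge0// ltW.
apply: le_trans (_ : \sum_(q < n) (M / Om ^+ 3 *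
  (tail (N - i) (p - q%:Z) + tail i (q%:Z - p)))%:C <= _).
  apply: ler_sum => q _; rewrite coefG; case: ifPn => hn.
    by rewrite -[q%:Z - p]opprB (norm_coef_tail d1 d2 d3).
  have tpos (m : int) (c : nat) : (0 : R) <= tail c m.
    rewrite /tail; case: ifP => // cm.
    by rewrite invr_ge0 exprn_ge0// ler0z (le_trans _ (ltW cm)).
  by rewrite normr0 ler0c mulr_ge0// addr_ge0.
rewrite -rmorph_sum lecR -mulr_sumr ler_wpM2l// big_split/= lerD//.
  by have [] := @sum_tail R (N - i) n p.
by have [] := @sum_tail R i n p.
Qed.

End Truncation.

(** * Hermitian forms and energy estimates *)

Section HermitianForms.
Context {R : realType} {V : lmodType R[i]}.
Local Notation C := R[i].
Implicit Types (b : V -> V -> C) (u v w : V).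

Definition hermitian_form b :=
  (forall (a : C) u v w, b w (a *: u + v) = a * b w u + b w v) /\
  (forall u v, b u v = (b v u)^*).

Definition positive_form b := hermitian_form b /\ forall v, 0 <= b v v.

Definition fnorm b v : R := Num.sqrt (Re (b v v)).

Section Hermitian.
Context b (hb : hermitian_form b).

Lemma hform0r w : b w 0 = 0.
Proof.
have := hb.1 1 0 0 w; rewrite scale1r addr0 mul1r => /eqP.
by rewrite -subr_eq0 opprD addrA subrr sub0r oppr_eq0 => /eqP.
Qed.

Lemma hformDr w u v : b w (u + v) = b w u + b w v.
Proof. by rewrite -[u in LHS]scale1r hb.1 mul1r. Qed.

Lemma hformZr w a u : b w (a *: u) = a * b w u.
Proof. by rewrite -[a *: u]addr0 hb.1 hform0r addr0. Qed.

Lemma hformNr w u : b w (- u) = - b w u.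
Proof. by rewrite -scaleN1r hformZr mulN1r. Qed.

Lemma hform_sumr (I : Type) (r : seq I) (P : pred I) (F : I -> V) w :
  b w (\sum_(i <- r | P i) F i) = \sum_(i <- r | P i) b w (F i).
Proof. exact: (big_morph (b w) (hformDr w) (hform0r w)). Qed.

Lemma hform0l w : b 0 w = 0.
Proof. by rewrite hb.2 hform0r conjC0. Qed.

Lemma hformDl w u v : b (u + v) w = b u w + b v w.
Proof. by rewrite hb.2 hformDr rmorphD/= -!hb.2. Qed.

Lemma hformZl w a u : b (a *: u) w = a^* * b u w.
Proof. by rewrite hb.2 hformZr rmorphM/= -hb.2. Qed.

Lemma hformNl w u : b (- u) w = - b u w.
Proof. by rewrite -scaleN1r hformZl rmorphN/= conjC1 mulN1r. Qed.

Lemma hform_suml (I : Type) (r : seq I) (P : pred I) (F : I -> V) w :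
  b (\sum_(i <- r | P i) F i) w = \sum_(i <- r | P i) b (F i) w.
Proof. exact: (big_morph (fun u => b u w) (hformDl w) (hform0l w)). Qed.

Lemma hform_diag_real v : b v v = (Re (b v v))%:C.
Proof.
apply: complex_eqP => //=.
have := congr1 (@complex.Im R) (hb.2 v v); rewrite Im_conjc.
by move=> /eqP; rewrite -subr_eq0 opprK -mulr2n mulrn_eq0/= => /eqP.
Qed.

End Hermitian.

Section Positive.
Context b (pb : positive_form b).
Let hb := pb.1.

Lemma Re_form_ge0 v : 0 <= Re (b v v).
Proof. by have := pb.2 v; rewrite (hform_diag_real hb) ler0c. Qed.

Lemma fnorm_ge0 v : 0 <= fnorm b v. Proof. exact: sqrtr_ge0. Qed.

Lemma fnorm_sqr v : fnorm b v ^+ 2 = Re (b v v).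
Proof. by rewrite sqr_sqrtr// Re_form_ge0. Qed.

Lemma form_diag v : b v v = (fnorm b v ^+ 2)%:C.
Proof. by rewrite fnorm_sqr -hform_diag_real. Qed.

Lemma cauchy_schwarz v w : `|b v w| <= (fnorm b v * fnorm b w)%:C.
Proof.
pose z := b v w; pose n2 := Re z ^+ 2 + Im z ^+ 2.
have n20 : 0 <= n2 by rewrite addr_ge0 ?sqr_ge0.
(* The form at [v - s z^* w], as a quadratic polynomial in the real number [s]. *)
have q (s : R) : 0 <= Re (b v v) - 2 * s * n2 + s ^+ 2 * n2 * Re (b w w).
  have := Re_form_ge0 (v + (- s%:C * z^*) *: w).
  rewrite hformDl// !hformDr// !hformZl// !hformZr// -[b w v]conjCK -hb.2 -/z.
  rewrite (hform_diag_real hb v) (hform_diag_real hb w).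
  rewrite !(Re_add, Re_mul, Im_mul, Re_conjc, Im_conjc, Im_add, Re_opp, Im_opp)/=.
  rewrite /n2; move: (Re z) (Im z) (Re _) (Re _) => x y a c.
  by set l := (X in 0 <= X -> _); set r := (X in _ -> 0 <= X);
     have -> : l = r by rewrite /l /r; ring.
have : n2 <= Re (b v v) * Re (b w w).
  (* If [b w w] vanishes, the polynomial is affine in [s] and the chosen [s] would give it the value
     -1; otherwise [s] is the minimiser. *)
  have := Re_form_ge0 w; rewrite le_eqVlt => /predU1P[w0|w0].
    rewrite -w0 mulr0; rewrite -w0 in q; rewrite leNgt; apply/negP => n2p.
    have := q ((Re (b v v) + 1) / (2 * n2)).
    rewrite mulr0 addr0 (_ : 2 * _ * n2 = Re (b v v) + 1); first by lra.
    by field; rewrite gt_eqF.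
  have := q (Re (b w w))^-1.
  rewrite (_ : _ - _ + _ = (Re (b v v) * Re (b w w) - n2) / Re (b w w)).
    by rewrite pmulr_lge0 ?invr_gt0// subr_ge0.
  by field; rewrite gt_eqF.
move=> h; rewrite norm_le_sqr ?mulr_ge0 ?fnorm_ge0//.
by rewrite exprMn !fnorm_sqr.
Qed.

Lemma fnormZ (a : C) v : fnorm b (a *: v) = Re `|a| * fnorm b v.
Proof.
rewrite /fnorm hformZl// hformZr// mulrA [a^* * a]mulrC -normCK normc_def.
rewrite -rmorphXn/= Re_mul/= mul0r subr0 sqrtrM ?sqr_ge0// sqrtr_sqr.
by rewrite ger0_norm ?sqrtr_ge0.
Qed.

Lemma fnormD v w : fnorm b (v + w) <= fnorm b v + fnorm b w.
Proof.
rewrite -(ler_pXn2r (_ : (0 < 2)%N)) ?nnegrE ?addr_ge0 ?fnorm_ge0//.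
rewrite sqrrD !fnorm_sqr hformDl// !hformDr// !Re_add.
have h1 := Re_le_norm (cauchy_schwarz v w).
have h2 := Re_le_norm (cauchy_schwarz w v).
by rewrite mulr2n; lra.
Qed.

Lemma fnormN v : fnorm b (- v) = fnorm b v.
Proof. by rewrite /fnorm hformNl// hformNr// opprK. Qed.

Lemma fnorm0 : fnorm b 0 = 0.
Proof. by rewrite /fnorm hform0r// sqrtr0. Qed.

Lemma fnorm_sum (I : Type) (r : seq I) (F : I -> V) :
  fnorm b (\sum_(i <- r) F i) <= \sum_(i <- r) fnorm b (F i).
Proof.
elim: r => [|i r IH]; first by rewrite !big_nil fnorm0.
by rewrite !big_cons (le_trans (fnormD _ _))// lerD2l.
Qed.

End Positive.

(* Applied to [A * p + b] and [A * p - b], both positive, the Cauchy-Schwarz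
   inequality bounds [b] by [p] off the diagonal. *)
Lemma hermitian_le p b (A : R) : positive_form p -> hermitian_form b ->
  (forall v, `|Re (b v v)| <= A * Re (p v v)) ->
  forall v w, `|b v w| <= (2 * A * (fnorm p v * fnorm p w))%:C.
Proof.
move=> pp hb hA.
have pos (e : C) : (e = 1 \/ e = -1) -> positive_form (fun v w => A%:C * p v w + e * b v w).
  move=> he; have ce : e^* = e by case: he => ->; rewrite ?rmorphN/= conjC1.
  split; first split.
  - by move=> a u v w; rewrite !(hformDr hb, hformDr pp.1, hformZr hb, hformZr pp.1); ring.
  - move=> u v; rewrite (pp.1.2 u v) (hb.2 u v) rmorphD !rmorphM/= ce.
    by congr (_ * _ + _ * _); apply: complex_eqP; rewrite ?/= ?oppr0.
  - move=> v; rewrite (hform_diag_real pp.1) (hform_diag_real hb).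
    have := hA v; rewrite ler_norml => /andP[h1 h2].
    case: he => ->; rewrite ?mulN1r ?mul1r lecE/= ?mul0r ?mulr0 ?addr0 ?subr0 ?oppr0 eqxx/=; lra.
have A0 v : 0 <= A * Re (p v v) by apply: le_trans (hA v).
have bnd e v : (e = 1 \/ e = -1) ->
    fnorm (fun v w => A%:C * p v w + e * b v w) v ^+ 2 <= 2 * A * fnorm p v ^+ 2.
  move=> he; rewrite (fnorm_sqr (pos e he)) (fnorm_sqr pp).
  rewrite (hform_diag_real pp.1) (hform_diag_real hb).
  have := hA v; rewrite ler_norml => /andP[h1 h2].
  case: he => ->; rewrite ?mulN1r ?mul1r /= ?mul0r ?mulr0 ?addr0 ?subr0; lra.
move=> v w.
have -> : b v w = 2^-1 * ((A%:C * p v w + 1 * b v w) - (A%:C * p v w + -1 * b v w)).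
  by field.
have A2 : 0 <= 2 * A * (fnorm p v * fnorm p w).
  have [A1|A1] := leP 0 A; first by rewrite !mulr_ge0 ?fnorm_ge0.
  have : fnorm p v = 0.
    apply/eqP; rewrite -sqrf_eq0 (fnorm_sqr pp) eq_le Re_form_ge0// andbT.
    by have := A0 v; rewrite nmulr_rge0.
  by move=> ->; rewrite mul0r mulr0.
have key e : (e = 1 \/ e = -1) ->
    `|A%:C * p v w + e * b v w| <= (2 * A * (fnorm p v * fnorm p w))%:C.
  move=> he; apply: le_trans (cauchy_schwarz (pos e he) v w) _; rewrite lecR.
  have f0 b' (x : V) : 0 <= fnorm b' x by exact: sqrtr_ge0.
  rewrite -(ler_pXn2r (_ : (0 < 2)%N)) ?nnegrE ?A2 ?(mulr_ge0 (f0 _ _) (f0 _ _))//.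
  rewrite !exprMn.
  apply: le_trans (ler_pM (sqr_ge0 _) (sqr_ge0 _) (bnd e v he) (bnd e w he)) _.
  by rewrite le_eqVlt; apply/orP; left; apply/eqP; ring.
rewrite normrM; apply: le_trans (ler_wpM2l (normr_ge0 _) (ler_normB _ _)) _.
apply: le_trans (ler_wpM2l (normr_ge0 _) (lerD (key 1 _) (key (-1) _))) _; [by left|by right|].
rewrite ger0_norm ?invr_ge0//; move: (_%:C) => x.
by rewrite (_ : 2^-1 * (x + x) = x)//; field.
Qed.

End HermitianForms.

(** * One-sided derivatives and the Gronwall inequality *)

Section Gronwall.
Context {R : realType}.
Implicit Types (f g : R -> R) (t : R).

(* The filter of the one-sided-at-0 difference quotients of [time_derivative]. *)
Definition half_line t : set_system R := within [set s | 0 <= t + s] 0^'.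

Global Instance half_line_filter t : Filter (half_line t).
Proof. exact: within_filter. Qed.

Lemma half_line_cvg t f (G : set_system R) :
  f s @[s --> 0^'] --> G -> f s @[s --> half_line t] --> G.
Proof. exact: cvg_within_filter. Qed.

Lemma half_line_neq0 t : \forall s \near half_line t, s != 0.
Proof. by apply: cvg_within; near=> s; near: s; exact: nbhs_dnbhs_neq. Unshelve. all: by end_near. Qed.

Lemma half_line_id t : s @[s --> half_line t] --> (0 : R).
Proof. by apply: half_line_cvg; apply: cvg_within. Qed.

Lemma half_line_pos t : 0 < t -> half_line t = 0^'.
Proof.
move=> t0; apply/seteqP; split => A; last exact: cvg_within.
rewrite /half_line /within/= => h; near=> s.
have : (0 <= t + s) by rewrite -lerBlDl sub0r ltW//; near: s; apply: nbhs_dnbhs; apply: lt_nbhsr; rewrite oppr_lt0.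
by near: s.
Unshelve. all: by end_near. Qed.

Lemma half_line_at_right : 0^'+ `=>` half_line (0 : R).
Proof.
move=> A h; have {}h : \forall s \near (0 : R), s != 0 -> 0 <= 0 + s -> A s by [].
rewrite /at_right /within/=; apply: filterS h => s h s0.
by apply: h; [rewrite gt_eqF|rewrite add0r ltW].
Qed.

Lemma squeeze_cvg0 (F : set_system R) {FF : Filter F} (f h : R -> R) :
  (\forall s \near F, 0 <= f s <= h s) -> h s @[s --> F] --> (0 : R) ->
  f s @[s --> F] --> (0 : R).
Proof.
move=> fh hh; apply: (squeeze_cvgr (f := fun=> 0) (h := h)) => //.
exact: cvg_cst.
Qed.

Lemma cvg_sum0 (F : set_system R) {FF : Filter F} (I : Type) (r : seq I) (g : I -> R -> R) :
  (forall i, g i s @[s --> F] --> (0 : R)) ->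
  \sum_(i <- r) g i s @[s --> F] --> (0 : R).
Proof.
move=> hg; elim: r => [|i r IH].
  by under eq_fun do rewrite big_nil; exact: cvg_cst.
under eq_fun do rewrite big_cons.
by have h := cvgD (hg i) IH; rewrite addr0 in h; exact: h.
Qed.

Definition half_derivative f t df :=
  s^-1 * (f (t + s) - f t) @[s --> half_line t] --> (df : R).

Lemma half_derivative_is_derive f t df : 0 < t -> half_derivative f t df ->
  is_derive t 1 f df.
Proof.
move=> t0; rewrite /half_derivative half_line_pos// => h.
have h' : (fun s => s^-1 *: (f (s *: 1 + t) - f t)) @ 0^' --> df.
  apply: cvg_trans h; apply: near_eq_cvg; near=> s.
  by rewrite /GRing.scale/= mulr1 [s + t]addrC.
by split; [apply/cvg_ex; exists df|exact: cvg_lim].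
Unshelve. all: by end_near. Qed.

Lemma is_derive_half_derivative f t df : is_derive t 1 f df -> half_derivative f t df.
Proof.
move=> [/cvg_ex[l hl] e]; apply: half_line_cvg.
have -> : df = l by rewrite -e; exact: cvg_lim.
apply: cvg_trans hl; apply: near_eq_cvg; near=> s.
by rewrite /= /GRing.scale/= mulr1 [s + t]addrC.
Unshelve. all: by end_near. Qed.

Lemma half_derivativeD f g t df dg : half_derivative f t df -> half_derivative g t dg ->
  half_derivative (fun s => f s + g s) t (df + dg).
Proof.
move=> hf hg; apply: cvg_trans (cvgD hf hg); apply: near_eq_cvg; near=> s.
by rewrite -[LHS]/(s^-1 * (f (t + s) - f t) + s^-1 * (g (t + s) - g t)); ring.
Unshelve. all: by end_near. Qed.

Lemma half_derivative_right f df : half_derivative f 0 df -> f s @[s --> 0^'+] --> f 0.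
Proof.
move=> h; have h1 := cvg_trans (cvg_app _ (@half_line_at_right)) h.
have h2 : s * (s^-1 * (f (0 + s) - f 0)) + f 0 @[s --> 0^'+] --> 0 * df + f 0.
  apply: cvgD; last exact: cvg_cst.
  apply: cvgM => //; apply: cvg_at_right_filter; exact: cvg_id.
rewrite mul0r add0r in h2; apply: cvg_trans h2; apply: near_eq_cvg; near=> s.
have s0 : s != 0 by rewrite gt_eqF.
by rewrite mulrA mulfV// mul1r subrK add0r.
Unshelve. all: by end_near. Qed.

(** The function e^(-a r) E(r) - b r is nonincreasing, since E' - a E <= b and e^(-a r) <= 1. At 0
    the one-sided derivative gives right continuity, which is all that monotonicity on [0, t] asks
    there. *)
Lemma gronwall (E E' : R -> R) (a b t : R) : 0 <= t -> 0 <= a -> 0 <= b ->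
  (forall r, 0 <= r -> half_derivative E r (E' r)) ->
  (forall r, 0 <= r <= t -> E' r <= a * E r + b) ->
  E 0 = 0 -> E t <= b * t * expR (a * t).
Proof.
move=> t0 a0 b0 dE hE E0.
have [->|tn0] := eqVneq t 0; first by rewrite E0 mulr0 mul0r.
have tp : 0 < t by rewrite lt_neqAle eq_sym tn0.
have de (x : R) : is_derive x 1 (fun r => expR (- a * r)) (- a * expR (- a * x)).
  by apply: is_derive_eq; rewrite /GRing.scale/=; ring.
pose G r := expR (- a * r) * E r - b * r.
have dG (r : R) : 0 < r -> is_derive r 1 G (expR (- a * r) * (E' r - a * E r) - b).
  move=> r0; have dEr := half_derivative_is_derive r0 (dE r (ltW r0)).
  by apply: is_derive_eq; rewrite /GRing.scale/=; ring.
have : G t <= G 0.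
  apply: (@ler0_derive1_nincr _ G 0 t) => //.
  - by move=> x; rewrite in_itv/= => /andP[x0 _]; have [] := dG x x0.
  - move=> x; rewrite in_itv/= => /andP[x0 xt]; rewrite derive1E.
    have [_ ->] := dG x x0; rewrite subr_le0.
    have : E' x - a * E x <= b by rewrite lerBlDl hE// !ltW.
    have e1 : expR (- a * x) <= 1.
      by rewrite mulNr -expR0 ler_expR oppr_le0 mulr_ge0// ltW.
    have := expR_ge0 (- a * x); nra.
  - apply/continuous_within_itvP => //; split.
    + move=> x; rewrite in_itv/= => /andP[x0 _].
      exact: is_derive_continuous (dG x x0).
    + rewrite /G; apply: cvgB.
        apply: cvgM; last exact: half_derivative_right (dE 0 _).
        by apply: cvg_at_right_filter; exact: (is_derive_continuous (de 0)).
      by apply: cvg_at_right_filter; apply: cvgM; [exact: cvg_cst|exact: cvg_id].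
    + apply: cvg_at_left_filter; exact: is_derive_continuous (dG t tp).
rewrite /G E0 !mulr0 subr0 subr_le0 => h.
have := expR_gt0 (a * t) => e0.
have : expR (a * t) * (expR (- a * t) * E t) <= expR (a * t) * (b * t) by rewrite ler_pM2l.
by rewrite mulrA -expRD mulNr subrr expR0 mul1r mulrC.
Qed.

End Gronwall.

(** * Derivatives of curves in the norm of a form *)

Section FormDerivative.
Context {R : realType} {V : lmodType R[i]} (m : V -> V -> R[i]) (hm : positive_form m).
Local Notation C := R[i].
Implicit Types (e f : R -> V) (t : R).

(** Same quotient and same filter as [time_derivative], with the norm of an abstract form, so that
    the two agree once coordinates are introduced. *)
Definition curve_derivative e t (w : V) :=
  fnorm m ((s^-1)%:C *: (e (t + s) - e t) - w) @[s --> half_line t] --> (0 : R).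

Lemma curve_derivativeB e f t v w :
  curve_derivative e t v -> curve_derivative f t w ->
  curve_derivative (fun s => e s - f s) t (v - w).
Proof.
move=> he hf; have h := cvgD (FF := half_line_filter t) he hf; rewrite addr0 in h.
rewrite /curve_derivative; apply: (squeeze_cvg0 _ h); near=> s; rewrite fnorm_ge0/=.
have sub4 (a b c d : V) : a - b - (c - d) = a - c - (b - d).
  by rewrite !opprD !opprK addrACA.
rewrite sub4 scalerBr sub4; apply: le_trans (fnormD hm _ _) _.
by rewrite (fnormN hm).
Unshelve. all: by end_near. Qed.

(** Serves to identify the initial velocity, which is given only as a derivative of the mode sum at
    0. *)
Lemma curve_derivative_unique e t v w :
  ProperFilter (half_line t) -> (forall v, fnorm m v = 0 -> v = 0) ->
  curve_derivative e t v -> curve_derivative e t w -> v = w.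
Proof.
move=> pf h0 hv hw; apply/eqP; rewrite -subr_eq0; apply/eqP/h0.
have h := curve_derivativeB hv hw; rewrite /curve_derivative in h.
have {}h : fnorm m (v - w) @[_ --> half_line t] --> (0 : R).
  apply: cvg_trans h; apply: near_eq_cvg; near=> s.
  by rewrite !subrr scaler0 sub0r fnormN.
by apply: (cvg_unique _ (cvg_cst _) h).
Unshelve. all: by end_near. Qed.

Lemma half_line0_proper : ProperFilter (half_line (0 : R)).
Proof.
apply: Build_ProperFilter_ex => A hA.
have : (0 : R)^'+ A by exact: half_line_at_right.
exact: (@filter_ex _ _ (at_right_proper_filter (0 : R))).
Qed.

(** The vector error is a combination of the [u i] whose coefficients [q i s] are the scalar errors
    of the exponentials, and these tend to 0. *)
Lemma curve_derivative_exp (I : finType) (lam : I -> C) (u : I -> V) t :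
  curve_derivative (fun s => \sum_i cexp (lam i * s%:C) *: u i) t
    (\sum_i (lam i * cexp (lam i * t%:C)) *: u i).
Proof.
pose q i s : C := (s^-1)%:C * (cexp (lam i * (t + s)%:C) - cexp (lam i * t%:C)) -
  lam i * cexp (lam i * t%:C).
have cR i : Re (q i s) @[s --> half_line t] --> (0 : R).
  have [/is_derive_half_derivative h _] := cderivable_cexp (lam i) t.
  rewrite -(subrr (Re (lam i * cexp (lam i * t%:C)))).
  apply: cvg_trans (cvgB h (cvg_cst _)); apply: near_eq_cvg; near=> s.
  rewrite -[LHS]/(s^-1 * (Re (cexp (lam i * (t + s)%:C)) - Re (cexp (lam i * t%:C))) -
    Re (lam i * cexp (lam i * t%:C))).
  by rewrite /q !(Re_add, Re_opp, Re_mul)/=; ring.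
have cI i : Im (q i s) @[s --> half_line t] --> (0 : R).
  have [_ /is_derive_half_derivative h] := cderivable_cexp (lam i) t.
  rewrite -(subrr (Im (lam i * cexp (lam i * t%:C)))).
  apply: cvg_trans (cvgB h (cvg_cst _)); apply: near_eq_cvg; near=> s.
  rewrite -[LHS]/(s^-1 * (Im (cexp (lam i * (t + s)%:C)) - Im (cexp (lam i * t%:C))) -
    Im (lam i * cexp (lam i * t%:C))).
  by rewrite /q !(Im_add, Im_opp, Im_mul)/=; ring.
have cq : \sum_i ((`|Re (q i s)| + `|Im (q i s)|) * fnorm m (u i)) @[s --> half_line t] --> (0 : R).
  apply: cvg_sum0 => i; rewrite -(mul0r (fnorm m (u i))); apply: cvgM; last exact: cvg_cst.
  have h := cvgD (cvg_norm (cR i)) (cvg_norm (cI i)).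
  by rewrite !normr0 addr0 in h; exact: h.
rewrite /curve_derivative; apply: (squeeze_cvg0 _ cq); near=> s; rewrite fnorm_ge0/=.
have -> : (s^-1)%:C *: (\sum_i cexp (lam i * (t + s)%:C) *: u i -
    \sum_i cexp (lam i * t%:C) *: u i) - \sum_i (lam i * cexp (lam i * t%:C)) *: u i =
    \sum_i q i s *: u i.
  rewrite -sumrB scaler_sumr -sumrB; apply: eq_bigr => i _.
  by rewrite /q -scalerBl scalerA -scalerBl.
apply: le_trans (fnorm_sum hm _ _) _; apply: ler_sum => i _.
by rewrite (fnormZ hm) ler_wpM2r ?fnorm_ge0// Re_norm_le.
Unshelve. all: by end_near. Qed.

End FormDerivative.

(** * Energy estimate for a damped second-order equation *)

Section Energy.
Context {R : realType} {V : lmodType R[i]} (m : V -> V -> R[i]) (hm : positive_form m).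
Local Notation C := R[i].
Implicit Types (e f : R -> V) (t : R).

Lemma squeeze_norm0 (F : set_system R) {FF : Filter F} (f h : R -> R) :
  (\forall s \near F, `|f s| <= h s) -> h s @[s --> F] --> (0 : R) ->
  f s @[s --> F] --> (0 : R).
Proof.
move=> fh hh; apply: (squeeze_cvgr (f := fun s => - h s) (h := h)) => //.
  by near=> s; rewrite -ler_norml; near: s.
by rewrite -oppr0; exact: cvgN.
Unshelve. all: by end_near. Qed.

(** With e(t + s) = e(t) + s (w + r(s)), the difference quotient splits into that of [b] at the
    fixed vector [e t], the cross term with [w], and terms in [r] or [s] that vanish in the limit
    because [b] is bounded relative to [m]. *)
Lemma form_product_derivative (b b1 : R -> V -> V -> C) (B : R) e w t :
  (forall t, hermitian_form (b t)) ->
  (forall v w, cderivable (fun t => b t v w) (fun t => b1 t v w)) ->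
  (forall t v w, `|b t v w| <= (B * (fnorm m v * fnorm m w))%:C) ->
  curve_derivative m e t w ->
  half_derivative (fun s => Re (b s (e s) (e s))) t
    (Re (b1 t (e t) (e t)) + 2 * Re (b t (e t) w)).
Proof.
move=> hb db bB he; have FF := half_line_filter t.
pose r s := (s^-1)%:C *: (e (t + s) - e t) - w.
have B0 v : 0 <= B * (fnorm m v * fnorm m v).
  by rewrite -ler0c; apply: le_trans (bB t v v).
have nB s v v' : `|Re (b s v v')| <= B * (fnorm m v * fnorm m v').
  by rewrite -lecR; apply: le_trans (normc_ge_Re _) (bB _ _ _).
have h1 : s^-1 * (Re (b (t + s) (e t) (e t)) - Re (b t (e t) (e t))) @[s --> half_line t] -->
    Re (b1 t (e t) (e t)).
  exact: is_derive_half_derivative (db _ _ t).1.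
have h2 : 2 * Re (b (t + s) (e t) w) @[s --> half_line t] --> 2 * Re (b t (e t) w).
  apply: cvgM; first exact: cvg_cst.
  have /is_derive_half_derivative h := (db (e t) w t).1.
  have h3 := cvgM (FF := FF) (half_line_id t) h; rewrite mul0r in h3.
  have h4 := cvgD (FF := FF) h3 (cvg_cst (FF := FF) (Re (b t (e t) w))).
  rewrite add0r in h4; apply: cvg_trans h4; apply: near_eq_cvg; near=> s.
  rewrite -[LHS]/(s * (s^-1 * (Re (b (t + s) (e t) w) - Re (b t (e t) w))) + Re (b t (e t) w)).
  have s0 : s != 0 by near: s; exact: half_line_neq0.
  by rewrite mulrA mulfV// mul1r subrK.
have hr : fnorm m (r s) @[s --> half_line t] --> (0 : R) by exact: he.
have h3 : 2 * Re (b (t + s) (e t) (r s)) + s * Re (b (t + s) (w + r s) (w + r s))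
    @[s --> half_line t] --> (0 : R).
  apply: (@squeeze_norm0 _ _ _ (fun s => 2 * (B * fnorm m (e t)) * fnorm m (r s) +
     `|s| * (`|B| * (fnorm m w + fnorm m (r s)) ^+ 2))).
    near=> s; apply: le_trans (ler_normD _ _) _; apply: lerD.
      rewrite normrM ger0_norm// -mulrA ler_wpM2l//.
      by apply: le_trans (nB _ _ _) _; rewrite mulrA.
    rewrite normrM ler_wpM2l//; apply: le_trans (nB _ _ _) _.
    apply: le_trans (_ : `|B| * (fnorm m (w + r s) * fnorm m (w + r s)) <= _).
      by rewrite ler_wpM2r ?ler_norm// mulr_ge0 ?fnorm_ge0.
    rewrite ler_wpM2l// -expr2 ler_sqr ?nnegrE ?addr_ge0 ?fnorm_ge0//.
    exact: fnormD.
  have a1 := cvgM (FF := FF) (cvg_cst (FF := FF) (2 * (B * fnorm m (e t)))) hr.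
  have a2 := cvgD (FF := FF) (cvg_cst (FF := FF) (fnorm m w)) hr.
  have a3 := cvgM (FF := FF) (cvg_cst (FF := FF) `|B|) (cvgM (FF := FF) a2 a2).
  have a4 := cvgM (FF := FF) (cvg_norm (FF := FF) (half_line_id t)) a3.
  have := cvgD (FF := FF) a1 a4.
  by rewrite normr0 mulr0 mul0r addr0; exact.
have := cvgD (FF := FF) (cvgD (FF := FF) h1 h2) h3; rewrite addr0 => h4.
apply: cvg_trans h4; apply: near_eq_cvg; near=> s.
rewrite -[LHS]/(s^-1 * (Re (b (t + s) (e t) (e t)) - Re (b t (e t) (e t))) +
  2 * Re (b (t + s) (e t) w) +
  (2 * Re (b (t + s) (e t) (r s)) + s * Re (b (t + s) (w + r s) (w + r s)))).
have s0 : s != 0 by near: s; exact: half_line_neq0.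
have -> : e (t + s) = e t + s%:C *: (w + r s).
  by rewrite /r addrCA subrr addr0 scalerA -rmorphM/= mulfV// scale1r [RHS]addrC subrK.
have hbs := hb (t + s).
have sC : (s%:C)^* = s%:C :> C by apply: complex_eqP; rewrite //= oppr0.
move: (r s) => x.
rewrite !(hformDl hbs, hformDr hbs, hformZl hbs, hformZr hbs) sC.
rewrite (hbs.2 w (e t)) (hbs.2 x (e t)).
rewrite !(Re_add, Re_mul, Im_add, Im_mul, Re_conjc)/=.
by field.
Unshelve. all: by end_near. Qed.

Context (g s : V -> V -> C) (k k1 : R -> V -> V -> C) (kap0 M c0 B : R).
Context (hg : positive_form g) (hs : positive_form s).
Context (hk : forall t, hermitian_form (k t)) (hc0 : 0 < c0) (hM : 0 <= M).
Context (hcoer : forall t v, c0 * Re (g v v) <= Re (k t v v)).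
Context (dk : forall v w, cderivable (fun t => k t v w) (fun t => k1 t v w)).
Context (bk1 : forall t v w, `|k1 t v w| <= (M * (fnorm g v * fnorm g w))%:C).
Context (bk : forall t v w, `|k t v w| <= (B * (fnorm m v * fnorm m w))%:C).
Context (hkap0 : 0 <= kap0).

(** Testing with [e1] leaves a damping term of favourable sign, the form [k1], which coercivity
    bounds by [M / c0] times the energy, and two products split by Young's inequality, covered by
    the 3 in the rate. The constant [B] enters only through differentiability of the energy. The
    summand |e|^2 yields the L^2 bound on the error itself. *)
Lemma energy_estimate (e e1 e2 : R -> V) (res : R -> V -> C) (rho t : R) : 0 <= t -> 0 <= rho ->
  (forall r, 0 <= r -> curve_derivative m e r (e1 r)) ->
  (forall r, 0 <= r -> curve_derivative m e1 r (e2 r)) ->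
  (forall r v, 0 <= r -> m v (e2 r) + k r v (e r) + kap0%:C * s v (e1 r) = - res r v) ->
  (forall r v, 0 <= r <= t -> `|res r v| <= (rho * fnorm m v)%:C) ->
  e 0 = 0 -> e1 0 = 0 ->
  fnorm m (e1 t) ^+ 2 + c0 * fnorm g (e t) ^+ 2 + fnorm m (e t) ^+ 2 <=
  rho ^+ 2 * (t * expR ((3 + M / c0) * t)).
Proof.
move=> t0 rho0 de de1 eqn hres e0 e10.
pose E r := Re (m (e1 r) (e1 r)) + Re (k r (e r) (e r)) + Re (m (e r) (e r)).
(* The zeros are the time derivatives of the constant form [m], kept so that
   [form_product_derivative] applies to all three summands. *)
pose E' r := (0 + 2 * Re (m (e1 r) (e2 r))) +
  (Re (k1 r (e r) (e r)) + 2 * Re (k r (e r) (e1 r))) + (0 + 2 * Re (m (e r) (e1 r))).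
have dm v w : cderivable (fun t : R => m v w) (fun t => (fun=> fun=> fun=> 0 : C) t v w).
  exact: cderivable_cst.
have bm (r : R) v w : `|m v w| <= (1 * (fnorm m v * fnorm m w))%:C.
  by rewrite mul1r cauchy_schwarz.
have dE r : 0 <= r -> half_derivative E r (E' r).
  move=> r0; apply: half_derivativeD; first apply: half_derivativeD.
  - exact: form_product_derivative (fun _ => hm.1) dm bm (de1 r r0).
  - exact: form_product_derivative hk dk bk (de r r0).
  - exact: form_product_derivative (fun _ => hm.1) dm bm (de r r0).
have hE' r : 0 <= r <= t -> E' r <= (3 + M / c0) * E r + rho ^+ 2.
  move=> /[dup] rt /andP[r0 _].
  have := congr1 (@complex.Re R) (eqn r (e1 r) r0).
  rewrite !Re_add Re_mul/= mul0r subr0 Re_opp => q.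
  have sy : Re (k r (e r) (e1 r)) = Re (k r (e1 r) (e r)) by rewrite (hk r).2 Re_conjc.
  have S0 : 0 <= kap0 * Re (s (e1 r) (e1 r)) by rewrite mulr_ge0// Re_form_ge0.
  have h1 : `|Re (res r (e1 r))| <= rho * fnorm m (e1 r).
    by rewrite -lecR; apply: le_trans (normc_ge_Re _) (hres _ _ rt).
  have h2 : Re (k1 r (e r) (e r)) <= M / c0 * Re (k r (e r) (e r)).
    apply: le_trans (Re_le_norm (bk1 _ _ _)) _.
    rewrite -expr2 (fnorm_sqr hg) -mulrA ler_wpM2l// mulrC ler_pdivlMr//.
    by rewrite mulrC.
  have h3 : Re (m (e r) (e1 r)) <= fnorm m (e r) * fnorm m (e1 r).
    exact: Re_le_norm (cauchy_schwarz hm _ _).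
  have K0 : 0 <= Re (k r (e r) (e r)).
    by apply: le_trans (hcoer r _); rewrite mulr_ge0 ?(ltW hc0)// Re_form_ge0.
  have M0 : 0 <= M / c0 by rewrite divr_ge0// ltW.
  rewrite /E' /E -!(fnorm_sqr hm) !add0r sy.
  move: h1 h3 h2 q K0; rewrite ler_norml => /andP[h1 _].
  move: h1 (fnorm_ge0 m (e r)) (fnorm_ge0 m (e1 r)).
  move: (fnorm m (e r)) (fnorm m (e1 r)) (Re (k r (e r) (e r))) (Re (k1 _ _ _)) => a a1 kk kk1.
  move: (Re (m (e1 r) (e2 r))) (Re (k r (e1 r) (e r))) (Re (m (e r) (e1 r))) => x y z.
  move: S0; move: (kap0 * _) (Re (res _ _)) => S rr S0 h1 a0 a10 h3 h2 q K0.
  have s1 := sqr_ge0 (rho - a1); have s2 := sqr_ge0 (a - a1).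
  have p1 : 0 <= M / c0 * (a1 ^+ 2 + a ^+ 2) by rewrite mulr_ge0// addr_ge0 ?sqr_ge0.
  have s3 := sqr_ge0 a; have s4 := sqr_ge0 a1.
  have {}s1 : 2 * (rho * a1) <= rho ^+ 2 + a1 ^+ 2 by move: s1; rewrite !expr2; lra.
  have {}s2 : 2 * (a * a1) <= a ^+ 2 + a1 ^+ 2 by move: s2; rewrite !expr2; lra.
  have -> : (3 + M / c0) * (a1 ^+ 2 + kk + a ^+ 2) = 3 * a1 ^+ 2 + 3 * kk + 3 * a ^+ 2 +
      (M / c0 * kk + M / c0 * (a1 ^+ 2 + a ^+ 2)) by ring.
  move: s1 s2 s3 s4 p1 S0 h1 h2 h3 q K0.
  by lra.
have E0 : E 0 = 0.
  by rewrite /E e10 e0 !(hform0r hm.1) (hform0r (hk 0)) !addr0.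
have := gronwall t0 (_ : 0 <= 3 + M / c0) (sqr_ge0 rho) dE hE' E0.
rewrite addr_ge0 ?divr_ge0 ?(ltW hc0)// => /(_ isT).
rewrite mulrA; apply: le_trans; rewrite /E -!(fnorm_sqr hm) lerD2r lerD2l.
by rewrite (fnorm_sqr hg).
Qed.

End Energy.

(** * Coupled harmonics *)

Section HarmonicEstimates.
Context {R : realType} (T : R) (hT : 0 < T) (V : lmodType R[i]).
Local Notation C := R[i].
Local Notation Om := (frequency T).
Context (m g s : V -> V -> C) (k k1 k2 k3 : R -> V -> V -> C).
Context (kap0 M c0 Cinv c : R).
Context (hm : positive_form m) (hg : positive_form g) (hs : positive_form s).
Context (hk : forall t, hermitian_form (k t)).
Context (hk1 : forall t, hermitian_form (k1 t)).
Context (hc0 : 0 < c0).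
Context (hcoer : forall t v, c0 * Re (g v v) <= Re (k t v v)).
Context (dk : forall v w, cderivable (fun t => k t v w) (fun t => k1 t v w)).
Context (dk1 : forall v w, cderivable (fun t => k1 t v w) (fun t => k2 t v w)).
Context (dk2 : forall v w, cderivable (fun t => k2 t v w) (fun t => k3 t v w)).
Context (ck3 : forall v w, ccontinuous (fun t => k3 t v w)).
Context (pk : forall v w t, k (t + T) v w = k t v w).
Context (pk1 : forall v w t, k1 (t + T) v w = k1 t v w).
Context (pk2 : forall v w t, k2 (t + T) v w = k2 t v w).
Context (hM : 0 <= M).
Context (bk : forall t v w, `|k t v w| <= (M * (fnorm g v * fnorm g w))%:C).
Context (bk1 : forall t v w, `|k1 t v w| <= (M * (fnorm g v * fnorm g w))%:C).
Context (bk3 : forall t v w, `|k3 t v w| <= (M * (fnorm g v * fnorm g w))%:C).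
Context (hinv : forall v, fnorm g v <= Cinv * fnorm m v).
Context (hkap0 : 0 <= kap0) (hc : 0 < c) (hcC : c <= Cinv).

Definition form_coef (v w : V) (n : int) : C := coef T (fun t => k t v w) n.

Let Om0 : 0 < Om := frequency_gt0 hT.
Let ck v w : ccontinuous (fun t => k t v w) := cderivable_continuous (dk v w).

Let M' := M * (1 + 4 / Om ^+ 3).

Lemma coef_decay_ge0 : 0 <= M'.
Proof. by rewrite /M' mulr_ge0// addr_ge0// divr_ge0// exprn_ge0// ltW. Qed.

(** In [M'], the 1 serves [n = 0]. For other [n] the cubic decay is weakened by (1 + |n|)^2 <= 4
    |n|^3 to the summable [weight n]. *)
Lemma norm_form_coef v w n :
  `|form_coef v w n| <= (M' * weight n * (fnorm g v * fnorm g w))%:C.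
Proof.
have F0 : 0 <= fnorm g v * fnorm g w by rewrite mulr_ge0// fnorm_ge0.
have [->|n0] := eqVneq n 0.
  apply: le_trans (norm_coef_le hT 0 (ck v w) (fun t _ => bk t v w)) _.
  rewrite lecR ler_wpM2r// /weight normr0 addr0 expr1n invr1 mulr1 /M'.
  by rewrite ler_peMr// lerDl divr_ge0// exprn_ge0// ltW.
have h := norm_coef_C3 hT n (dk v w) (dk1 v w) (dk2 v w) (ck3 v w)
  (periodic_T0 (pk v w)) (periodic_T0 (pk1 v w)) (periodic_T0 (pk2 v w))
  (fun t _ => bk3 t v w).
move: h; rewrite /form_coef normc_def -rmorphM !lecR.
move: (Num.sqrt _) => x.
have n1 : 1 <= `|n|%:~R :> R.
  by rewrite ler1z -gtz0_ge1 normr_gt0.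
rewrite /weight /M' -intr_norm; move: (`|n|%:~R) n1 => y y1 h.
have O3 : 0 < Om ^+ 3 by rewrite exprn_gt0.
have y3 : 0 < y ^+ 3 by rewrite exprn_gt0//; lra.
move: h; rewrite exprMn -ler_pdivlMr ?(mulr_gt0 y3 O3)// => h.
apply: (le_trans h); move: O3 y3; move: (Om ^+ 3) => o O3 y3.
have q : (y ^+ 3 * o)^-1 <= (1 + 4 / o) * ((1 + y) ^+ 2)^-1.
  have yy : 0 < (1 + y) ^+ 2 by rewrite exprn_gt0//; lra.
  apply: le_trans (_ : 4 / o * ((1 + y) ^+ 2)^-1 <= _); last first.
    by rewrite ler_wpM2r ?invr_ge0 ?(ltW yy)// lerDr.
  rewrite invfM [leLHS]mulrC [4 / o]mulrC -mulrA ler_wpM2l ?invr_ge0 ?(ltW O3)//.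
  by rewrite ler_pdivlMr// mulrC ler_pdivrMr//; nra.
rewrite [leRHS](_ : _ =
  M * (fnorm g v * fnorm g w) * ((1 + 4 / o) * ((1 + y) ^+ 2)^-1)); last by ring.
by rewrite ler_wpM2l// mulr_ge0.
Qed.

Context (K : nat) (hK : (0 < K)%N) (om : C) (u : 'I_(K.*2.+1) -> V).
Context (hom : `|Re om| <= Om / 2).
Context (hu1 : \sum_n fnorm m (u n) ^+ 2 = 1).

Definition exponent (n : 'I_(K.*2.+1)) : C :=
  - iunit * (om + ((harm n)%:~R * Om)%:C).
Local Notation lam := exponent.

Context (heq : forall n v, lam n ^+ 2 * m v (u n) +
  \sum_(j < K.*2.+1) form_coef v (u j) (n%:Z - j%:Z) + kap0%:C * lam n * s v (u n) = 0).

Let mu (n : 'I_(K.*2.+1)) : R := Re om + (harm n)%:~R * Om.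
Let sigma : R := Im om.

Lemma exponentE n : lam n = sigma +i* (- mu n).
Proof.
by apply: complex_eqP; rewrite /exponent !(Re_mul, Im_mul, Re_opp, Im_opp, Re_add, Im_add)/= /sigma /mu; ring.
Qed.

Lemma fnorm_mode_le1 n : fnorm m (u n) <= 1.
Proof.
rewrite -(ler_pXn2r (_ : (0 < 2)%N)) ?nnegrE ?fnorm_ge0// expr1n -hu1.
by rewrite (bigD1 n)//= lerDl sumr_ge0// => i _; rewrite sqr_ge0.
Qed.

Let Cinv0 : 0 < Cinv := lt_le_trans hc hcC.

(* Multiplying the [n]-th equation, tested with [u n], by the conjugate of
   [lam n] makes the boundary term real, so it drops out of the imaginary part. *)
Lemma frequency_sqr_le n :
  mu n ^+ 2 * fnorm m (u n) <= 4 * M' * Cinv ^+ 2.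
Proof.
pose q := \sum_(j < K.*2.+1) form_coef (u n) (u j) (n%:Z - j%:Z).
have nq : `|q| <= (4 * M' * Cinv ^+ 2 * fnorm m (u n))%:C.
  apply: le_trans (ler_norm_sum _ _ _) _.
  apply: le_trans (_ : \sum_(j < K.*2.+1)
      (weight (j%:Z - n%:Z) * (M' * Cinv ^+ 2 * fnorm m (u n)))%:C <= _).
    apply: ler_sum => j _; apply: le_trans (norm_form_coef _ _ _) _; rewrite lecR.
    have -> : weight (n%:Z - j%:Z) = weight (j%:Z - n%:Z) :> R.
      by rewrite /weight -opprB normrN.
    rewrite -[in leRHS]mulrA [M' * weight _]mulrC -mulrA.
    apply: ler_wpM2l; first exact: ltW (weight_gt0 _).
    apply: ler_wpM2l; first exact: coef_decay_ge0.
    apply: le_trans (ler_pM (fnorm_ge0 _ _) (fnorm_ge0 _ _) (hinv _) (hinv _)) _.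
    have := fnorm_mode_le1 j; have := fnorm_ge0 m (u j).
    move: (fnorm m (u j)) (fnorm m (u n)) (fnorm_ge0 m (u n)) => b a a0 b0 b1.
    rewrite (_ : Cinv * a * (Cinv * b) = Cinv ^+ 2 * a * b); last by ring.
    by rewrite ler_piMr// mulr_ge0// exprn_ge0// ltW.
  rewrite -rmorph_sum lecR -mulr_suml.
  rewrite (_ : 4 * M' * _ * _ = 4 * (M' * Cinv ^+ 2 * fnorm m (u n))); last by ring.
  apply: ler_wpM2r; last exact: sum_weight.
  exact: mulr_ge0 (mulr_ge0 coef_decay_ge0 (sqr_ge0 _)) (fnorm_ge0 _ _).
have [->|mu0] := eqVneq (mu n) 0.
  by rewrite expr0n mul0r (mulr_ge0 (mulr_ge0 _ coef_decay_ge0) (sqr_ge0 _)).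
pose a := fnorm m (u n) ^+ 2.
have main : mu n ^+ 2 * a <= 4 * M' * Cinv ^+ 2 * fnorm m (u n).
  move: nq; set N := 4 * _ * _ * _ => nq.
  have N0 : 0 <= N by rewrite -lecR; apply: le_trans nq; exact: normr_ge0.
  have := heq n (u n); rewrite -/q (form_diag hm) -/a (form_diag hs) exponentE.
  move: nq; rewrite norm_le_sqr//; move: (fnorm s _ ^+ 2) => b.
  case: q => x y /= nq E.
  have E1 := congr1 (@complex.Re R) E; have E2 := congr1 (@complex.Im R) E.
  rewrite !expr2 !(Re_add, Im_add, Re_mul, Im_mul)/= in E1 E2.
  have h1 : (sigma ^+ 2 + mu n ^+ 2) * mu n * a = sigma * y + mu n * x.
    have e1 : x = - ((sigma * sigma - mu n * mu n) * a + kap0 * sigma * b) by lra.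
    have e2 : y = - ((- 2 * sigma * mu n) * a - kap0 * mu n * b) by lra.
    by rewrite e1 e2; ring.
  (* Cauchy-Schwarz in the plane. One factor |lam|^2 then cancels and the other is bounded below by
     mu^2, so no bound on [sigma] is called for. *)
  have : ((sigma ^+ 2 + mu n ^+ 2) * mu n * a) ^+ 2 <=
         (sigma ^+ 2 + mu n ^+ 2) * (x ^+ 2 + y ^+ 2).
    rewrite h1 -subr_ge0.
    rewrite (_ : _ - _ = (sigma * x - mu n * y) ^+ 2); last by ring.
    exact: sqr_ge0.
  have S0 : 0 < sigma ^+ 2 + mu n ^+ 2.
    by rewrite ltr_wpDl ?sqr_ge0// exprn_even_gt0.
  move=> h2.
  have h3 : (sigma ^+ 2 + mu n ^+ 2) * (mu n * a) ^+ 2 <= N ^+ 2.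
    rewrite -(ler_pM2l S0); apply: (le_trans _ (ler_wpM2l (ltW S0) nq)).
    rewrite [leLHS](_ : _ = ((sigma ^+ 2 + mu n ^+ 2) * mu n * a) ^+ 2)//; ring.
  have a0 : 0 <= a by exact: sqr_ge0.
  rewrite -(ler_pXn2r (_ : (0 < 2)%N)) ?nnegrE ?(mulr_ge0 (sqr_ge0 _) a0)//.
  apply: (le_trans _ h3).
  rewrite [leLHS](_ : _ = mu n ^+ 2 * (mu n * a) ^+ 2); last by ring.
  by rewrite ler_wpM2r ?sqr_ge0// lerDr sqr_ge0.
have := fnorm_ge0 m (u n); rewrite le_eqVlt => /predU1P[<-|f0].
  by rewrite mulr0 (mulr_ge0 (mulr_ge0 _ coef_decay_ge0) (sqr_ge0 _)).
by move: main; rewrite /a expr2 mulrA ler_pM2r.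
Qed.

(** First term: for a harmonic n other than 0, |Re om| <= Omega / 2 gives |mu| >= |n| Omega / 2, so
    (1 + |n|) Omega <= 4 |mu|, and the constant 4 of [frequency_sqr_le] is multiplied by 16. Second
    term: for the harmonic 0, 1 <= Cinv^2 / c^2. *)
Definition decay_const : R := 64 * M' / Om ^+ 2 + (c ^+ 2)^-1.

Let decay0 : 0 <= 64 * M' / Om ^+ 2.
Proof.
by apply: divr_ge0; [exact: mulr_ge0 _ coef_decay_ge0|exact: sqr_ge0].
Qed.

Lemma decay_const_ge0 : 0 <= decay_const.
Proof. by rewrite addr_ge0// invr_ge0 sqr_ge0. Qed.

Lemma fnorm_mode_decay n :
  fnorm m (u n) <= decay_const * Cinv ^+ 2 * weight (harm n).
Proof.
have [h0|h0] := eqVneq (harm n) 0.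
  rewrite h0 /weight normr0 addr0 expr1n invr1 mulr1.
  apply: (le_trans (fnorm_mode_le1 n)).
  apply: le_trans (_ : (c ^+ 2)^-1 * Cinv ^+ 2 <= _).
    by rewrite mulrC ler_pdivlMr ?exprn_gt0// mul1r ler_sqr ?nnegrE// ltW.
  by rewrite ler_wpM2r ?sqr_ge0// /decay_const lerDr.
have h1 : 1 <= `|(harm n)|%:~R :> R by rewrite ler1z -gtz0_ge1 normr_gt0.
have mu_ge : `|harm n|%:~R * Om / 2 <= `|mu n|.
  have : `|(harm n)%:~R * Om| <= `|mu n| + `|Re om|.
    rewrite -[`|Re om|]normrN; apply: le_trans (ler_normD _ _).
    by rewrite /mu addrAC subrr add0r.
  rewrite normrM (gtr0_norm Om0) -intr_norm => h2.
  have h3 : Om <= `|harm n|%:~R * Om by rewrite ler_peMl// ltW.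
  by move: h2 hom h3; lra.
have w0 : 0 < (1 + `|harm n|%:~R) ^+ 2 :> R by rewrite exprn_gt0//; lra.
rewrite /weight ler_pdivlMr//.
apply: le_trans (_ : 64 * M' / Om ^+ 2 * Cinv ^+ 2 <= _); last first.
  by rewrite ler_wpM2r ?sqr_ge0// /decay_const lerDl invr_ge0 sqr_ge0.
have := frequency_sqr_le n; rewrite -real_normK ?num_real//.
move: (fnorm m (u n)) (fnorm_ge0 m (u n)) => a a0.
have -> : 64 * M' / Om ^+ 2 * Cinv ^+ 2 = 16 * (4 * M' * Cinv ^+ 2) / Om ^+ 2 by ring.
rewrite ler_pdivlMr ?exprn_gt0// => h2.
have h3 : (1 + `|harm n|%:~R) ^+ 2 * Om ^+ 2 <= 16 * `|mu n| ^+ 2.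
  rewrite (_ : 16 * _ = (4 * `|mu n|) ^+ 2); last by ring.
  have y0 : 0 <= 1 + `|harm n|%:~R :> R by lra.
  rewrite -exprMn ler_sqr ?nnegrE ?(mulr_ge0 y0 (ltW Om0)) ?(mulr_ge0 _ (normr_ge0 _))//.
  have h4 : Om <= `|harm n|%:~R * Om by rewrite ler_peMl// ltW.
  by move: mu_ge h4; lra.
apply: le_trans (_ : 16 * (`|mu n| ^+ 2 * a) <= _); last by rewrite ler_wpM2l.
by rewrite -[leLHS]mulrA mulrC [leRHS]mulrA ler_wpM2r.
Qed.

Lemma form_coef_conj v w n : (form_coef v w n)^* = form_coef w v (- n).
Proof.
rewrite /form_coef /coef -mean_conj; last first.
  by apply: ccontinuousM => //; exact: ccontinuous_mode.
by apply: eq_mean => t _; rewrite rmorphM/= mode_conj -(hk t).2.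
Qed.

(* The frequencies are not shifted by [K]: only their differences matter below. *)
Let W t := \sum_(n < K.*2.+1) mode T (- n%:Z) t *: u n.
Let Q (n j : 'I_(K.*2.+1)) := form_coef (u n) (u j) (n%:Z - j%:Z).

Lemma form_harmonic_sum (b : V -> V -> C) t : hermitian_form b ->
  b (W t) (W t) = \sum_(n < K.*2.+1) \sum_(j < K.*2.+1) b (u n) (u j) * mode T (n%:Z - j%:Z) t.
Proof.
move=> hb; rewrite /W hform_suml//; apply: eq_bigr => n _.
rewrite hform_sumr//; apply: eq_bigr => j _.
by rewrite hformZl// hformZr// mode_conj opprK modeD; ring.
Qed.

(** A Parseval identity for time-dependent forms: it turns the coupling sums of the frequency domain
    into time averages, where coercivity and the bound on the derivative can be used pointwise. *)
Lemma mean_harmonic_sum (b : R -> V -> V -> C) :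
  (forall t, hermitian_form (b t)) -> (forall v w, ccontinuous (fun t => b t v w)) ->
  mean T (fun t => b t (W t) (W t)) =
  \sum_(n < K.*2.+1) \sum_(j < K.*2.+1) coef T (fun t => b t (u n) (u j)) (n%:Z - j%:Z).
Proof.
move=> hb cb.
rewrite (eq_mean (fun t _ => form_harmonic_sum t (hb t))).
have cbm (n j : 'I_(K.*2.+1)) : ccontinuous (fun t => b t (u n) (u j) * mode T (n%:Z - j%:Z) t).
  by apply: ccontinuousM => //; exact: ccontinuous_mode.
rewrite mean_sum// => [|n]; last exact: ccontinuous_sum.
by apply: eq_bigr => n _; rewrite mean_sum.
Qed.

Let cW (b : R -> V -> V -> C) : (forall t, hermitian_form (b t)) ->
  (forall v w, ccontinuous (fun t => b t v w)) -> ccontinuous (fun t => b t (W t) (W t)).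
Proof.
move=> hb cb; rewrite (funext (fun t => form_harmonic_sum t (hb t))).
do 2! (apply: ccontinuous_sum => ?).
by apply: ccontinuousM => //; exact: ccontinuous_mode.
Qed.

Lemma mean_form_derivative_le :
  `|mean T (fun t => k1 t (W t) (W t))| <=
  (M / c0)%:C * mean T (fun t => k t (W t) (W t)).
Proof.
have ck1 v w := cderivable_continuous (dk1 v w).
rewrite -meanZ; last exact: cW.
apply: le_norm_mean => //; first exact: cW.
  by apply: ccontinuousM; [exact: ccontinuous_cst|exact: cW].
move=> t _; apply: le_trans (bk1 _ _ _) _.
rewrite (hform_diag_real (hk t)) -rmorphM lecR -expr2 (fnorm_sqr hg).
by rewrite -mulrA ler_wpM2l// ler_pdivlMl.
Qed.

(* Integrating by parts in time, twice the real part of the coupling sum [P] is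
   [2 sigma A - D], where [A] and [D] are the means of [k_t (W t) (W t)] and
   [k1_t (W t) (W t)] and [`|D| <= M / c0 * A]; if [sigma] were larger than
   [M / (2 c0)], all terms of [balance] would be nonnegative and one positive. *)
Lemma growth_rate_le : Im om <= M / (2 * c0).
Proof.
rewrite leNgt -/sigma; apply/negP => sM.
have s0 : 0 < sigma by apply: le_lt_trans sM; rewrite divr_ge0// mulr_ge0// ltW.
pose A := \sum_(n < K.*2.+1) \sum_(j < K.*2.+1) Q n j.
pose D := \sum_(n < K.*2.+1) \sum_(j < K.*2.+1) - (iunit * ((n%:Z - j%:Z)%:~R * Om)%:C) * Q n j.
pose P := \sum_(n < K.*2.+1) (lam n)^* * \sum_(j < K.*2.+1) Q n j.
have hA : mean T (fun t => k t (W t) (W t)) = A by rewrite mean_harmonic_sum.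
have hD : mean T (fun t => k1 t (W t) (W t)) = D.
  rewrite mean_harmonic_sum// => [|v w]; last exact: cderivable_continuous (dk1 v w).
  apply: eq_bigr => n _; apply: eq_bigr => j _.
  rewrite (coef_derivative hT _ (dk (u n) (u j)))//.
    exact: cderivable_continuous (dk1 (u n) (u j)).
  exact: periodic_T0 (pk (u n) (u j)).
have DA := mean_form_derivative_le; rewrite hA hD in DA.
(* Conjugation exchanges [n] and [j], and conj lam_n + lam_j = 2 sigma + i (n - j) Omega; the second
   term is minus the factor by which differentiation in time multiplies the coefficient of index n -
   j. *)
have PP : P + P^* = (2 * sigma)%:C * A - D.
  have -> : P^* = \sum_(n < K.*2.+1) \sum_(j < K.*2.+1) lam j * Q n j.
    rewrite exchange_big/= rmorph_sum/=; apply: eq_bigr => n _.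
    rewrite rmorphM rmorph_sum/= conjCK mulr_sumr; apply: eq_bigr => j _.
    by rewrite /Q form_coef_conj opprB.
  rewrite /A /D mulr_sumr -sumrB -big_split/=; apply: eq_bigr => n _.
  rewrite !mulr_sumr -sumrB -big_split/=; apply: eq_bigr => j _.
  rewrite -mulrDl mulNr opprK -mulrDl; congr (_ * _).
  rewrite !exponentE /mu /harm !intrD !intrN; apply: complex_eqP;
    by rewrite !(Re_add, Im_add, Re_mul, Im_mul, Re_conjc, Im_conjc)/=; ring.
have AR : A = (Re A)%:C.
  apply: complex_eqP => //=; have : A^* = A.
    rewrite /A [RHS]exchange_big/= rmorph_sum/=; apply: eq_bigr => n _.
    by rewrite rmorph_sum/=; apply: eq_bigr => j _; rewrite /Q form_coef_conj opprB.
  move=> /(congr1 (@complex.Im R)); rewrite Im_conjc => /eqP.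
  by rewrite -subr_eq0 -opprD oppr_eq0 -mulr2n mulrn_eq0/= => /eqP.
have hP : Re P >= (sigma - M / (2 * c0)) * Re A.
  have := congr1 (@complex.Re R) PP; rewrite AR in DA *.
  rewrite !(Re_add, Re_opp, Re_mul, Re_conjc)/= mul0r subr0.
  have := Re_le_norm (_ : `|D| <= (M / c0 * Re A)%:C); rewrite rmorphM/= => /(_ DA).
  have -> : M / (2 * c0) = M / c0 / 2 by field; rewrite gt_eqF.
  by lra.
have A0 : 0 <= Re A.
  rewrite -ler0c -AR -hA; apply: le_trans (normr_ge0 (mean T (fun=> 0))) _.
  apply: le_norm_mean => //; [exact: ccontinuous_cst|exact: cW|].
  move=> t _; rewrite normr0 (hform_diag_real (hk t)) ler0c.
  by apply: le_trans (hcoer _ _); rewrite mulr_ge0 ?(ltW hc0)// (Re_form_ge0 hg).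
pose L n := sigma ^+ 2 + mu n ^+ 2.
pose B := \sum_(n < K.*2.+1) L n * fnorm m (u n) ^+ 2.
have B1 : sigma ^+ 2 <= B.
  rewrite -[leLHS]mulr1 -hu1 mulr_sumr; apply: ler_sum => n _.
  by rewrite ler_wpM2r ?sqr_ge0// lerDl sqr_ge0.
(* The equations tested with [u n] are weighted by conj lam_n and summed; in the real part the
   boundary terms are nonnegative and are dropped. *)
have balance : sigma * B + Re P <= 0.
  have E : \sum_(n < K.*2.+1) (lam n)^* * (lam n ^+ 2 * m (u n) (u n) +
      \sum_(j < K.*2.+1) Q n j + kap0%:C * lam n * s (u n) (u n)) = 0.
    by rewrite big1// => n _; rewrite heq mulr0.
  have := congr1 (@complex.Re R) E; rewrite Re_sum/=.
  rewrite (eq_bigr (fun n => sigma * (L n * fnorm m (u n) ^+ 2) +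
    Re ((lam n)^* * \sum_(j < K.*2.+1) Q n j) + kap0 * L n * fnorm s (u n) ^+ 2)); last first.
    move=> n _; rewrite (form_diag hm) (form_diag hs).
    rewrite !mulrDr !Re_add; congr (_ + _ + _); rewrite exponentE ?expr2 /L;
      by rewrite !(Re_mul, Im_mul, Re_conjc, Im_conjc)/=; ring.
  rewrite !big_split/= -mulr_sumr -Re_sum -/P -/B => Z.
  have S0 : 0 <= \sum_(n < K.*2.+1) kap0 * L n * fnorm s (u n) ^+ 2.
    apply: sumr_ge0 => n _; apply: mulr_ge0 (sqr_ge0 _); apply: mulr_ge0 => //.
    by rewrite addr_ge0 ?sqr_ge0.
  by move: Z S0; lra.
have : 0 < sigma * B by rewrite mulr_gt0// (lt_le_trans _ B1)// exprn_gt0.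
have : 0 <= (sigma - M / (2 * c0)) * Re A by rewrite mulr_ge0// subr_ge0 ltW.
by move: balance hP; lra.
Qed.

(** The defect of [mode_curve] in the semi-discrete equation tested with [v], as
    [residual_mode_curve] shows. *)
Definition residual (t : R) (v : V) : C := \sum_(n < K.*2.+1)
  cexp (lam n * t%:C) *
  (lam n ^+ 2 * m v (u n) + k t v (u n) + kap0%:C * lam n * s v (u n)).

Lemma cexp_exponent_shift (n j : 'I_(K.*2.+1)) t :
  cexp (lam j * t%:C) = cexp (lam n * t%:C) * mode T (n%:Z - j%:Z) t.
Proof.
rewrite /mode -cexpD; congr cexp; rewrite -mulrDl; congr (_ * _).
rewrite /exponent /harm.
have -> : (j%:Z - K%:Z)%:~R * Om = (n%:Z - K%:Z)%:~R * Om - (n%:Z - j%:Z)%:~R * Om.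
  by rewrite !intrD !intrN; ring.
by rewrite rmorphB/=; ring.
Qed.

(** The harmonic equations replace mass and boundary terms by coupling sums. Exchanging the
    summations collects all coefficients of one [u n], and the quotient of two exponentials is the
    mode missing in its Fourier series. *)
Lemma residualE t v : residual t v = \sum_(n < K.*2.+1)
  cexp (lam n * t%:C) * (k t v (u n) -
    \sum_(j < K.*2.+1) form_coef v (u n) (j%:Z - n%:Z) * mode T (n%:Z - j%:Z) t).
Proof.
transitivity (\sum_(n < K.*2.+1) cexp (lam n * t%:C) * k t v (u n) -
    \sum_(n < K.*2.+1) \sum_(j < K.*2.+1)
      cexp (lam n * t%:C) * form_coef v (u j) (n%:Z - j%:Z)).
  rewrite /residual -sumrB; apply: eq_bigr => n _.
  rewrite -mulr_sumr -mulrBr; congr (_ * _).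
  have := heq n v; set q := \sum_(j < _) _ => /eqP.
  rewrite addrAC addr_eq0 => /eqP h.
  by rewrite addrAC h addrC.
rewrite exchange_big/= -sumrB; apply: eq_bigr => n _.
rewrite mulrBr; congr (_ - _); rewrite mulr_sumr; apply: eq_bigr => j _.
by rewrite (cexp_exponent_shift n j); ring.
Qed.

(** If a + b >= K then K^2 <= 2 (a^2 + b^2), so a^-2 b^-2 <= 2 K^-2 (a^-2 + b^-2). The distances of
    the index from [K] and from either end 0 or [2K], each increased by 1, satisfy this; four sums
    bounded by 4 give 2 * 16 = 32. *)
Lemma sum_weight_product : \sum_(n < K.*2.+1) weight (harm n) *
    (1 / (K.*2 - n).+1%:R ^+ 2 + 1 / n.+1%:R ^+ 2) <= 32 / K%:R ^+ 2 :> R.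
Proof.
have K0 : (0 : R) < K%:R by rewrite ltr0n.
have prod_le (a b : R) : 0 < a -> 0 < b -> K%:R <= a + b ->
    (a ^+ 2)^-1 * (b ^+ 2)^-1 <= 2 / K%:R ^+ 2 * ((a ^+ 2)^-1 + (b ^+ 2)^-1).
  move=> a0 b0 ab.
  have K2 : 0 < K%:R ^+ 2 :> R by rewrite exprn_gt0.
  have a2 : 0 < a ^+ 2 by rewrite exprn_gt0.
  have b2 : 0 < b ^+ 2 by rewrite exprn_gt0.
  have -> : 2 / K%:R ^+ 2 * ((a ^+ 2)^-1 + (b ^+ 2)^-1) =
      2 * (a ^+ 2 + b ^+ 2) / K%:R ^+ 2 * ((a ^+ 2)^-1 * (b ^+ 2)^-1).
    by field; rewrite !gt_eqF.
  rewrite ler_peMl ?mulr_ge0 ?invr_ge0 ?(ltW a2) ?(ltW b2)//.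
  rewrite ler_pdivlMr// mul1r.
  have : K%:R ^+ 2 <= (a + b) ^+ 2 by rewrite ler_sqr ?nnegrE ?addr_ge0// ltW.
  by have := sqr_ge0 (a - b); rewrite !expr2; lra.
apply: le_trans (_ : \sum_(n < K.*2.+1) 2 / K%:R ^+ 2 *
   ((weight (n%:Z - K%:Z) + weight (n%:Z - K.*2%:Z)) +
    (weight (n%:Z - K%:Z) + weight (n%:Z - 0%:Z))) <= _); last first.
  rewrite -mulr_sumr !big_split/=.
  have h p := @sum_weight R K.*2.+1 p.
  rewrite (_ : 32 / K%:R ^+ 2 = 2 / K%:R ^+ 2 * (4 + 4 + (4 + 4))); last by ring.
  by rewrite ler_wpM2l ?divr_ge0 ?exprn_ge0// !lerD.
apply: ler_sum => n _; have nK : (n <= K.*2)%N by rewrite -ltnS.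
have wE : weight (n%:Z - K%:Z) = ((1 + `|n%:R - K%:R|) ^+ 2)^-1 :> R.
  by rewrite /weight intr_norm intrD intrN.
have w1 : weight (n%:Z - K.*2%:Z) = ((K.*2 - n).+1%:R ^+ 2)^-1 :> R.
  rewrite /weight distrC subzn// ger0_norm// -[(K.*2 - n).+1]add1n natrD.
  by rewrite -[_%:Z%:~R]/(_%:R).
have w2 : weight (n%:Z - 0%:Z) = (n.+1%:R ^+ 2)^-1 :> R.
  by rewrite /weight subr0 ger0_norm// -[n.+1]add1n natrD.
rewrite w1 w2 /harm wE mulrDr !div1r mulrDr.
have a0 : 0 < 1 + `|n%:R - K%:R| :> R by rewrite ltr_wpDr.
apply: lerD; apply: prod_le; rewrite ?ltr0n//.
  have d2 : K.*2%:R = 2 * K%:R :> R by rewrite -mul2n natrM.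
  by have := ler_norm (n%:R - K%:R : R); rewrite -natr1 natrB// d2; lra.
by have := ler_norm (- (n%:R - K%:R) : R); rewrite normrN -natr1; lra.
Qed.

Definition residual_const : R := 64 * M / Om ^+ 3 * decay_const.

(** Two powers of [Cinv] come from the gradients of [v] and [u n] in the truncation bound, two from
    the decay of [u n]. The 64 in [residual_const] is the 2 of [fourier_truncation] times the 32 of
    [sum_weight_product]. *)
Lemma norm_residual_le t v : `|residual t v| <=
  (expR (Im om * t) * (residual_const * (Cinv ^+ 4 / K%:R ^+ 2)) * fnorm m v)%:C.
Proof.
rewrite residualE; apply: le_trans (ler_norm_sum _ _ _) _.
have O3 : 0 < Om ^+ 3 by rewrite exprn_gt0.
pose X := expR (Im om * t) * (2 * M / Om ^+ 3 * (Cinv ^+ 4 * decay_const) * fnorm m v).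
have P0 : 0 <= 2 * M / Om ^+ 3.
  by apply: divr_ge0 (ltW O3); exact: mulr_ge0.
have X0 : 0 <= X.
  apply: mulr_ge0 (expR_ge0 _) _; apply: mulr_ge0 (fnorm_ge0 _ _).
  by apply: mulr_ge0 => //; apply: mulr_ge0 (exprn_ge0 _ (ltW Cinv0)) decay_const_ge0.
apply: le_trans (_ : \sum_(n < K.*2.+1) (X * (weight (harm n) *
    (1 / (K.*2 - n).+1%:R ^+ 2 + 1 / n.+1%:R ^+ 2)))%:C <= _); last first.
  rewrite -rmorph_sum lecR -mulr_sumr.
  apply: le_trans (ler_wpM2l X0 sum_weight_product) _.
  rewrite le_eqVlt; apply/orP; left; apply/eqP; rewrite /X /residual_const; ring.
apply: ler_sum => n _; rewrite normrM normr_cexp.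
have -> : Re (lam n * t%:C) = Im om * t.
  by rewrite exponentE Re_mul/= mulr0 subr0.
have nK : (n <= K.*2)%N by rewrite -ltnS.
set S := 1 / _ + 1 / _.
have S0 : 0 <= S by rewrite addr_ge0// divr_ge0// exprn_ge0.
have h := fourier_truncation hT t nK (dk v (u n)) (dk1 v (u n)) (dk2 v (u n))
  (ck3 v (u n)) (pk v (u n)) (pk1 v (u n)) (pk2 v (u n))
  (fun t => bk1 t v (u n)) (fun t _ => bk3 t v (u n)).
rewrite /X -mulrA rmorphM; apply: ler_wpM2l; first by rewrite ler0c expR_ge0.
apply: (le_trans h); rewrite lecR -/S [leRHS]mulrA; apply: ler_wpM2r => //.
rewrite (_ : 2 * (M * (fnorm g v * fnorm g (u n))) / Om ^+ 3 =
  2 * M / Om ^+ 3 * (fnorm g v * fnorm g (u n))); last by ring.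
rewrite -2![leRHS]mulrA; apply: ler_wpM2l => //.
apply: le_trans (ler_pM (fnorm_ge0 _ _) (fnorm_ge0 _ _) (hinv _) (hinv _)) _.
rewrite (_ : Cinv * fnorm m v * (Cinv * fnorm m (u n)) =
  Cinv ^+ 2 * fnorm m v * fnorm m (u n)); last by ring.
apply: le_trans (_ : Cinv ^+ 2 * fnorm m v * (decay_const * Cinv ^+ 2 * weight (harm n)) <= _).
  apply: ler_wpM2l (fnorm_mode_decay _).
  exact: mulr_ge0 (sqr_ge0 _) (fnorm_ge0 _ _).
by rewrite le_eqVlt; apply/orP; left; apply/eqP; ring.
Qed.

Definition mode_curve (t : R) : V := \sum_n cexp (lam n * t%:C) *: u n.
Definition mode_curve1 (t : R) : V := \sum_n (lam n * cexp (lam n * t%:C)) *: u n.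
Let mode_curve2 (t : R) : V := \sum_n (lam n ^+ 2 * cexp (lam n * t%:C)) *: u n.

Lemma mode_curve_derivative t : curve_derivative m mode_curve t (mode_curve1 t).
Proof. exact: curve_derivative_exp. Qed.

Lemma mode_curve1_derivative t : curve_derivative m mode_curve1 t (mode_curve2 t).
Proof.
have -> : mode_curve1 = fun t => \sum_n cexp (lam n * t%:C) *: (lam n *: u n).
  by apply/funext => r; apply: eq_bigr => n _; rewrite scalerA mulrC.
have -> : mode_curve2 t = \sum_n (lam n * cexp (lam n * t%:C)) *: (lam n *: u n).
  by apply: eq_bigr => n _; rewrite scalerA; congr (_ *: _); rewrite expr2; ring.
exact: curve_derivative_exp.
Qed.

Lemma residual_mode_curve t v : residual t v =
  m v (mode_curve2 t) + k t v (mode_curve t) + kap0%:C * s v (mode_curve1 t).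
Proof.
rewrite /mode_curve /mode_curve1 /mode_curve2.
rewrite !(hform_sumr hm.1, hform_sumr (hk t), hform_sumr hs.1).
rewrite mulr_sumr -!big_split/=; apply: eq_bigr => n _.
by rewrite !(hformZr hm.1, hformZr (hk t), hformZr hs.1); ring.
Qed.

(** Free of [K] and [Cinv]. The first factor bounds the growth of the mode on [0, t]; the square
    root comes from the Gronwall bound on the squared norms. *)
Definition evolution_const (t : R) : R :=
  expR (M / (2 * c0) * t) * residual_const * Num.sqrt (t * expR ((3 + M / c0) * t)).

Lemma evolution_estimate (w w1 w2 : R -> V) t : 0 <= t ->
  (forall r, 0 <= r -> curve_derivative m w r (w1 r)) ->
  (forall r, 0 <= r -> curve_derivative m w1 r (w2 r)) ->
  (forall r v, 0 <= r -> m v (w2 r) + k r v (w r) + kap0%:C * s v (w1 r) = 0) ->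
  w 0 = mode_curve 0 -> w1 0 = mode_curve1 0 ->
  fnorm m (w1 t - mode_curve1 t) ^+ 2 + c0 * fnorm g (w t - mode_curve t) ^+ 2 +
    fnorm m (w t - mode_curve t) ^+ 2 <=
  (evolution_const t * (Cinv ^+ 4 / K%:R ^+ 2)) ^+ 2.
Proof.
move=> t0 dw dw1 eqn w0 w10.
have q0 : 0 <= Cinv ^+ 4 / K%:R ^+ 2 by rewrite divr_ge0 ?exprn_ge0// ltW.
have r0 : 0 <= residual_const.
  apply: mulr_ge0 decay_const_ge0; apply: divr_ge0; first exact: mulr_ge0.
  by rewrite exprn_ge0// ltW.
pose rho := expR (M / (2 * c0) * t) * residual_const * (Cinv ^+ 4 / K%:R ^+ 2).
have rho0 : 0 <= rho := mulr_ge0 (mulr_ge0 (expR_ge0 _) r0) q0.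
have -> : (evolution_const t * (Cinv ^+ 4 / K%:R ^+ 2)) ^+ 2 =
    rho ^+ 2 * (t * expR ((3 + M / c0) * t)).
  have Z0 : 0 <= t * expR ((3 + M / c0) * t) by rewrite mulr_ge0// expR_ge0.
  rewrite /rho /evolution_const -[in RHS](sqr_sqrtr Z0).
  by move: (Num.sqrt _) (expR _) => Z X; ring.
have bkm r v v' : `|k r v v'| <= (M * Cinv ^+ 2 * (fnorm m v * fnorm m v'))%:C.
  apply: le_trans (bk r v v') _; rewrite lecR -mulrA ler_wpM2l//.
  apply: le_trans (ler_pM (fnorm_ge0 _ _) (fnorm_ge0 _ _) (hinv _) (hinv _)) _.
  by rewrite le_eqVlt; apply/orP; left; apply/eqP; ring.
apply: (energy_estimate (e := fun r => w r - mode_curve r)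
  (e1 := fun r => w1 r - mode_curve1 r) (e2 := fun r => w2 r - mode_curve2 r)
  (res := residual) hm hg hs hk hc0 hM hcoer dk bk1 bkm hkap0 t0 rho0).
- by move=> r hr; apply: (curve_derivativeB hm); [exact: dw|exact: mode_curve_derivative].
- by move=> r hr; apply: (curve_derivativeB hm); [exact: dw1|exact: mode_curve1_derivative].
- move=> r v hr; rewrite residual_mode_curve -[RHS]add0r -(eqn r v hr).
  rewrite !(hformDr hm.1, hformDr (hk r), hformDr hs.1, hformNr hm.1, hformNr (hk r), hformNr hs.1).
  by ring.
- move=> r v /andP[hr rt]; apply: le_trans (norm_residual_le _ _) _; rewrite lecR.
  apply: ler_wpM2r; first exact: fnorm_ge0.
  rewrite /rho -[leRHS]mulrA; apply: ler_wpM2r; first exact: mulr_ge0 r0 q0.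
  rewrite ler_expR.
  apply: le_trans (ler_wpM2r hr growth_rate_le) _.
  by rewrite ler_wpM2l// divr_ge0// mulr_ge0// ltW.
- by rewrite w0 subrr.
- by rewrite w10 subrr.
Qed.

End HarmonicEstimates.

(** * Weighted inner products *)

Section WeightedIntegrals.
Context {d : measure_display} {S : measurableType d} {R : realType}.
Variable mu : {measure set S -> \bar R}.
Implicit Types (a p : S -> R) (f g h : S -> R[i]).
Local Notation C := R[i].
Local Notation integrableR p := (mu.-integrable [set: S] (EFin \o p)).

Lemma Linf_ae_le a (A : R) : (Lnorm mu +oo%E (EFin \o a) <= A%:E)%E ->
  \forall x \ae mu, `|a x| <= A.
Proof.
rewrite unlock; case: ifPn => [_ /ess_supP|].
  by apply: filterS => x /=; rewrite lee_fin.
(* The measure is zero here and the L^oo norm a default value; any property holds almost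
   everywhere. *)
rewrite -leNgt measure_le0 => /eqP mu0 _.
exists setT; split => //.
Qed.

Definition ae_bounded (A : R) a :=
  [/\ 0 <= A, measurable_fun setT a & \forall x \ae mu, `|a x| <= A].

Lemma ae_bounded_mul (A : R) a p : ae_bounded A a -> integrableR p ->
  integrableR (fun x => a x * p x) /\
  `|\int[mu]_x (a x * p x)| <= A * \int[mu]_x `|p x|.
Proof.
move=> [A0 ma aA] ip; have /integrableP[/measurable_EFinP mp pfin] := ip.
have map' : measurable_fun setT (fun x => a x * p x) by exact: measurable_funM.
have mnp : measurable_fun setT (fun x => `|p x|) by exact: measurableT_comp.
have inp : integrableR (fun x => `|p x|).
  exact: (integrable_norm ip).
have ae_le : (\int[mu]_x (`|a x * p x|)%:E <= \int[mu]_x (A * `|p x|)%:E)%E.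
  apply: ae_ge0_le_integral => //.
  - by apply/measurable_EFinP; exact: measurableT_comp.
  - by move=> x _; rewrite lee_fin mulr_ge0.
  - by apply/measurable_EFinP; exact: measurable_funM.
  - apply: filterS aA => x xA _; rewrite lee_fin normrM ler_wpM2r//.
have iA : integrableR (fun x => A * `|p x|).
  exact: (integrableZl measurableT A inp).
have iap : integrableR (fun x => a x * p x).
  apply/integrableP; split; first exact/measurable_EFinP.
  apply: le_lt_trans ae_le _; have /integrableP[_] := iA.
  apply: le_lt_trans; apply: ge0_le_integral => //.
  - by move=> x _; rewrite lee_fin mulr_ge0.
  - by apply/measurable_EFinP; exact: measurable_funM.
  - by do 2 apply: measurableT_comp => //; exact: measurable_funM.
  - by move=> x _; rewrite abse_EFin lee_fin ler_norm.
split => //; apply: le_trans (le_normr_Rintegral measurableT iap) _.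
rewrite -RintegralZl// /Rintegral fine_le//.
- exact: integrable_fin_num (integrable_norm iap).
- exact: integrable_fin_num iA.
Qed.

(** Deduced from the upper bound of [ae_bounded_mul], applied to [B - a] with [B] at least [A] and
    [c]: this function lies between 0 and [B - c] almost everywhere. *)
Lemma ae_bounded_ge (A c : R) a p : ae_bounded A a -> integrableR p ->
  (forall x, 0 <= p x) -> (\forall x \ae mu, c <= a x) ->
  c * \int[mu]_x p x <= \int[mu]_x (a x * p x).
Proof.
move=> bA ip p0 ca.
have [iap _] := ae_bounded_mul bA ip; have [A0 ma aA] := bA.
pose B := A + `|c|.
have cB : c <= B by rewrite (le_trans (ler_norm c))// lerDr.
have bB : ae_bounded (B - c) (fun x => B - a x).
  split; [by rewrite subr_ge0|exact: measurable_funB|].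
  apply: filterS2 aA ca => x; rewrite ler_norml => /andP[_ xA] cx.
  rewrite ger0_norm ?subr_ge0 ?lerD2l ?lerN2// (le_trans xA)// lerDl//.
have iBp : integrableR (fun x => B * p x) := integrableZl measurableT B ip.
have [_] := ae_bounded_mul bB ip.
under eq_Rintegral do rewrite mulrBl.
under [X in _ <= _ * X]eq_Rintegral do rewrite ger0_norm//.
rewrite RintegralB// RintegralZl// => /(le_trans (ler_norm _)); lra.
Qed.

Definition cintegrable h :=
  integrableR (fun x => Re (h x)) /\ integrableR (fun x => Im (h x)).

Lemma cintegralD f g : cintegrable f -> cintegrable g ->
  cintegrable (fun x => f x + g x) /\
  cintegral mu (fun x => f x + g x) = cintegral mu f + cintegral mu g.
Proof.
move=> [f1 f2] [g1 g2].
have i1 := integrableD measurableT f1 g1; have i2 := integrableD measurableT f2 g2.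
split; first split.
- by under [X in EFin \o X]eq_fun do rewrite Re_add.
- by under [X in EFin \o X]eq_fun do rewrite Im_add.
rewrite /cintegral; under eq_Rintegral do rewrite Re_add.
under [X in _ +i* X = _]eq_Rintegral do rewrite Im_add.
by rewrite !RintegralD.
Qed.

Lemma cintegralZ (z : C) f : cintegrable f ->
  cintegrable (fun x => z * f x) /\
  cintegral mu (fun x => z * f x) = z * cintegral mu f.
Proof.
move=> [f1 f2].
have i1 c := integrableZl measurableT c f1; have i2 c := integrableZl measurableT c f2.
have j1 := integrableB measurableT (i1 (Re z)) (i2 (Im z)).
have j2 := integrableD measurableT (i2 (Re z)) (i1 (Im z)).
split; first split.
- by under [X in EFin \o X]eq_fun do rewrite Re_mul.
- by under [X in EFin \o X]eq_fun do rewrite Im_mul.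
rewrite /cintegral; under eq_Rintegral do rewrite Re_mul.
under [X in _ +i* X = _]eq_Rintegral do rewrite Im_mul.
rewrite RintegralB//; [|exact: i1|exact: i2].
rewrite RintegralD//; [|exact: i2|exact: i1].
by rewrite !RintegralZl//; apply: complex_eqP; rewrite ?Re_mul ?Im_mul.
Qed.

Lemma cintegral_conj f : cintegrable f ->
  cintegral mu (fun x => (f x)^*) = (cintegral mu f)^*.
Proof.
move=> [f1 f2]; rewrite /cintegral; under eq_Rintegral do rewrite Re_conjc.
under [X in _ +i* X = _]eq_Rintegral do rewrite Im_conjc -mulN1r.
by rewrite RintegralZl// mulN1r.
Qed.

Lemma L2_integrable f g : L2 mu f -> L2 mu g -> cintegrable (fun x => (f x)^* * g x).
Proof.
move=> [f1 f2] [g1 g2].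
have prod p q : p \in Lfun mu 2%:E -> q \in Lfun mu 2%:E -> integrableR (fun x => p x * q x).
  by move=> hp hq; apply/Lfun1_integrable; exact: Lfun2_mul_Lfun1.
have j1 := integrableD measurableT (prod _ _ f1 g1) (prod _ _ f2 g2).
have j2 := integrableB measurableT (prod _ _ f1 g2) (prod _ _ f2 g1).
split.
- under [X in EFin \o X]eq_fun do rewrite Re_mul Re_conjc Im_conjc mulNr opprK.
  exact: j1.
- under [X in EFin \o X]eq_fun do rewrite Im_mul Re_conjc Im_conjc mulNr.
  exact: j2.
Qed.

Let Lfun2D p q : p \in Lfun mu 2%:E -> q \in Lfun mu 2%:E ->
  (fun x => p x + q x) \in Lfun mu 2%:E.
Proof. exact: (Lfun_addr_closed mu (lee1n 2)).2. Qed.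

Let Lfun2Z c p : p \in Lfun mu 2%:E -> (fun x => c * p x) \in Lfun mu 2%:E.
Proof.
move=> hp; have := Lfun_scale c (ler1n R 2) hp.
by rewrite (_ : c \o* p = fun x => c * p x)//; apply/funext => x /=; rewrite mulrC.
Qed.

Lemma L2D f g : L2 mu f -> L2 mu g -> L2 mu (fun x => f x + g x).
Proof.
move=> [f1 f2] [g1 g2]; split.
- by under eq_fun do rewrite Re_add; exact: Lfun2D.
- by under eq_fun do rewrite Im_add; exact: Lfun2D.
Qed.

Lemma L2Z (z : C) f : L2 mu f -> L2 mu (fun x => z * f x).
Proof.
move=> [f1 f2]; split.
- under eq_fun do rewrite Re_mul -mulNr; exact: Lfun2D (Lfun2Z _ f1) (Lfun2Z _ f2).
- under eq_fun do rewrite Im_mul; exact: Lfun2D (Lfun2Z _ f2) (Lfun2Z _ f1).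
Qed.

Definition weighted a f : S -> C := fun x => (a x)%:C * f x.

Lemma weighted_integrable (A : R) a f g : ae_bounded A a -> L2 mu f -> L2 mu g ->
  cintegrable (fun x => (f x)^* * weighted a g x) /\
  inner mu f (weighted a g) =
    (\int[mu]_x (a x * Re ((f x)^* * g x))) +i* (\int[mu]_x (a x * Im ((f x)^* * g x))).
Proof.
move=> ba hf hg; have [i1 i2] := L2_integrable hf hg.
have eR x : Re ((f x)^* * weighted a g x) = a x * Re ((f x)^* * g x).
  by rewrite /weighted mulrCA Re_mul/= mul0r subr0.
have eI x : Im ((f x)^* * weighted a g x) = a x * Im ((f x)^* * g x).
  by rewrite /weighted mulrCA Im_mul/= mul0r addr0.
split; first split.
- by under [X in EFin \o X]eq_fun do rewrite eR; exact: (ae_bounded_mul ba i1).1.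
- by under [X in EFin \o X]eq_fun do rewrite eI; exact: (ae_bounded_mul ba i2).1.
by rewrite /inner /cintegral; congr (_ +i* _); apply: eq_Rintegral => x _.
Qed.

End WeightedIntegrals.

Section WeightedForms.
Context {d : measure_display} {S : measurableType d} {R : realType}.
Variable mu : {measure set S -> \bar R}.
Local Notation C := R[i].
Context {V : lmodType C} (L : V -> S -> C).
Context (L_linear : forall a u v x, L (a *: u + v) x = a * L u x + L v x).
Context (L_L2 : forall v, L2 mu (L v)).

Lemma inner_ge0 (f : S -> C) : 0 <= inner mu f f.
Proof.
rewrite /inner /cintegral.
have -> : \int[mu]_x Im ((f x)^* * f x) = 0.
  transitivity (\int[mu]_(x in [set: S]) (0 : R)); last by rewrite Rintegral_cst ?mul0r.
  by apply: eq_Rintegral => x _; rewrite Im_mul Re_conjc Im_conjc; ring.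
rewrite lecE/= eqxx/=; apply: Rintegral_ge0 => x _.
by rewrite Re_mul Re_conjc Im_conjc mulNr opprK addr_ge0// -expr2 sqr_ge0.
Qed.

Lemma weighted_hermitian (A : R) a : ae_bounded mu A a ->
  hermitian_form (fun v w => inner mu (L v) (weighted a (L w))).
Proof.
move=> ba; split.
  move=> z u v w.
  have [iu _] := weighted_integrable ba (L_L2 w) (L_L2 u).
  have [iv _] := weighted_integrable ba (L_L2 w) (L_L2 v).
  have [izu <-] := cintegralZ z iu.
  have [_ <-] := cintegralD izu iv.
  rewrite /inner; congr cintegral; apply/funext => x.
  by rewrite /weighted L_linear; ring.
move=> u v; have [iv _] := weighted_integrable ba (L_L2 v) (L_L2 u).
rewrite /inner -cintegral_conj//; congr cintegral; apply/funext => x.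
rewrite /weighted !rmorphM/= conjCK.
have -> : ((a x)%:C)^* = (a x)%:C :> C by apply: complex_eqP; rewrite //= oppr0.
by ring.
Qed.

Lemma weightedE1 (f : S -> C) : weighted (fun=> 1) f = f.
Proof. by apply/funext => x; rewrite /weighted mul1r. Qed.

Lemma ae_bounded1 : ae_bounded mu 1 (fun=> 1).
Proof. by split => //; apply: nearW => x; rewrite normr1. Qed.

Lemma inner_positive_form : positive_form (fun v w => inner mu (L v) (L w)).
Proof.
split; last by move=> v; exact: inner_ge0.
have <- : (fun v w => inner mu (L v) (weighted (fun=> 1) (L w))) =
    fun v w => inner mu (L v) (L w).
  by apply/funext => v; apply/funext => w; rewrite weightedE1.
exact: weighted_hermitian ae_bounded1.
Qed.

Let sq (f : S -> C) x : Re ((f x)^* * f x) = Re (f x) ^+ 2 + Im (f x) ^+ 2.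
Proof. by rewrite Re_mul Re_conjc Im_conjc; ring. Qed.

Lemma weighted_diag_le (A : R) a v : ae_bounded mu A a ->
  `|Re (inner mu (L v) (weighted a (L v)))| <= A * Re (inner mu (L v) (L v)).
Proof.
move=> ba; have [i1 _] := L2_integrable (L_L2 v) (L_L2 v).
rewrite (weighted_integrable ba (L_L2 v) (L_L2 v)).2/=.
apply: le_trans (ae_bounded_mul ba i1).2 _.
rewrite /inner /cintegral/=; under eq_Rintegral do rewrite ger0_norm ?sq ?addr_ge0 ?sqr_ge0//.
by under [X in _ <= _ * X]eq_Rintegral do rewrite sq.
Qed.

Lemma weighted_diag_ge (A c : R) a v : ae_bounded mu A a ->
  (\forall x \ae mu, c <= a x) ->
  c * Re (inner mu (L v) (L v)) <= Re (inner mu (L v) (weighted a (L v))).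
Proof.
move=> ba ca; have [i1 _] := L2_integrable (L_L2 v) (L_L2 v).
rewrite (weighted_integrable ba (L_L2 v) (L_L2 v)).2/=.
by apply: ae_bounded_ge ba i1 _ ca => x; rewrite sq addr_ge0 ?sqr_ge0.
Qed.

Lemma hermitian_form_sum (I : Type) (r : seq I) (b : I -> V -> V -> C) :
  (forall i, hermitian_form (b i)) -> hermitian_form (fun v w => \sum_(i <- r) b i v w).
Proof.
move=> hb; split => [a u v w|u v].
  by rewrite mulr_sumr -big_split/=; apply: eq_bigr => i _; rewrite (hb i).1.
by rewrite rmorph_sum/=; apply: eq_bigr => i _; rewrite -(hb i).2.
Qed.

End WeightedForms.

(** * Weights depending on time as curves in L^oo *)

Section WeightedCurves.
Context {d : measure_display} {S : measurableType d} {R : realType}.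
Variable mu : {measure set S -> \bar R}.
Local Notation C := R[i].
Implicit Types (k : R -> S -> R) (f g : S -> C).
Local Notation Linf a := (Lnorm mu +oo%E (EFin \o a)).

Lemma Linf_ae_bounded a (A : R) : a \in Lfun mu +oo%E -> (Linf a <= A%:E)%E ->
  ae_bounded mu A a.
Proof.
move=> /sub_Lfun_mfun; rewrite inE/= => ma aA; split => //; last exact: Linf_ae_le.
by rewrite -lee_fin; apply: le_trans aA; exact: Lnorm_ge0.
Qed.

Lemma Lfun_Linf a : a \in Lfun mu +oo%E ->
  Linf a = (fine (Linf a))%:E /\ ae_bounded mu (fine (Linf a)) a.
Proof.
move=> ha; have := sub_Lfun_finLfun ha; rewrite inE/= /finite_norm => fa.
have e : Linf a = (fine (Linf a))%:E.
  by rewrite fineK// ge0_fin_numE// Lnorm_ge0.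
by split => //; apply: Linf_ae_bounded => //; rewrite -e.
Qed.

Lemma LfunyD a b : a \in Lfun mu +oo%E -> b \in Lfun mu +oo%E ->
  (fun x => a x + b x) \in Lfun mu +oo%E.
Proof. exact: (Lfun_addr_closed mu (leey 1)).2. Qed.

Lemma LfunyZ c a : a \in Lfun mu +oo%E -> (fun x => c * a x) \in Lfun mu +oo%E.
Proof.
move=> ha; have [h0 h] := Lfun_submod_closed mu (leey 1).
by have := h c a 0 ha h0; rewrite addr0.
Qed.

Lemma LfunyB a b : a \in Lfun mu +oo%E -> b \in Lfun mu +oo%E ->
  (fun x => a x - b x) \in Lfun mu +oo%E.
Proof.
move=> ha hb; under eq_fun do rewrite -mulN1r; exact: LfunyD (LfunyZ _ hb).
Qed.

Lemma is_derive_limit (F : R -> R) (t df : R) :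
  s^-1 * (F (t + s) - F t) @[s --> 0^'] --> df -> is_derive t 1 F df.
Proof.
move=> h; have h' : (fun s => s^-1 *: (F (s *: 1 + t) - F t)) @ 0^' --> df.
  apply: cvg_trans h; apply: near_eq_cvg; near=> s.
  by rewrite /GRing.scale/= mulr1 [s + t]addrC.
by split; [apply/cvg_ex; exists df|exact: cvg_lim].
Unshelve. all: by end_near. Qed.

Lemma cvge0_le (U : Type) (F : set_system U) {FF : Filter F} (n : U -> \bar R) (eps : R) :
  n s @[s --> F] --> 0%E -> 0 < eps -> (forall s, (0 <= n s)%E) ->
  \forall s \near F, (n s <= eps%:E)%E.
Proof.
move=> h e0 n0.
have : nbhs 0%E [set x | (x < eps%:E)%E].
  by apply: open_nbhs_nbhs; split; [exact: open_ereal_lt_ereal|rewrite /= lte_fin].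
by move=> /h hF; apply: (filterS _ (hF : F [set s | (n s < eps%:E)%E])) => s; exact: ltW.
Qed.

Lemma norm_cvg_le (U : Type) (F : set_system U) {FF : Filter F} (f : U -> R) (l B : R)
    (n : U -> \bar R) : n s @[s --> F] --> 0%E -> (forall s, (0 <= n s)%E) -> 0 <= B ->
  (forall s A, 0 <= A -> (n s <= A%:E)%E -> `|f s - l| <= A * B) ->
  f s @[s --> F] --> l.
Proof.
move=> hn n0 B0 hf; apply/cvgrPdist_le => e e0.
have e1 : 0 < e / (B + 1) by rewrite divr_gt0// ltr_wpDl.
have hF := cvge0_le (FF := FF) hn e1 n0; apply: filterS hF => s hs.
rewrite distrC; apply: le_trans (hf s _ (ltW e1) hs) _.
by rewrite -mulrA ler_piMr ?(ltW e0)// mulrC ler_pdivrMr ?ltr_wpDl// mul1r lerDl.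
Qed.

(** Integration against the fixed integrable [p] is a bounded functional on L^oo, so convergence of
    difference quotients in L^oo passes to the integrals. *)
Lemma weighted_integral_derivative k k1 (p : S -> R) t :
  (forall t, k t \in Lfun mu +oo%E) -> (forall t, k1 t \in Lfun mu +oo%E) ->
  mu.-integrable setT (EFin \o p) ->
  Linf (fun x => s^-1 * (k (t + s) x - k t x) - k1 t x) @[s --> 0^'] --> 0%E ->
  is_derive t 1 (fun t => \int[mu]_x (k t x * p x)) (\int[mu]_x (k1 t x * p x)).
Proof.
move=> hk hk1 ip hd; apply: is_derive_limit.
have B0 : 0 <= \int[mu]_x `|p x| by exact: Rintegral_ge0.
apply: (norm_cvg_le hd) B0 _ => [s|s A A0 hs]; first exact: Lnorm_ge0.
have ha : (fun x => s^-1 * (k (t + s) x - k t x) - k1 t x) \in Lfun mu +oo%E.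
  by apply: LfunyB => //; apply: LfunyZ; exact: LfunyB.
have bnd := Linf_ae_bounded ha hs.
have [_] := ae_bounded_mul bnd ip; congr (`|_| <= _).
have ii a : a \in Lfun mu +oo%E -> mu.-integrable setT (EFin \o (fun x => a x * p x)).
  by move=> /Lfun_Linf[_ ba]; exact: (ae_bounded_mul ba ip).1.
under eq_Rintegral do rewrite mulrBl -mulrA mulrBl.
rewrite RintegralB//; last exact: ii.
  rewrite RintegralZl//; last exact: (integrableB measurableT (ii _ (hk _)) (ii _ (hk _))).
  by rewrite RintegralB//; exact: ii.
exact: (integrableZl measurableT s^-1 (integrableB measurableT (ii _ (hk _)) (ii _ (hk _)))).
Qed.

Lemma weighted_integral_continuous k (p : S -> R) :
  (forall t, k t \in Lfun mu +oo%E) -> mu.-integrable setT (EFin \o p) ->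
  (forall t, Linf (k s \- k t) @[s --> t] --> 0%E) ->
  continuous (fun t => \int[mu]_x (k t x * p x)).
Proof.
move=> hk ip hc t.
have B0 : 0 <= \int[mu]_x `|p x| by exact: Rintegral_ge0.
apply: (norm_cvg_le (hc t)) B0 _ => [s|s A A0 hs]; first exact: Lnorm_ge0.
have ha : (k s \- k t) \in Lfun mu +oo%E by exact: LfunyB.
have [_] := ae_bounded_mul (Linf_ae_bounded ha hs) ip; congr (`|_| <= _).
have ii a : a \in Lfun mu +oo%E -> mu.-integrable setT (EFin \o (fun x => a x * p x)).
  by move=> /Lfun_Linf[_ ba]; exact: (ae_bounded_mul ba ip).1.
under eq_Rintegral do rewrite mulrBl.
by rewrite RintegralB//; exact: ii.
Qed.

Lemma weighted_cderivable k k1 f g :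
  (forall t, k t \in Lfun mu +oo%E) -> (forall t, k1 t \in Lfun mu +oo%E) ->
  (forall t, Linf (fun x => s^-1 * (k (t + s) x - k t x) - k1 t x) @[s --> 0^'] --> 0%E) ->
  L2 mu f -> L2 mu g ->
  cderivable (fun t => inner mu f (weighted (k t) g)) (fun t => inner mu f (weighted (k1 t) g)).
Proof.
move=> hk hk1 hd hf hg.
have E k' : (forall t, k' t \in Lfun mu +oo%E) ->
    (fun t => inner mu f (weighted (k' t) g)) = fun t =>
    (\int[mu]_x (k' t x * Re ((f x)^* * g x))) +i* (\int[mu]_x (k' t x * Im ((f x)^* * g x))).
  move=> hk'; apply/funext => t; have [_ bk] := Lfun_Linf (hk' t).
  exact: (weighted_integrable bk hf hg).2.
have [i1 i2] := L2_integrable hf hg.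
by rewrite !E// => t; split; exact: weighted_integral_derivative.
Qed.

Lemma weighted_ccontinuous k f g :
  (forall t, k t \in Lfun mu +oo%E) -> (forall t, Linf (k s \- k t) @[s --> t] --> 0%E) ->
  L2 mu f -> L2 mu g -> ccontinuous (fun t => inner mu f (weighted (k t) g)).
Proof.
move=> hk hc hf hg.
have -> : (fun t => inner mu f (weighted (k t) g)) = fun t =>
    (\int[mu]_x (k t x * Re ((f x)^* * g x))) +i* (\int[mu]_x (k t x * Im ((f x)^* * g x))).
  apply/funext => t; have [_ bk] := Lfun_Linf (hk t).
  exact: (weighted_integrable bk hf hg).2.
have [i1 i2] := L2_integrable hf hg.
by split; exact: weighted_integral_continuous.
Qed.

(** By Minkowski's inequality the norm is continuous along the curve, hence attains its maximum on
    [a, b]. *)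
Lemma Linf_curve_bounded k (a b : R) : a <= b -> (forall t, k t \in Lfun mu +oo%E) ->
  (forall t, Linf (k s \- k t) @[s --> t] --> 0%E) ->
  exists2 M : R, 0 <= M & forall t, a <= t <= b -> (Linf (k t) <= M%:E)%E.
Proof.
move=> ab hk hc; pose n t := fine (Linf (k t)).
have nE t : Linf (k t) = (n t)%:E by exact: (Lfun_Linf (hk t)).1.
have n0 t : 0 <= n t by rewrite -lee_fin -nE Lnorm_ge0.
have mk t : measurable_fun setT (k t) by have [_ []] := Lfun_Linf (hk t).
have cn : continuous n.
  move=> t; apply: (norm_cvg_le (hc t)) ler01 _ => [s|s A A0 hs]; first exact: Lnorm_ge0.
  have tri u v : (Linf (k u \- k v)%R <= A%:E)%E -> n u - n v <= A.
    move=> h; rewrite lerBlDr -lee_fin EFinD -!nE.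
    apply: le_trans (leeD2r _ h).
    have := eminkowski mu (measurable_funB (mk u) (mk v)) (mk v) (leey 1).
    rewrite (_ : (k u \- k v \+ k v)%R = k u)//.
    by apply/funext => x /=; rewrite subrK.
  rewrite mulr1 ler_norml lerNl opprB !tri//.
  have -> : k t \- k s = \- (k s \- k t) by apply/funext => x /=; rewrite opprB.
  pose q := k s \- k t; rewrite (_ : EFin \o _ = (\- (EFin \o q))%E); first by rewrite oppe_Lnorm.
  by apply/funext => x.
have [c _ hM] := EVT_max ab (continuous_subspaceT cn).
by exists (n c) => // t tab; rewrite nE lee_fin hM// in_itv.
Qed.

End WeightedCurves.

(** * Exchange of time averages and spatial integrals *)

Section WeightedFubini.
Context {d : measure_display} {S : measurableType d} {R : realType}.
Variable mu : {finite_measure set S -> \bar R}.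
Local Notation leb := (@lebesgue_measure R).
Local Notation integrableR p := (mu.-integrable [set: S] (EFin \o p)).
Context (k : R -> S -> R) (M T : R) (hT : 0 < T).
Context (mk : measurable_fun setT (fun p : S * measurableTypeR R => k p.2 p.1)).
Context (bk : forall t, 0 <= t <= T -> ae_bounded mu M (k t)).
Context (psi : R -> R) (cpsi : continuous psi) (psi1 : forall t, `|psi t| <= 1).

Let I : set (measurableTypeR R) := `[0, T]%classic.
Let mI : measurable I. Proof. exact: measurable_itv. Qed.
Let q (t : measurableTypeR R) : R := psi t * \1_I t.
Let mq : measurable_fun setT q.
Proof.
apply: measurable_funM; last exact: measurable_indic.
exact: continuous_measurable_fun.
Qed.

Let w (p : S -> R) (z : S * measurableTypeR R) : \bar R :=
  (k z.2 z.1 * q z.2 * p z.1)%:E.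

Let M0 : 0 <= M.
Proof.
have h : 0 <= (0 : R) <= T by rewrite lexx ltW.
by have [] := bk h.
Qed.

Let q_out t : ~ I t -> q t = 0.
Proof. by move=> h; rewrite /q indicE memNset// mulr0. Qed.

Let q_le t : `|q t| <= \1_I t.
Proof.
by rewrite /q normrM indicE; case: (_ \in _); rewrite ?normr1 ?mulr1// normr0 mulr0.
Qed.

(** The iterated integral takes space first, since the bound on [k t] holds for each fixed [t] off a
    null set that may depend on [t]. *)
Let int_w p : integrableR p -> (mu \x leb)%E.-integrable setT (w p).
Proof.
move=> ip; have /integrableP[/measurable_EFinP mp _] := ip.
have mw : measurable_fun setT (w p).
  apply/measurable_EFinP; apply: measurable_funM; first apply: measurable_funM => //.
    by apply: (measurableT_comp mq); exact: measurable_snd.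
  by apply: (measurableT_comp mp); exact: measurable_fst.
apply/integrable21ltyP => //.
pose B := M * \int[mu]_x `|p x|.
have inp := integrable_norm ip.
have B0 : 0 <= B by rewrite mulr_ge0// Rintegral_ge0.
apply: (@le_lt_trans _ _ (\int[leb]_t (B * \1_I t)%:E)%E).
  apply: ge0_le_integral => //.
  - by move=> t _; apply: integral_ge0.
  - have mw' : measurable_fun setT (abse \o w p) by exact: measurableT_comp.
    exact: (measurable_fun_fubini_tonelli_G (m1 := mu) _ mw' (fun x => abse_ge0 _)).
  - by apply/measurable_EFinP; apply: measurable_funM => //; exact: measurable_indic.
  move=> t _; have [It|nIt] := pselect (I t); last first.
    rewrite (eq_integral (fun=> 0%E)) ?integral0 => [|x _]; last first.
      by rewrite /w /= q_out// mulr0 mul0r normr0.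
    by rewrite lee_fin; apply: mulr_ge0 B0 (ler0n _ _).
  have ht : 0 <= t <= T by move: It; rewrite /I /= in_itv.
  have [_ mkt kM] := bk ht.
  have ba : ae_bounded mu M (fun x => `|k t x * q t|).
    split => //; first by apply: measurableT_comp => //; exact: measurable_funM.
    apply: filterS kM => x kx; rewrite normr_id normrM (le_trans _ kx)// ler_piMr//.
    by apply: le_trans (q_le t) _; rewrite indicE; case: (_ \in _).
  have [i1 le1] := ae_bounded_mul ba inp.
  have E x : `|w p (x, t)|%E = (`|k t x * q t| * `|p x|)%:E by rewrite /w abse_EFin normrM.
  rewrite (eq_integral (fun x => (`|k t x * q t| * `|p x|)%:E)); last by move=> x _; exact: E.
  have -> : (\int[mu]_x (`|k t x * q t| * `|p x|)%:E =
      (\int[mu]_x (`|k t x * q t| * `|p x|))%R%:E)%E.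
    by rewrite /Rintegral fineK//; exact: integrable_fin_num i1.
  rewrite lee_fin indicE mem_set// mulr1; apply: le_trans (ler_norm _) _.
  apply: le_trans le1 _; rewrite /B.
  by under eq_Rintegral do rewrite normr_id.
have -> : (\int[leb]_t (B * \1_I t)%:E)%E = (B%:E * leb I)%E.
  under eq_integral do rewrite EFinM.
  by rewrite ge0_integralZl ?lee_fin// ?integral_indic ?setIT//; apply/measurable_EFinP; exact: measurable_indic.
by rewrite lebesgue_measure_itv/= lte_fin hT -EFinD -EFinM ltry.
Qed.

Definition time_average_integral (x : S) : R := \int[leb]_(t in `[0, T]) (k t x * psi t).
Local Notation Kx := time_average_integral.

Let KxE x : Kx x = \int[leb]_t (k t x * q t).
Proof.
rewrite /time_average_integral Rintegral_mkcond; apply: eq_Rintegral => t _.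
rewrite patchE /q indicE -[t \in `[0, T]%classic]/(t \in I).
by case: (t \in I); rewrite ?mulr1 ?mulr0.
Qed.

Let w1E x t : w (fun=> 1) (x, t) = (k t x * q t)%:E.
Proof. by rewrite /w mulr1. Qed.

Let i1 : integrableR (fun=> 1).
Proof. exact: finite_measure_integrable_cst. Qed.

(** Taken from Fubini with [p = 1], which is integrable because [mu] is finite. *)
Lemma measurable_time_average : measurable_fun setT Kx.
Proof.
have h := measurable_fubini_F (int_w i1).
have -> : Kx = fine \o fubini_F leb (w (fun=> 1)).
  apply/funext => x; rewrite KxE /= /Rintegral; congr fine.
  by apply: eq_integral => t _; rewrite w1E.
exact: (measurableT_comp (fine_measurable _)).
Qed.

Lemma fubini_weighted p : integrableR p ->
  integrableR (fun x => Kx x * p x) /\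
  \int[mu]_x (Kx x * p x) = \int[leb]_(t in `[0, T]) (psi t * \int[mu]_x (k t x * p x)).
Proof.
move=> ip; have iw := int_w ip; have iw1 := int_w i1.
have /integrableP[/measurable_EFinP mp _] := ip.
(* Integrability in time is known for almost every [x] only, so [p x] can be moved out of the time
   integral only there. *)
have ae1 : \forall x \ae mu, fubini_F leb (w p) x = (Kx x * p x)%:E.
  apply: filterS (ae_integrable1 iw1) => x ix.
  have {}ix : leb.-integrable setT (EFin \o (fun t => k t x * q t)).
    by apply: eq_integrable ix => // t _; rewrite w1E.
  rewrite /fubini_F KxE -RintegralZr// /Rintegral fineK//.
  exact: integrable_fin_num (integrableZr measurableT (p x) ix).
have iF := integrable_fubini_F iw.
have mKp : measurable_fun setT (fun x => Kx x * p x).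
  by apply: measurable_funM => //; exact: measurable_time_average.
have mKpE : measurable_fun setT (fun x => (Kx x * p x)%:E) by exact/measurable_EFinP.
have iKp : integrableR (fun x => Kx x * p x).
  apply/integrableP; split=> //; have /integrableP[mF] := iF.
  apply: le_lt_trans; rewrite le_eqVlt; apply/orP; left; apply/eqP.
  apply: ge0_ae_eq_integral => //; do ?exact: measurableT_comp.
  by apply: filterS ae1 => x -> _.
split=> //.
have -> : \int[mu]_x (Kx x * p x) = fine (\int[mu]_x fubini_F leb (w p) x)%E.
  rewrite /Rintegral; congr fine; apply: ae_eq_integral => //.
    exact: measurable_fubini_F iw.
  by apply: filterS ae1 => x h _.
rewrite /fubini_F (Fubini iw) /Rintegral [in RHS]integral_mkcond; congr fine.
apply: eq_integral => t _; rewrite patchE; case: ifPn => tI.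
  have ht : 0 <= t <= T by move: tI; rewrite inE/= in_itv.
  have [ii _] := ae_bounded_mul (bk ht) ip.
  rewrite EFinM fineK ?integrable_fin_num// -integralZl//.
  apply: eq_integral => x _; rewrite /w /q/= indicE (_ : t \in I)// mulr1 -EFinM.
  by congr (_%:E); ring.
rewrite (eq_integral (fun=> 0%E)) ?integral0// => x _.
rewrite /w q_out ?mulr0 ?mul0r// => It; move/negP: tI; apply; exact: mem_set.
Qed.

End WeightedFubini.

(** * Finite volume of a bounded domain *)

Section FiniteVolume.
Context {R : realType} {d : nat} (D : set 'rV[R]_d) (hD : bounded_set D).

Lemma lebesgue_outer_bounded : (lebesgue_outer D < +oo)%E.
Proof.
have [M DM] : exists M : R, forall x, D x -> forall i, `|x 0 i| <= M.
  have [M [_ hM]] := hD; exists (M + 1) => x Dx i.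
  have := hM (M + 1) (ltr_pwDr ltr01 (lexx M)) x Dx; apply: le_trans.
  by rewrite [leRHS]/Num.Def.normr/= mx_normrE; apply/bigmax_geP; right => /=; exists (0, i).
pose b : 'rV[R]_d := const_mx (`|M| + 1).
have Db : D `<=` box (- b) b.
  move=> x Dx i; rewrite !mxE.
  have := le_trans (DM x Dx i) (ler_norm M); rewrite ler_norml => /andP[h1 h2].
  by apply/andP; split; lra.
have gauge_le : (box_gauge D < +oo)%E.
  rewrite /box_gauge; case: ifP => // _.
  apply: (@le_lt_trans _ _ (\prod_i (b 0 i - (- b) 0 i))%:E); last exact: ltry.
  apply: ereal_inf_lbound; exists (- b, b) => //=; split => // i.
  by rewrite !mxE; have := normr_ge0 M; lra.
apply: le_lt_trans gauge_le; rewrite /lebesgue_outer /mu_ext.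
(* The cover consists of [D] itself followed by empty sets, so its cost is the gauge of [D]. *)
apply: ereal_inf_lbound; exists (fun n : nat => if (n == 0)%N then D else set0 : set 'rV[R]_d).
  by split=> [[]// _|x Dx]; exists 0%N.
apply/cvg_lim => //; rewrite -cvg_shiftS.
rewrite (_ : [sequence _]_n = cst (box_gauge D)); first exact: cvg_cst.
by rewrite funeqE => n /=; rewrite big_nat_recl//= big1 ?adde0// => i _; exact: box_gauge0.
Qed.

Lemma vol_fin_num : fin_num_fun (vol D).
Proof.
move=> A mA; rewrite ge0_fin_numE ?measure_ge0//.
apply: le_lt_trans lebesgue_outer_bounded.
apply: (@le_outer_measure _ _ lebesgue_outer); exact: subIsetr.
Qed.

(* [vol D] again, under a name that can carry the finite measure structure. *)
Definition bounded_vol of bounded_set D : set (caratheodory_type (vol_outer D)) -> \bar R :=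
  vol D.
HB.instance Definition _ := Measure.copy (bounded_vol hD) (vol D).
HB.instance Definition _ := Measure_isFinite.Build _ _ _ (bounded_vol hD) vol_fin_num.

End FiniteVolume.

(** * From almost every time to every time *)

Section TimeSections.
Context {disp : measure_display} {S : measurableType disp} {R : realType}.
Variable mu : {finite_measure set S -> \bar R}.
Local Notation leb := (@lebesgue_measure R).

(** Uniqueness of the product measure allows it to be computed by sections at fixed time; a
    nonnegative function of integral zero vanishes almost everywhere. *)
Lemma ae_ysection_null (A : set (S * measurableTypeR R)) : measurable A ->
  ((mu \x leb) A = 0)%E -> \forall t \ae leb, mu (ysection A t) = 0%E.
Proof.
move=> mA A0.
have : (\int[leb]_t `|(mu (ysection A t))| = 0)%E.
  have e : ((mu \x^ leb) A = 0)%E.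
    rewrite -A0; apply/esym; apply: product_measure_unique => // B B' mB mB'.
    exact: product_measure2E.
  rewrite -[RHS]e /product_measure2; apply: eq_integral => t _.
  by rewrite gee0_abs.
move=> /(ae_eq_integral_abs leb measurableT (measurable_fun_ysection mu mA)).
by apply: filterS => t; apply.
Qed.

Lemma ae_continuous_ge0 (T : R) (h : R -> R) : 0 < T -> continuous h ->
  (\forall t \ae leb, 0 <= t <= T -> 0 <= h t) -> forall t, 0 <= t <= T -> 0 <= h t.
Proof.
move=> T0 ch [N [mN N0 hN]] t /andP[t0 tT]; rewrite leNgt; apply/negP => ht.
have : \forall s \near t, h s < 0.
  exact: (ch t [set x | x < 0] (lt_nbhsl ht)).
move=> /nbhs_ballP[e /= e0 he].
(* The part within (0, T) of a neighbourhood on which [h] is negative; it has positive length even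
   when [t] is an endpoint, so it is not contained in a null set. *)
pose a := Num.max 0 (t - e); pose b := Num.min T (t + e).
have ab : a < b.
  have -> : (a < b) = [&& (0 < T) && (0 < t + e) & (t - e < T) && (t - e < t + e)].
    by rewrite /a /b gt_max !lt_min.
  by apply/andP; split; apply/andP; split; lra.
have sub : `]a, b[%classic `<=` N.
  move=> s; rewrite /= in_itv/= gt_max lt_min => /andP[/andP[s0 st] /andP[sT ste]].
  have hs : h s < 0.
    by apply: he; rewrite /ball/= ltr_norml; apply/andP; split; lra.
  apply: hN => /= H; have : 0 <= h s by apply: H; rewrite !ltW.
  by rewrite leNgt hs.
have : (leb `]a, b[%classic <= leb N)%E.
  by apply: le_measure => //; rewrite inE//=; exact: measurable_itv.
rewrite N0 lebesgue_measure_itv/= lte_fin ab -EFinD lee_fin subr_le0.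
by rewrite leNgt ab.
Qed.

End TimeSections.

(** * Fourier coefficients of weighted inner products *)

Section FourierForms.
Context {disp : measure_display} {S : measurableType disp} {R : realType}.
Variable mu : {finite_measure set S -> \bar R}.
Local Notation C := R[i].
Local Notation leb := (@lebesgue_measure R).
Context (k : R -> S -> R) (M T : R) (hT : 0 < T).
Context (mk : measurable_fun setT (fun p : S * measurableTypeR R => k p.2 p.1)).
Context (Lk : forall t, k t \in Lfun mu +oo%E).
Context (ck : forall t, Lnorm mu +oo%E (EFin \o (k s \- k t)) @[s --> t] --> 0%E).
Context (bk : forall t, 0 <= t <= T -> ae_bounded mu M (k t)).

(** The expression of [fourier], restated over an abstract finite measure space. *)
Definition fourier_coefficient (n : int) (x : S) : C := (T^-1)%:C *
  ((\int[leb]_(t in `[0, T]) (k t x * cos (n%:~R * frequency T * t))) +i*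
   (\int[leb]_(t in `[0, T]) (k t x * sin (n%:~R * frequency T * t)))).

(** Four real instances of [fubini_weighted]: cosine and sine against the real and imaginary part of
    the product of conj f and g. *)
Lemma inner_fourier (f g : S -> C) n : L2 mu f -> L2 mu g ->
  cintegrable mu (fun x => (f x)^* * (fourier_coefficient n x * g x)) /\
  inner mu f (fun x => fourier_coefficient n x * g x) =
  coef T (fun t => inner mu f (weighted (k t) g)) n.
Proof.
move=> hf hg; have [i1 i2] := L2_integrable hf hg.
pose p1 x := Re ((f x)^* * g x); pose p2 x := Im ((f x)^* * g x).
pose c t : R := cos (n%:~R * frequency T * t); pose s t : R := sin (n%:~R * frequency T * t).
have cc : continuous c.
  by move=> t; apply: (@is_derive_continuous _ _ t (- sin (n%:~R * frequency T * t) * (n%:~R * frequency T)));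
     apply: is_derive_eq; rewrite /GRing.scale/=; ring.
have cs : continuous s.
  by move=> t; apply: (@is_derive_continuous _ _ t (cos (n%:~R * frequency T * t) * (n%:~R * frequency T)));
     apply: is_derive_eq; rewrite /GRing.scale/=; ring.
have c1 t : `|c t| <= 1 by rewrite ler_norml cos_geN1 cos_le1.
have s1 t : `|s t| <= 1 by rewrite ler_norml sin_geN1 sin_le1.
have [jc1 ec1] := fubini_weighted hT mk bk cc c1 i1.
have [jc2 ec2] := fubini_weighted hT mk bk cc c1 i2.
have [js1 es1] := fubini_weighted hT mk bk cs s1 i1.
have [js2 es2] := fubini_weighted hT mk bk cs s1 i2.
pose Kc x := time_average_integral k T c x; pose Ks x := time_average_integral k T s x.
have eR x : Re ((f x)^* * (fourier_coefficient n x * g x)) =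
    T^-1 * (Kc x * p1 x - Ks x * p2 x).
  rewrite mulrCA /fourier_coefficient -mulrA Re_mul/= mul0r subr0 Re_mul/=.
  by rewrite -/(p1 x) -/(p2 x).
have eI x : Im ((f x)^* * (fourier_coefficient n x * g x)) =
    T^-1 * (Kc x * p2 x + Ks x * p1 x).
  rewrite mulrCA /fourier_coefficient -mulrA Im_mul/= mul0r addr0 Im_mul/=.
  by rewrite -/(p1 x) -/(p2 x).
have jR := integrableB measurableT jc1 js2; have jI := integrableD measurableT jc2 js1.
have ci : cintegrable mu (fun x => (f x)^* * (fourier_coefficient n x * g x)).
  split.
    under [X in EFin \o X]eq_fun do rewrite eR; exact: (integrableZl measurableT T^-1 jR).
  under [X in EFin \o X]eq_fun do rewrite eI; exact: (integrableZl measurableT T^-1 jI).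
split=> //.
pose A t := \int[mu]_x (k t x * p1 x); pose B t := \int[mu]_x (k t x * p2 x).
have cA : continuous A by exact: weighted_integral_continuous.
have cB : continuous B by exact: weighted_integral_continuous.
have cM (u v : R -> R) : continuous u -> continuous v -> continuous (fun t => u t * v t).
  by move=> cu cv t; exact: (continuousM (cu t) (cv t)).
have iM (u v : R -> R) : continuous u -> continuous v ->
    leb.-integrable `[0, T] (EFin \o (fun t => u t * v t)).
  by move=> cu cv; apply: continuous_integrable_itv; exact: cM.
have eF t : inner mu f (weighted (k t) g) = A t +i* B t.
  have [_ bkt] := Lfun_Linf (Lk t); exact: (weighted_integrable bkt hf hg).2.
have mitv : measurable (`[0, T] : set (measurableTypeR R)) by exact: measurable_itv.
rewrite /inner /cintegral /coef mean.unlock.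
have -> : \int[mu]_x Re ((f x)^* * (fourier_coefficient n x * g x)) =
    T^-1 * \int[leb]_(t in `[0, T]) Re (inner mu f (weighted (k t) g) * mode T n t).
  under eq_Rintegral do rewrite eR.
  rewrite RintegralZl// RintegralB// ec1 es2; congr (_ * _).
  under [RHS]eq_Rintegral do rewrite eF mode_cos_sin Re_mul/= [A _ * _]mulrC [B _ * _]mulrC.
  by rewrite RintegralB//; exact: iM.
have -> : \int[mu]_x Im ((f x)^* * (fourier_coefficient n x * g x)) =
    T^-1 * \int[leb]_(t in `[0, T]) Im (inner mu f (weighted (k t) g) * mode T n t).
  under eq_Rintegral do rewrite eI.
  rewrite RintegralZl// RintegralD// ec2 es1; congr (_ * _).
  under [RHS]eq_Rintegral do rewrite eF mode_cos_sin Im_mul/= [A _ * _]mulrC [B _ * _]mulrC addrC.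
  by rewrite RintegralD//; exact: iM.
by apply: complex_eqP; rewrite !(Re_mul, Im_mul)/=; ring.
Qed.

Lemma cintegral_sum (I : Type) (r : seq I) (F : I -> S -> C) :
  (forall i, cintegrable mu (F i)) ->
  cintegrable mu (fun x => \sum_(i <- r) F i x) /\
  cintegral mu (fun x => \sum_(i <- r) F i x) = \sum_(i <- r) cintegral mu (F i).
Proof.
move=> hF; elim: r => [|i r [IH1 IH2]].
  have i0 : cintegrable mu (fun=> 0) by split; exact: integrable0.
  have [_] := cintegralZ 0 i0; rewrite big_nil !mul0r => e0.
  have -> : (fun x => \sum_(i <- [::]) F i x) = fun=> 0 by apply/funext => x; rewrite big_nil.
  by split.
under eq_fun do rewrite big_cons; rewrite big_cons -IH2.
exact: cintegralD.
Qed.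

End FourierForms.

(** * Periodic functions *)

Section PeriodicFunctions.
Context {R : realType}.
Local Notation C := R[i].

(** Periodicity is assumed of [kappa] alone; uniqueness of derivatives passes it on to the forms of
    its time derivatives. *)
Lemma cderivable_periodic (F F1 : R -> C) (T : R) : cderivable F F1 ->
  (forall t, F (t + T) = F t) -> forall t, F1 (t + T) = F1 t.
Proof.
move=> dF pF t.
have key (f : R -> R) (a b : R) : (forall s, f (s + T) = f s) ->
    is_derive (t + T) 1 f a -> is_derive t 1 f b -> a = b.
  move=> pf ha hb.
  have hT : is_derive t 1 (fun s => s + T) (1 + 0) by exact: is_deriveD.
  have h := @is_derive1_comp _ f (fun s => s + T) t _ _ ha hT.
  rewrite addr0 /GRing.scale/= mulr1 in h.
  have {}h : is_derive t 1 f a.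
    by rewrite (_ : f = f \o (fun s => s + T))//; apply/funext => s /=; rewrite pf.
  by rewrite -(derive_val (is_derive := h)) -(derive_val (is_derive := hb)).
have [r1 i1] := dF (t + T); have [r2 i2] := dF t.
apply: complex_eqP.
  by apply: key r1 r2 => s; rewrite pF.
by apply: key i1 i2 => s; rewrite pF.
Qed.

Lemma cderivable_sum (I : Type) (r : seq I) (F F1 : I -> R -> C) :
  (forall i, cderivable (F i) (F1 i)) ->
  cderivable (fun t => \sum_(i <- r) F i t) (fun t => \sum_(i <- r) F1 i t).
Proof.
move=> dF; elim: r => [|i r IH].
  have e (H : I -> R -> C) : (fun t => \sum_(i <- [::]) H i t) = fun=> 0.
    by apply/funext => t; rewrite big_nil.
  by rewrite !e; exact: cderivable_cst.
have e (H : I -> R -> C) : (fun t => \sum_(i <- i :: r) H i t) =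
    fun t => H i t + \sum_(i <- r) H i t.
  by apply/funext => t; rewrite big_cons.
by rewrite !e; exact: cderivableD.
Qed.

Lemma periodic_reduce (U : Type) (f : R -> U) (T : R) : 0 < T ->
  (forall t, f (t + T) = f t) -> forall t, exists2 r, 0 <= r <= T & f t = f r.
Proof.
move=> T0 pf t; pose n := Num.floor (t / T).
have pn (k : nat) s : f (s + k%:R * T) = f s.
  elim: k s => [|k IH] s; first by rewrite mul0r addr0.
  by rewrite -natr1 mulrDl mul1r addrA pf.
exists (t - n%:~R * T).
  have /andP[h1 h2] := floor_itv (t / T).
  move: h1 h2; rewrite -/n ler_pdivlMr// ltr_pdivrMr// intrD mulrDl mul1r => h1 h2.
  by apply/andP; split; lra.
case: n => k; first by rewrite -[in RHS](pn k) subrK.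
by rewrite NegzE mulrNz mulNr opprK pn.
Qed.

End PeriodicFunctions.

(** * The coefficient and its time derivatives *)

Section Coefficient.
Context {R : realType} {d : nat} (D : set 'rV[R]_d) (hD : bounded_set D).
Context (T : R) (hT : 0 < T) (kappa : R -> 'rV[R]_d -> R).
Local Notation mu := (bounded_vol hD).
Local Notation leb := (@lebesgue_measure R).
Local Notation Linf a := (Lnorm mu +oo%E (EFin \o a)).

Lemma coefficient_coercive : admissible_coefficient D T kappa ->
  exists2 c0 : R, 0 < c0 & \forall t \ae leb, 0 <= t <= T ->
    \forall x \ae mu, c0 <= kappa t x.
Proof.
move=> [mk _ k0 _].
have [c0 c00 hc0] : exists2 c0 : R, 0 < c0 & (c0%:E <= kappa_inf D T kappa)%E.
  (* If the essential infimum is [+oo], any positive constant serves. *)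
  move: k0; case: (kappa_inf D T kappa) => [r|_|//]; last by exists 1; rewrite ?leey.
  by rewrite lte_fin => r0; exists r.
exists c0 => //.
pose A := [set p : caratheodory_type (vol_outer D) * measurableTypeR R |
  (0 <= p.2 <= T) /\ kappa p.2 p.1 < c0].
have mA : measurable A.
  have -> : A = ((setT `*` `[0, T]) `&` (fun p => kappa p.2 p.1) @^-1` [set r | r < c0]).
    by apply/seteqP; split => p /=; rewrite in_itv/=; [move=> [? ?]|move=> [[_ ?] ?]].
  apply: measurableI; first exact: measurable_cylinder.
  rewrite -[_ @^-1` _]setTI; apply: mk => //.
  by rewrite (_ : [set r | r < c0] = `]-oo, c0[%classic)//; apply/seteqP; split=> r; rewrite /= in_itv.
have A0 : ((mu \x leb) A = 0)%E.
  have [N [mN N0 hN]] := elimT ess_infP hc0.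
  have mNT : measurable (N `&` ([set: caratheodory_type (vol_outer D)] `*`
      (`[0, T] : set (measurableTypeR R)))).
    by apply: measurableI => //; exact: measurable_cylinder.
  apply: (subset_measure0 mA mNT _ N0) => p [pT pk]; split.
    by apply: hN => /=; rewrite lee_fin leNgt pk.
  by split => //=; rewrite in_itv.
have := ae_ysection_null mA A0; apply: filterS => t A0t t0T.
exists (ysection A t); split => //; first exact: measurable_ysection.
move=> x /= hx; apply/mem_set; split => //=.
by rewrite ltNge; apply/negP.
Qed.

Definition Linf_curve (k : R -> 'rV[R]_d -> R) := (forall t, k t \in Lfun mu +oo%E) /\
  forall t, Linf (k s \- k t) @[s --> t] --> 0%E.

Definition Linf_derivative (k k1 : R -> 'rV[R]_d -> R) := forall t,
  Linf (fun x => s^-1 * (k (t + s) x - k t x) - k1 t x) @[s --> 0^'] --> 0%E.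

Lemma C3_coefficient : Ck_Linf D 3 kappa -> Linf_curve kappa /\
  exists k1 k2 k3, [/\ Linf_curve k1, Linf_curve k2 & Linf_curve k3] /\
    [/\ Linf_derivative kappa k1, Linf_derivative k1 k2 & Linf_derivative k2 k3].
Proof.
move=> [L0 c0 [k1 [d1 [L1 c1 [k2 [d2 [L2 c2 [k3 [d3 [L3 c3 _]]]]]]]]]].
by split => //; exists k1, k2, k3.
Qed.

Lemma Linf_curve_ae_bounded k : Linf_curve k ->
  exists2 M : R, 0 <= M & forall t, 0 <= t <= T -> ae_bounded mu M (k t).
Proof.
move=> [Lk ck]; have [M M0 hM] := Linf_curve_bounded (ltW hT) Lk ck.
by exists M => // t /hM; exact: Linf_ae_bounded.
Qed.

End Coefficient.

(** * The gradient form and its weighted versions *)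

Section GradientForms.
Context {disp : measure_display} {S : measurableType disp} {R : realType}.
Variable mu : {finite_measure set S -> \bar R}.
Local Notation C := R[i].
Local Notation leb := (@lebesgue_measure R).
Context {V : lmodType C} {d : nat} (G : 'I_d -> V -> S -> C).
Context (G_linear : forall i a u v x, G i (a *: u + v) x = a * G i u x + G i v x).
Context (G_L2 : forall i v, L2 mu (G i v)).
Implicit Types (k : R -> S -> R) (a : S -> R) (v w : V).
Local Notation Linf a := (Lnorm mu +oo%E (EFin \o a)).

Definition gradient_form v w : C := \sum_i inner mu (G i v) (G i w).
Definition stiffness a v w : C := \sum_i inner mu (G i v) (weighted a (G i w)).

Lemma gradient_form_positive : positive_form gradient_form.
Proof.
split; last by move=> v; apply: sumr_ge0 => i _; exact: inner_ge0.
apply: hermitian_form_sum => i; exact: (inner_positive_form (G_linear i) (G_L2 i)).1.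
Qed.

Lemma stiffness_hermitian A a : ae_bounded mu A a -> hermitian_form (stiffness a).
Proof.
by move=> ba; apply: hermitian_form_sum => i; exact: (weighted_hermitian (G_linear i) (G_L2 i) ba).
Qed.

(** Componentwise only the diagonal is estimated; [hermitian_le] extends the bound off the diagonal
    at the cost of the factor 2. *)
Lemma stiffness_le A a v w : ae_bounded mu A a ->
  `|stiffness a v w| <= (2 * A * (fnorm gradient_form v * fnorm gradient_form w))%:C.
Proof.
move=> ba; apply: hermitian_le gradient_form_positive (stiffness_hermitian ba) _ _ _ => {v w} v.
rewrite /stiffness /gradient_form !Re_sum mulr_sumr; apply: le_trans (ler_norm_sum _ _ _) _.
by apply: ler_sum => i _; exact: weighted_diag_le.
Qed.

Lemma stiffness_ge A c a v : ae_bounded mu A a -> (\forall x \ae mu, c <= a x) ->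
  c * Re (gradient_form v v) <= Re (stiffness a v v).
Proof.
move=> ba ca; rewrite /stiffness /gradient_form !Re_sum mulr_sumr.
by apply: ler_sum => i _; exact: weighted_diag_ge ba ca.
Qed.

Lemma ccontinuous_stiffness k v w : (forall t, k t \in Lfun mu +oo%E) ->
  (forall t, Linf (k s \- k t) @[s --> t] --> 0%E) ->
  ccontinuous (fun t => stiffness (k t) v w).
Proof.
by move=> Lk ck; apply: ccontinuous_sum => i; exact: weighted_ccontinuous.
Qed.

Lemma cderivable_stiffness k k1 v w : (forall t, k t \in Lfun mu +oo%E) ->
  (forall t, k1 t \in Lfun mu +oo%E) ->
  (forall t, Linf (fun x => s^-1 * (k (t + s) x - k t x) - k1 t x) @[s --> 0^'] --> 0%E) ->
  cderivable (fun t => stiffness (k t) v w) (fun t => stiffness (k1 t) v w).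
Proof.
by move=> Lk Lk1 dk; apply: cderivable_sum => i; exact: weighted_cderivable.
Qed.

Lemma stiffness_ae_eq A a b v w : ae_bounded mu A a -> ae_bounded mu A b ->
  (\forall x \ae mu, a x = b x) -> stiffness a v w = stiffness b v w.
Proof.
move=> ba bb ab; apply: eq_bigr => i _.
have [i1 i2] := L2_integrable (G_L2 i v) (G_L2 i w).
rewrite (weighted_integrable ba (G_L2 i v) (G_L2 i w)).2.
rewrite (weighted_integrable bb (G_L2 i v) (G_L2 i w)).2.
have [_ ma _] := ba; have [_ mb _] := bb.
have key p : mu.-integrable setT (EFin \o p) ->
    \int[mu]_x (a x * p x) = \int[mu]_x (b x * p x).
  move=> /integrableP[/measurable_EFinP mp _]; rewrite /Rintegral; congr fine.
  apply: ae_eq_integral => //; try by apply/measurable_EFinP; exact: measurable_funM.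
  by apply: filterS ab => x -> _.
by congr (_ +i* _); exact: key.
Qed.

(** The lower bound on the coefficient holds at almost every time; continuity of the form in time
    extends its consequence to every time. *)
Lemma stiffness_coercive k (T c : R) : 0 < T -> (forall t, k t \in Lfun mu +oo%E) ->
  (forall t, Linf (k s \- k t) @[s --> t] --> 0%E) ->
  (\forall t \ae leb, 0 <= t <= T -> \forall x \ae mu, c <= k t x) ->
  forall t v, 0 <= t <= T -> c * Re (gradient_form v v) <= Re (stiffness (k t) v v).
Proof.
move=> T0 Lk ck kc t v t0T; rewrite -subr_ge0.
pose h t := Re (stiffness (k t) v v) - c * Re (gradient_form v v).
apply: (ae_continuous_ge0 (h := h) T0 _ _ t0T).
  move=> s; have cs := (ccontinuous_stiffness v v Lk ck).1 s.
  exact: (continuousB cs (@cst_continuous _ _ (c * Re (gradient_form v v)) s)).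
apply: (filterS (Filter := ae_filter_ringOfSetsType leb) _ kc) => s hs /hs ca; rewrite subr_ge0.
by have [_ bs] := Lfun_Linf (Lk s); exact: stiffness_ge bs ca.
Qed.

Lemma fourier_stiffness k (T M : R) (I : finType) (l : I -> int) v (w : I -> V) : 0 < T ->
  measurable_fun setT (fun p : S * measurableTypeR R => k p.2 p.1) ->
  (forall t, k t \in Lfun mu +oo%E) ->
  (forall t, Linf (k s \- k t) @[s --> t] --> 0%E) ->
  (forall t, 0 <= t <= T -> ae_bounded mu M (k t)) ->
  \sum_i inner mu (G i v) (fun x => \sum_j fourier_coefficient k T (l j) x * G i (w j) x) =
  \sum_j coef T (fun t => stiffness (k t) v (w j)) (l j).
Proof.
move=> T0 mk Lk ck bk.
have cw i j : ccontinuous (fun t => inner mu (G i v) (weighted (k t) (G i (w j)))).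
  exact: weighted_ccontinuous.
transitivity (\sum_i \sum_j
    coef T (fun t => inner mu (G i v) (weighted (k t) (G i (w j)))) (l j)).
  apply: eq_bigr => i _.
  have h j := inner_fourier T0 mk Lk ck bk (l j) (G_L2 i v) (G_L2 i (w j)).
  have [_ e] := cintegral_sum (mu := mu) (index_enum I) (fun j => (h j).1).
  transitivity (\sum_j inner mu (G i v) (fun x => fourier_coefficient k T (l j) x * G i (w j) x)).
    rewrite /inner -e; congr cintegral; apply/funext => x; exact: mulr_sumr.
  by apply: eq_bigr => j _; exact: (h j).2.
rewrite exchange_big; apply: eq_bigr => j _; rewrite /coef -(mean_sum T0).
  by apply: eq_mean => t _; rewrite mulr_suml.
by move=> i; apply: ccontinuousM => //; exact: ccontinuous_mode.
Qed.

End GradientForms.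

Lemma inner_eq0 {disp : measure_display} {S : measurableType disp} {R : realType}
    (mu : {measure set S -> \bar R}) (f : S -> R[i]) : L2 mu f ->
  Re (inner mu f f) = 0 -> \forall x \ae mu, f x = 0.
Proof.
move=> hf; have [i1 _] := L2_integrable hf hf; rewrite /inner /cintegral/= => h0.
have /integrableP[m1 _] := i1.
have sq x : Re ((f x)^* * f x) = Re (f x) ^+ 2 + Im (f x) ^+ 2.
  by rewrite Re_mul Re_conjc Im_conjc; ring.
have : (\int[mu]_x `|(Re ((f x)^* * f x))%:E| = 0)%E.
  have := integrable_fin_num measurableT i1; move: h0; rewrite /Rintegral => h0 hfin.
  rewrite -[RHS]/(0%:E) -h0 fineK//; apply: eq_integral => x _.
  by rewrite gee0_abs// lee_fin sq addr_ge0 ?sqr_ge0.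
move=> /(ae_eq_integral_abs mu measurableT m1).
apply: filterS => x /(_ I) [] /eqP; rewrite sq paddr_eq0 ?sqr_ge0// !sqrf_eq0.
by move=> /andP[/eqP h1 /eqP h2]; apply: complex_eqP.
Qed.

(** * The finite-dimensional space *)

Section Reconstruction.
Context {R : realType} {d : nat} (D : set 'rV[R]_d) (hD : bounded_set D).
Context (N : nat) (b : 'I_N -> H1fun R d) (hb : forall j, H1 D (b j)).
Context (b_free : forall c : 'I_N -> R[i],
  {ae vol D, forall x, fn (\sum_j c j *: b j) x = 0} -> forall j, c j = 0).
Local Notation C := R[i].
Local Notation mu := (bounded_vol hD).
Implicit Types (v w : 'rV[C]_N).

(** Row vectors of coordinates form the vector space to which the abstract estimates are applied;
    independence of the basis almost everywhere makes [mass] definite on it. *)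
Definition recon v : H1fun R d := \sum_j v 0 j *: b j.

Lemma recon_linear (a : C) v w : recon (a *: v + w) = a *: recon v + recon w.
Proof.
rewrite /recon scaler_sumr -big_split; apply: eq_bigr => j _.
by rewrite !mxE scalerDl scalerA.
Qed.

Lemma reconD v w : recon (v + w) = recon v + recon w.
Proof. by rewrite -[v in LHS]scale1r recon_linear scale1r. Qed.

Lemma reconZ (a : C) v : recon (a *: v) = a *: recon v.
Proof.
have r0 : recon 0 = 0 by apply: big1 => j _; rewrite mxE scale0r.
by rewrite -[a *: v]addr0 recon_linear r0 addr0.
Qed.

Lemma reconB v w : recon (v - w) = recon v - recon w.
Proof. by rewrite -scaleN1r reconD reconZ scaleN1r. Qed.

Lemma recon_sum (I : finType) (F : I -> 'rV[C]_N) : recon (\sum_i F i) = \sum_i recon (F i).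
Proof.
apply: (big_morph recon reconD).
by apply: big1 => j _; rewrite mxE scale0r.
Qed.

Lemma recon_L2 v : [/\ L2 mu (fn (recon v)), forall i, L2 mu (grad (recon v) i) &
  L2 (surf D) (trace (recon v))].
Proof.
have L20 disp (S : measurableType disp) (nu : {measure set S -> \bar R}) :
    L2 nu (fun=> (0 : C)).
  have [h _] := Lfun_submod_closed nu (lee1n 2 : (1 <= 2%:E)%E); by split.
apply: (big_ind (fun u : H1fun R d => [/\ L2 mu (fn u), forall i, L2 mu (grad u i) &
    L2 (surf D) (trace u)])) => [|u1 u2 [h1 h2 h3] [h4 h5 h6]|j _].
- by split=> [|i|]; [exact: (L20 _ _ mu)|exact: (L20 _ _ mu)|exact: (L20 _ _ (surf D))].
- split=> [|i|]; [exact: (L2D h1 h4)|exact: (L2D (h2 i) (h5 i))|exact: (L2D h3 h6)].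
- have [h1 h2 h3 _ _] := hb j.
  split=> [|i|]; [exact: (L2Z (v 0 j) h1)|exact: (L2Z (v 0 j) (h2 i))|exact: (L2Z (v 0 j) h3)].
Qed.

Definition mass v w : C := inner mu (fn (recon v)) (fn (recon w)).
Definition boundary_mass v w : C := inner (surf D) (trace (recon v)) (trace (recon w)).
Definition recon_grad (i : 'I_d) v : 'rV[R]_d -> C := grad (recon v) i.

Lemma mass_positive : positive_form mass.
Proof.
have lin a v w x : fn (recon (a *: v + w)) x = a * fn (recon v) x + fn (recon w) x.
  by rewrite recon_linear.
have l2 v : L2 mu (fn (recon v)) by have [] := recon_L2 v.
exact: (inner_positive_form (mu := mu) lin l2).
Qed.

Lemma boundary_mass_positive : positive_form boundary_mass.
Proof.
have lin a v w x : trace (recon (a *: v + w)) x = a * trace (recon v) x + trace (recon w) x.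
  by rewrite recon_linear.
have l2 v : L2 (surf D) (trace (recon v)) by have [] := recon_L2 v.
exact: (inner_positive_form (mu := surf D) lin l2).
Qed.

Lemma recon_grad_linear i (a : C) v w x :
  recon_grad i (a *: v + w) x = a * recon_grad i v x + recon_grad i w x.
Proof. by rewrite /recon_grad recon_linear. Qed.

Lemma recon_grad_L2 i v : L2 mu (recon_grad i v).
Proof. by have [_ h _] := recon_L2 v; exact: h. Qed.

Lemma mass_definite v : fnorm mass v = 0 -> v = 0.
Proof.
move=> v0; have h0 : Re (mass v v) = 0.
  by rewrite -(fnorm_sqr mass_positive) v0 expr0n.
have [hv _ _] := recon_L2 v.
have h := b_free (inner_eq0 hv h0).
by apply/rowP => j; rewrite mxE; exact: h.
Qed.

Context (T : R) (hT : 0 < T) (kappa : R -> 'rV[R]_d -> R) (kap0 M : R) (K : nat).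
Context (mk : measurable_fun setT
  (fun p : caratheodory_type (vol_outer D) * measurableTypeR R => kappa p.2 p.1)).
Context (kappa_curve : Linf_curve hD kappa).
Context (bk : forall t, 0 <= t <= T -> ae_bounded mu M (kappa t)).

Definition recon_stiffness t v w : C := stiffness mu recon_grad (kappa t) v w.

Lemma inner_Tkappa_grad (U : 'I_(K.*2.+1) -> 'rV[C]_N) n v :
  inner_grad D (grad (recon v)) (Tkappa_grad T kappa (fun j => recon (U j)) n) =
  \sum_(j < K.*2.+1) form_coef T recon_stiffness v (U j) (n%:Z - j%:Z).
Proof.
have [Lk ck] := kappa_curve.
have e (j : 'I_(K.*2.+1)) : harm n - harm j = n%:Z - j%:Z.
  by rewrite /harm opprD opprK addrACA addNr addr0.
have := fourier_stiffness recon_grad_L2 (fun j : 'I_(K.*2.+1) => n%:Z - j%:Z) v U hT mk Lk ck bk.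
move=> <-; apply: eq_bigr => i _; congr inner; apply/funext => x.
by apply: eq_bigr => j _; rewrite e.
Qed.

Lemma recon_stiffness_hermitian t : hermitian_form (recon_stiffness t).
Proof.
have [_ bt] := Lfun_Linf (kappa_curve.1 t).
exact: (stiffness_hermitian (mu := mu) recon_grad_linear recon_grad_L2 bt).
Qed.

Lemma eigenmode_equation (X : set (H1fun R d)) (om : C) (U : 'I_(K.*2.+1) -> 'rV[C]_N) :
  X = range recon -> eigenmode D kap0 T kappa X om (fun n => recon (U n)) ->
  forall n v, exponent T om n ^+ 2 * mass v (U n) +
    \sum_(j < K.*2.+1) form_coef T recon_stiffness v (U j) (n%:Z - j%:Z) +
    kap0%:C * exponent T om n * boundary_mass v (U n) = 0.
Proof.
move=> XE [_ [z [Xz _ eq1 eq2]]].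
have /choice[Z zE] : forall n, exists w, recon w = z n.
  by move=> n; have := Xz n; rewrite XE => -[w _ <-]; exists w.
have {}zE : z = fun n => recon (Z n) by apply/funext => n; rewrite zE.
subst z.
have Xr w : X (recon w) by rewrite XE; exists w.
have hm := mass_positive; have hs := boundary_mass_positive.
have ZE n : Z n = exponent T om n *: U n.
  pose W n := exponent T om n *: U n - Z n.
  have eqW := eq1 (fun n => recon (W n)) (fun n => Xr (W n)).
  have s0 : \sum_j mass (W j) (W j) = 0.
    move: eqW => /eqP; rewrite -subr_eq0 => /eqP eqW; apply: etrans eqW.
    rewrite /innerK_D mulr_sumr -sumrB; apply: eq_bigr => j _.
    have -> : Dop T (fun n => recon (U n)) j - recon (Z j) =
        recon ((- iunit * ((harm j)%:~R * frequency T)%:C) *: U j - Z j).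
      by rewrite reconB reconZ.
    rewrite -[inner _ _ _]/(mass (W j) ((- iunit * ((harm j)%:~R * frequency T)%:C) *: U j - Z j)).
    rewrite -[inner (vol D) _ (fn (recon (U j)))]/(mass (W j) (U j)).
    rewrite -(hformZr hm.1) -(hformNr hm.1) -(hformDr hm.1); congr mass.
    rewrite /W /exponent mulrDr scalerDl mulNr scaleNr -addrA addrC; congr (_ - _).
  have W0 : mass (W n) (W n) = 0 by apply: (psumr_eq0P _ s0) => // j _; exact: hm.2.
  apply/eqP; rewrite eq_sym -subr_eq0; apply/eqP.
  by apply: mass_definite; rewrite /fnorm -[mass _ _]/(mass (W n) (W n)) W0 sqrtr0.
(* The second equation, tested with [v] in the harmonic [n] and 0 in all others, reduces to its
   [n]-th line. *)
move=> n v; pose eta j := if j == n then v else 0.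
have := eq2 (fun j => recon (eta j)) (fun j => Xr (eta j)).
have eta_sum (B : 'rV[C]_N -> 'I_(K.*2.+1) -> C) : (forall j, B 0 j = 0) ->
    \sum_j B (eta j) j = B v n.
  move=> B0; rewrite (bigD1 n)//= /eta eqxx big1 ?addr0// => j /negPf ->; exact: B0.
have -> : innerK_D D (fun j => recon (eta j)) (Dop T (fun j => recon (Z j))) =
    mass v ((- iunit * ((harm n)%:~R * frequency T)%:C) *: Z n).
  rewrite -(eta_sum (fun v j => mass v ((- iunit * ((harm j)%:~R * frequency T)%:C) *: Z j))).
    by apply: eq_bigr => j _; rewrite /mass reconZ.
  by move=> j; exact: hform0l hm.1 _.
have -> : innerK_grad D (gradK (fun j => recon (eta j)))
    (Tkappa_grad T kappa (fun j => recon (U j))) =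
    \sum_(j < K.*2.+1) form_coef T recon_stiffness v (U j) (n%:Z - j%:Z).
  rewrite -(eta_sum (fun v l => \sum_(j < K.*2.+1) form_coef T recon_stiffness v (U j) (l%:Z - j%:Z))).
    by apply: eq_bigr => l _; rewrite -inner_Tkappa_grad.
  move=> l; apply: big1 => j _; rewrite /form_coef /coef -[RHS](mean_cst hT).
  by apply: eq_mean => // t _; rewrite (hform0l (recon_stiffness_hermitian t)) mul0r.
have -> : innerK_bd D (fun j => recon (eta j)) (fun j => recon (Z j)) = boundary_mass v (Z n).
  rewrite -(eta_sum (fun v j => boundary_mass v (Z j)))//.
  by move=> j; exact: hform0l hs.1 _.
have -> : innerK_D D (fun j => recon (eta j)) (fun j => recon (Z j)) = mass v (Z n).
  rewrite -(eta_sum (fun v j => mass v (Z j)))//.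
  by move=> j; exact: hform0l hm.1 _.
rewrite ZE !(hformZr hm.1, hformZr hs.1) => /eqP; rewrite -subr_eq0 => /eqP h.
by apply: etrans h; rewrite /exponent; ring.
Qed.

End Reconstruction.

Lemma ae_bounded_le {disp : measure_display} {S : measurableType disp} {R : realType}
    (mu : {measure set S -> \bar R}) (A B : R) a :
  A <= B -> ae_bounded mu A a -> ae_bounded mu B a.
Proof.
move=> AB [A0 ma aA]; split => //; first exact: le_trans AB.
by apply: filterS aA => x /le_trans; apply.
Qed.

(** * The error of the semi-discrete solution, in coordinates *)

Section SemidiscreteError.
Context {R : realType} {d : nat} (D : set 'rV[R]_d) (hD : bounded_set D).
Context (T : R) (hT : 0 < T) (kappa k1 k2 k3 : R -> 'rV[R]_d -> R) (kap0 M c0 : R).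
Local Notation C := R[i].
Local Notation mu := (bounded_vol hD).
Context (mk : measurable_fun setT
  (fun p : caratheodory_type (vol_outer D) * measurableTypeR R => kappa p.2 p.1)).
Context (kappa_curve : Linf_curve hD kappa) (k1_curve : Linf_curve hD k1).
Context (k2_curve : Linf_curve hD k2) (k3_curve : Linf_curve hD k3).
Context (dk : Linf_derivative hD kappa k1) (dk1 : Linf_derivative hD k1 k2).
Context (dk2 : Linf_derivative hD k2 k3).
Context (bk : forall t, 0 <= t <= T -> ae_bounded mu M (kappa t)).
Context (bk1 : forall t, 0 <= t <= T -> ae_bounded mu M (k1 t)).
Context (bk3 : forall t, 0 <= t <= T -> ae_bounded mu M (k3 t)).
Context (pk : forall t, {ae vol D, forall x, kappa (t + T) x = kappa t x}).
Context (hc0 : 0 < c0) (kappa_ge : \forall t \ae (@lebesgue_measure R), 0 <= t <= T ->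
  \forall x \ae mu, c0 <= kappa t x).
Context (N : nat) (b : 'I_N -> H1fun R d) (hb : forall j, H1 D (b j)).
Context (b_free : forall c : 'I_N -> R[i],
  {ae vol D, forall x, fn (\sum_j c j *: b j) x = 0} -> forall j, c j = 0).
Implicit Types (v w : 'rV[C]_N) (k : R -> 'rV[R]_d -> R).
Local Notation recon := (recon b).
Local Notation mass := (mass hD b).
Local Notation form k := (recon_stiffness hD b k).
Local Notation grad_form := (gradient_form mu (recon_grad b)).

Lemma recon_stiffness_le k v w : Linf_curve hD k ->
  (forall v w t, form k (t + T) v w = form k t v w) ->
  (forall t, 0 <= t <= T -> ae_bounded mu M (k t)) ->
  forall t, `|form k t v w| <= (2 * M * (fnorm grad_form v * fnorm grad_form w))%:C.
Proof.
move=> Lk pf bf t; have [r hr ->] := periodic_reduce hT (pf v w) t.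
exact: (stiffness_le (mu := mu) (recon_grad_linear b) (recon_grad_L2 hD hb) v w (bf r hr)).
Qed.

Lemma recon_stiffness_derivative k l v w : Linf_curve hD k -> Linf_curve hD l ->
  Linf_derivative hD k l ->
  cderivable (fun t => form k t v w) (fun t => form l t v w).
Proof.
move=> [Lk ck] [Ll cl] dl.
exact: (cderivable_stiffness (mu := mu) (recon_grad_L2 hD hb) v w Lk Ll dl).
Qed.

Lemma recon_stiffness_periodic v w t : form kappa (t + T) v w = form kappa t v w.
Proof.
have [_ b1] := Lfun_Linf (kappa_curve.1 (t + T)).
have [_ b2] := Lfun_Linf (kappa_curve.1 t).
pose B := Num.max (fine (Lnorm mu +oo%E (EFin \o kappa (t + T)))) (fine (Lnorm mu +oo%E (EFin \o kappa t))).
apply: (stiffness_ae_eq (mu := mu) (A := B) (recon_grad_L2 hD hb)) (pk t).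
  by apply: ae_bounded_le b1; rewrite le_max lexx.
by apply: ae_bounded_le b2; rewrite le_max lexx orbT.
Qed.

(** Coordinates at nonnegative times suffice, since the filter of the difference quotients only sees
    [0 <= t + s]. *)
Lemma time_derivative_recon (f : R -> H1fun R d) (e : R -> 'rV[C]_N) t v : 0 <= t ->
  (forall s, 0 <= s -> f s = recon (e s)) ->
  time_derivative D f t (recon v) <-> curve_derivative mass e t v.
Proof.
move=> t0 fe.
have E : \forall s \near half_line t,
    normD D ((s^-1)%:C *: (f (t + s) - f t) - recon v) =
    fnorm mass ((s^-1)%:C *: (e (t + s) - e t) - v).
  rewrite /half_line near_withinE; apply: nearW => s /= s0.
  by rewrite (fe _ s0) (fe _ t0) -reconB -reconZ -reconB.
split=> h.
  by apply: cvg_trans h; apply: near_eq_cvg; apply: filterS E => s ->.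
by apply: cvg_trans h; apply: near_eq_cvg; apply: filterS E => s ->.
Qed.

(** Translates [evolution_estimate] back to functions. The squares stay in one sum, as each final
    estimate uses different summands; square integrability of the error is recorded for the passage
    to real parts. *)
Lemma semidiscrete_error (X : set (H1fun R d)) (Cinv c : R) (K : nat) (om : C)
    (uhat : harmonics K (H1fun R d)) (u u1 u2 : R -> H1fun R d) t :
  0 <= M -> 0 <= kap0 -> 0 < c -> c <= Cinv -> (0 < K)%N -> X = range recon ->
  (forall u, X u -> norm_grad D u <= Cinv * normD D u) ->
  eigenmode D kap0 T kappa X om uhat -> `|Re om| <= frequency T / 2 ->
  normK D uhat = 1 -> semidiscrete_solution D kap0 kappa X u u1 u2 ->
  u 0 = mode_sum T om uhat 0 -> time_derivative D (mode_sum T om uhat) 0 (u1 0) ->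
  0 <= t ->
  exists d1, [/\ X d1, time_derivative D (u \- mode_sum T om uhat) t d1,
    L2 mu (fn (u t - mode_sum T om uhat t)) &
    normD D d1 ^+ 2 + c0 * norm_grad D (u t - mode_sum T om uhat t) ^+ 2 +
      normD D (u t - mode_sum T om uhat t) ^+ 2 <=
    (evolution_const T (2 * M) c0 c t * (Cinv ^+ 4 / K%:R ^+ 2)) ^+ 2].
Proof.
move=> M0 kap00 c_gt0 cC K0 XE hinv eig hom hnorm hu hu0 hu1 t0.
have Xr w : X (recon w) by rewrite XE; exists w.
have Xrange f : X f -> exists w, recon w = f by rewrite XE => -[w _ <-]; exists w.
have /choice[U UE] : forall n, exists w, recon w = uhat n.
  by move=> n; apply: Xrange; case: eig => + _; exact.
have {}UE : uhat = fun n => recon (U n) by apply/funext => n; rewrite UE.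
subst uhat.
(* The solution lies in [X] at nonnegative times only; coordinates default to 0 elsewhere. *)
have ex (f : R -> H1fun R d) : (forall s, 0 <= s -> X (f s)) ->
    exists e : R -> 'rV[C]_N, forall s, 0 <= s -> f s = recon (e s).
  move=> Xf; have /choice[e eE] : forall s, exists w, 0 <= s -> recon w = f s.
    move=> s; have [s0|s0] := boolP (0 <= s); last by exists 0.
    by have [w wE] := Xrange _ (Xf s s0); exists w.
  by exists e => s s0; rewrite eE.
have [w wE] : exists e : R -> 'rV[C]_N, forall s, 0 <= s -> u s = recon (e s).
  by apply: ex => s /hu[[]].
have [w1 w1E] : exists e : R -> 'rV[C]_N, forall s, 0 <= s -> u1 s = recon (e s).
  by apply: ex => s /hu[[]].
have [w2 w2E] : exists e : R -> 'rV[C]_N, forall s, 0 <= s -> u2 s = recon (e s).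
  by apply: ex => s /hu[[]].
have modeE s : mode_sum T om (fun n => recon (U n)) s = recon (mode_curve T om U s).
  by rewrite recon_sum; apply: eq_bigr => n _; rewrite reconZ.
have hm := mass_positive hD hb; have hs := boundary_mass_positive hD hb.
have hg := gradient_form_positive (mu := mu) (recon_grad_linear b) (recon_grad_L2 hD hb).
have hf k : Linf_curve hD k -> forall t, hermitian_form (form k t).
  by move=> hk t'; exact: (recon_stiffness_hermitian hb hk).
have p0 := recon_stiffness_periodic.
have dk_form v w := recon_stiffness_derivative v w kappa_curve k1_curve dk.
have dk1_form v w := recon_stiffness_derivative v w k1_curve k2_curve dk1.
have dk2_form v w := recon_stiffness_derivative v w k2_curve k3_curve dk2.
have p1 v w := cderivable_periodic (dk_form v w) (p0 v w).
have p2 v w := cderivable_periodic (dk1_form v w) (p1 v w).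
have p3 v w := cderivable_periodic (dk2_form v w) (p2 v w).
have coer r v : c0 * Re (grad_form v v) <= Re (form kappa r v v).
  have [q hq ->] := periodic_reduce hT (p0 v v) r.
  exact: (stiffness_coercive (mu := mu) (recon_grad_L2 hD hb) hT kappa_curve.1 kappa_curve.2 kappa_ge).
have ck3 v w' : ccontinuous (fun t => form k3 t v w').
  exact: (ccontinuous_stiffness (mu := mu) (recon_grad_L2 hD hb) v w' k3_curve.1 k3_curve.2).
have b0 r v w' := recon_stiffness_le v w' kappa_curve p0 bk r.
have b1 r v w' := recon_stiffness_le v w' k1_curve p1 bk1 r.
have b3 r v w' := recon_stiffness_le v w' k3_curve p3 bk3 r.
have hinv' v : fnorm grad_form v <= Cinv * fnorm mass v by exact: hinv (Xr v).
have M2 : 0 <= 2 * M by rewrite mulr_ge0.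
have hu1' : \sum_n fnorm mass (U n) ^+ 2 = 1.
  transitivity (normK D (fun n => recon (U n)) ^+ 2); last by rewrite hnorm expr1n.
  have E : innerK_D D (fun n => recon (U n)) (fun n => recon (U n)) = \sum_n mass (U n) (U n).
    by [].
  rewrite /normK E Re_sum sqr_sqrtr; last by apply: sumr_ge0 => n _; exact: Re_form_ge0.
  by apply: eq_bigr => n _; exact: fnorm_sqr.
have heq := eigenmode_equation hb b_free hT mk kappa_curve bk XE eig.
have dw r : 0 <= r -> curve_derivative mass w r (w1 r).
  move=> r0; have [_ h _ _] := hu r r0; rewrite (w1E r r0) in h.
  exact: (proj1 (time_derivative_recon (w1 r) r0 wE) h).
have dw1 r : 0 <= r -> curve_derivative mass w1 r (w2 r).
  move=> r0; have [_ _ h _] := hu r r0; rewrite (w2E r r0) in h.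
  exact: (proj1 (time_derivative_recon (w2 r) r0 w1E) h).
have weq r v : 0 <= r ->
    mass v (w2 r) + form kappa r v (w r) + kap0%:C * boundary_mass D b v (w1 r) = 0.
  move=> r0; have [_ _ _ h] := hu r r0; have := h _ (Xr v).
  by rewrite (wE r r0) (w1E r r0) (w2E r r0).
have inj v v' : recon v = recon v' -> v = v'.
  move=> e; apply/eqP; rewrite -subr_eq0; apply/eqP; apply: (mass_definite (hD := hD) hb b_free).
  have e0 : recon (v - v') = recon 0 by rewrite reconB e subrr -[0 in RHS](subrr 0) reconB subrr.
  by rewrite /fnorm /mass e0 -[inner _ _ _]/(mass 0 0) (hform0r hm.1) sqrtr0.
have w00 : w 0 = mode_curve T om U 0 by apply: inj; rewrite -(wE 0 (lexx 0)) hu0 modeE.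
(* Both are derivatives at 0 of the mode sum, so they agree by definiteness of the mass form. *)
have w10 : w1 0 = mode_curve1 T om U 0.
  apply: (curve_derivative_unique hm half_line0_proper (mass_definite hb b_free)).
    rewrite (w1E 0 (lexx 0)) in hu1.
    exact: (proj1 (time_derivative_recon (w1 0) (lexx 0) (fun s _ => modeE s)) hu1).
  exact: mode_curve_derivative.
have est := evolution_estimate hT hm hg hs (hf _ kappa_curve) (hf _ k1_curve) hc0 coer
  dk_form dk1_form dk2_form ck3 p0 p1 p2 M2 b0 b1 b3 hinv' kap00 c_gt0 cC K0 hom hu1' heq
  t0 dw dw1 weq w00 w10.
exists (recon (w1 t - mode_curve1 T om U t)); split.
- exact: Xr.
- have dE s : 0 <= s ->
      (u \- mode_sum T om (fun n => recon (U n))) s = recon (w s - mode_curve T om U s).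
    by move=> s0; rewrite reconB -(wE s s0) -modeE.
  apply: (proj2 (time_derivative_recon (w1 t - mode_curve1 T om U t) t0 dE)).
  by apply: (curve_derivativeB hm (dw t t0)); exact: mode_curve_derivative.
- rewrite (wE t t0) modeE -reconB.
  by have [h _ _] := recon_L2 hD hb (w t - mode_curve T om U t); exact: h.
rewrite (wE t t0) modeE -reconB; exact: est.
Qed.

End SemidiscreteError.

(** * Real parts, the period map and the final estimates *)

(** The minus sign fits the second estimate, whose integrand is minus the real part of the error at
    time [T]. *)
Lemma norm2_Re_le {disp : measure_display} {S : measurableType disp} {R : realType}
    (mu : {measure set S -> \bar R}) (f : S -> R[i]) : L2 mu f ->
  norm2 mu (fun x => (- Re (f x))%:C) <= norm2 mu f.
Proof.
move=> hf; have [i1 _] := L2_integrable hf hf.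
have i2 : mu.-integrable setT (EFin \o (fun x => Re (f x) * Re (f x))).
  by have [f1 _] := hf; apply/Lfun1_integrable; exact: Lfun2_mul_Lfun1.
rewrite /norm2 ler_wsqrtr//.
have -> : Re (inner mu (fun x => (- Re (f x))%:C) (fun x => (- Re (f x))%:C)) =
    \int[mu]_x (Re (f x) * Re (f x)).
  by apply: eq_Rintegral => x _; rewrite Re_mul Re_conjc Im_conjc/= oppr0 mul0r subr0 mulrNN.
apply: le_Rintegral => // x _.
by rewrite Re_mul Re_conjc Im_conjc mulNr opprK lerDl -expr2 sqr_ge0.
Qed.

Lemma mode_sum_period (R : realType) (d K : nat) (T : R) (om : R[i])
    (uhat : harmonics K (H1fun R d)) : 0 < T ->
  mode_sum T om uhat T = cexp (- iunit * om * T%:C) *: mode_sum T om uhat 0.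
Proof.
move=> T0; rewrite /mode_sum scaler_sumr; apply: eq_bigr => n _.
rewrite mulr0 cexp0 scale1r mulrDr mulrDl cexpD.
have -> : cexp (- iunit * ((harm n)%:~R * frequency T)%:C * T%:C) = mode T (- harm n) T.
  by rewrite /mode; congr cexp; rewrite intrN !(mulNr, rmorphN)/=; ring.
by rewrite mode_period// mulr1.
Qed.

Theorem proposition4p1 (R : realType) (d : nat) (hd : (0 < d)%N)
    (D : set 'rV[R]_d) (hD : bounded_lipschitz_domain D)
    (kappa0 : R) (hkappa0 : 0 < kappa0) (T : R) (hT : 0 < T)
    (kappa : R -> 'rV[R]_d -> R) (hkappa : admissible_coefficient D T kappa)
    (hkappa3 : Ck_per_Linf D 3 T kappa)
    (t : R) (ht : 0 <= t) (c : R) (hc : 0 < c) :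
  exists C : R,
  forall (X : R -> set (H1fun R d)) (Cinv : R -> R)
    (hX : forall h, 0 < h -> fin_dim_subspace D (X h))
    (hinv : forall h, 0 < h -> forall u, X h u ->
       norm_grad D u <= Cinv h * normD D u)
    (hCinv : Cinv h @[h --> 0^'+] --> +oo)
    (h : R) (hh : 0 < h) (hch : c <= Cinv h)
    (K : nat) (hK : (0 < K)%N)
    (omega : R[i]) (uhat : harmonics K (H1fun R d))
    (heig : eigenmode D kappa0 T kappa (X h) omega uhat)
    (homega : - (frequency T / 2) < complex.Re omega <= frequency T / 2)
    (hnorm : normK D uhat = 1)
    (u u1 u2 : R -> H1fun R d)
    (hu : semidiscrete_solution D kappa0 kappa (X h) u u1 u2)
    (hu0 : u 0 = mode_sum T omega uhat 0)
    (hu1 : time_derivative D (mode_sum T omega uhat) 0 (u1 0)),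
  (exists d1 : H1fun R d,
     [/\ X h d1, time_derivative D (u \- mode_sum T omega uhat) t d1 &
         normD D d1 + norm_grad D (u t - mode_sum T omega uhat t)
           <= C * (Cinv h ^+ 4 / K%:R ^+ 2)]) /\
  norm2 (vol D) (fun x =>
      (complex.Re (fn (u 0) x * cexp (- iunit * omega * T%:C))
       - complex.Re (fn (u T) x))%:C)
    <= C * (Cinv h ^+ 4 / K%:R ^+ 2).
Proof.
have hDb : bounded_set D by case: hD.
have [mk _ _ _] := hkappa; have [hC3 pk] := hkappa3.
have [c0 c00 kge] := coefficient_coercive hDb hkappa.
have [v0 [k1 [k2 [k3 [[v1 v2 v3] [d0 d1 d2]]]]]] := C3_coefficient hDb hC3.
have [M0 M00 b0] := Linf_curve_ae_bounded hT v0.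
have [M1 M10 b1] := Linf_curve_ae_bounded hT v1.
have [M3 M30 b3] := Linf_curve_ae_bounded hT v3.
(* A common bound for the coefficient and its first and third time derivatives. *)
pose M := M0 + M1 + M3.
have hM : 0 <= M by rewrite !addr_ge0.
have {}b0 s : 0 <= s <= T -> ae_bounded (bounded_vol hDb) M (kappa s).
  by move=> /b0; apply: ae_bounded_le; rewrite /M -addrA lerDl addr_ge0.
have {}b1 s : 0 <= s <= T -> ae_bounded (bounded_vol hDb) M (k1 s).
  by move=> /b1; apply: ae_bounded_le; rewrite /M addrAC lerDr addr_ge0.
have {}b3 s : 0 <= s <= T -> ae_bounded (bounded_vol hDb) M (k3 s).
  by move=> /b3; apply: ae_bounded_le; rewrite /M lerDr addr_ge0.
pose Y s := `|evolution_const T (2 * M) c0 c s|.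
have Y0 s : 0 <= Y s by exact: normr_ge0.
have s0 : 0 < Num.sqrt c0 by rewrite sqrtr_gt0.
(* Velocity and gradient error at time [t], then the L^2 error at time [T]; the absolute value in
   [Y] makes all three summands nonnegative, so each estimate may discard the others. *)
exists (Y t + Y t / Num.sqrt c0 + Y T).
move=> X Cinv hX hinv _ h hh hch K hK omega uhat heig homega hnorm u u1 u2 hu hu0 hu1.
have [N [b [hb bfree XE]]] := hX h hh.
pose q := Cinv h ^+ 4 / K%:R ^+ 2.
have q0 : 0 <= q by rewrite /q divr_ge0 ?exprn_even_ge0.
have XE' : X h = range (recon b).
  rewrite XE; apply/seteqP; split => w /=.
    move=> [a ->]; exists (\row_j a j) => //.
    by apply: eq_bigr => j _; rewrite mxE.
  by move=> [v _ <-]; exists (fun j => v 0 j).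
have hom : `|Re omega| <= frequency T / 2.
  by move: homega => /andP[h1 h2]; rewrite ler_norml h2 ltW.
have err s := semidiscrete_error (t := s) hT mk v0 v1 v2 v3 d0 d1 d2 b0 b1 b3 pk c00 kge
  hb bfree hM (ltW hkappa0) hc hch hK XE' (hinv h hh) heig hom hnorm hu hu0 hu1.
have sqr_le (x y : R) : 0 <= x -> x ^+ 2 <= (y * q) ^+ 2 -> x <= `|y| * q.
  by move=> x0; rewrite -ler_sqrt ?sqr_ge0// !sqrtr_sqr normrM (ger0_norm x0) (ger0_norm q0).
split.
  have [e1 [Xe de _ he]] := err t ht; rewrite -/q in he.
  exists e1; split => //.
  set a := normD D e1 in he *; set g := norm_grad D _ in he *; set z := normD D _ in he.
  have a0 : 0 <= a by exact: sqrtr_ge0.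
  have g0 : 0 <= g by exact: sqrtr_ge0.
  have gg : 0 <= c0 * g ^+ 2 := mulr_ge0 (ltW c00) (sqr_ge0 g).
  have aa := sqr_ge0 a; have zz := sqr_ge0 z.
  have h1 : a <= Y t * q by apply: sqr_le => //; lra.
  have h2 : Num.sqrt c0 * g <= Y t * q.
    apply: sqr_le; first exact: mulr_ge0 (ltW s0) g0.
    by rewrite exprMn sqr_sqrtr ?(ltW c00)//; lra.
  have h3 : g <= Y t / Num.sqrt c0 * q.
    by rewrite mulrAC ler_pdivlMr// mulrC.
  have h4 : 0 <= Y T * q := mulr_ge0 (Y0 T) q0.
  by rewrite -/q !mulrDl; lra.
have [e1 [_ _ L2e he]] := err T (ltW hT); rewrite -/q in he.
set e := u T - mode_sum T omega uhat T in L2e he.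
have -> : (fun x => (complex.Re (fn (u 0) x * cexp (- iunit * omega * T%:C)) -
    complex.Re (fn (u T) x))%:C) = fun x => (- Re (fn e x))%:C.
  apply/funext => x; congr (_%:C).
  have -> : fn e x = fn (u T) x - fn (mode_sum T omega uhat T) x by [].
  rewrite mode_sum_period// -hu0.
  have -> : fn (cexp (- iunit * omega * T%:C) *: u 0) x =
      cexp (- iunit * omega * T%:C) * fn (u 0) x by [].
  by rewrite Re_add Re_opp opprB mulrC.
apply: le_trans (norm2_Re_le (mu := vol D) L2e) _.
have z0 : 0 <= normD D e by exact: sqrtr_ge0.
have gg : 0 <= c0 * norm_grad D e ^+ 2 := mulr_ge0 (ltW c00) (sqr_ge0 _).
have aa := sqr_ge0 (normD D e1).
have h1 : normD D e <= Y T * q by apply: sqr_le => //; lra.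
apply: (le_trans h1); rewrite -/q; apply: ler_wpM2r => //.
by rewrite lerDr; apply: addr_ge0 => //; exact: divr_ge0 (Y0 t) (ltW s0).
Qed.
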